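(* Assume that $\infty$ is regular. Let $(p_{ij}(t))_{i,j\in\mathbb N}$ be a $Q$-process which is not the minimal one. Then it is symmetrizable if and only if there exists a constant $\kappa\in[0,\infty)$ such that $$p_{ij}(t)=p^\kappa_{ij}(t),\qquad t\ge0,\ i,j\in\mathbb N,$$ where $p^\kappa_{ij}(t)=\mathbf P_i(X^\kappa_t=j)$ and $X^\kappa$ is the Markov process on $\mathbb N\cup\{\infty\}$ associated with the regular Dirichlet form $(\mathscr E^\kappa,\mathscr F^\kappa)$. In particular, in this case the set of branching points of (the Ray-Knight compactification of) $(p_{ij}(t))_{i,j\in\mathbb N}$ is empty.
   Context: Setting. $\mathbb N=\{0,1,2,\dots\}$. Let $a_0=0$, $a_k>0$ ($k\ge1$), $b_k>0$ ($k\ge 0$), $q_k=a_k+b_k$, and let $Q=(q_{ij})_{i,j\in\mathbb N}$ be the tridiagonal matrix with $q_{kk}=-q_k$, $q_{k,k+1}=b_k$, $q_{k,k-1}=a_k$, all other entries $0$. A transition matrix $(p_{ij}(t))_{i,j\in\mathbb N,t\ge0}$ is a nonnegative semigroup of matrices with row sums $\le 1$; it is extended to an honest one (row sums $1$) on $\mathbb N\cup\{\partial\}$ by adding a trap $\partial$. It is standard if $\lim_{t\to0}p_{ij}(t)=\delta_{ij}$. A $Q$-process is a continuous-time Markov chain whose transition matrix is standard with $p_{ij}'(0)=q_{ij}$ for all $i,j\in\mathbb N$; two $Q$-processes with the same transition matrix are identified. The minimal $Q$-process has the smallest transition matrix: $p^{\min}_{ij}(t)\le p_{ij}(t)$ for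 every $Q$-process. A $Q$-process is symmetrizable if there is a (nonzero) $\sigma$-finite measure $m$ on $\mathbb N$ with $m(\{i\})p_{ij}(t)=m(\{j\})p_{ji}(t)$ for all $i,j\in\mathbb N$, $t\ge0$. Put $\mu_0=1$, $\mu_k=\frac{b_0\cdots b_{k-1}}{a_1\cdots a_k}$, $c_0=0$, $c_1=\frac1{2b_0}$, $c_k=\frac1{2b_0}+\sum_{i=2}^k\frac{a_1\cdots a_{i-1}}{2b_0b_1\cdots b_{i-1}}$ ($k\ge2$), $\sigma=\sum_{k\ge0}(c_{k+1}-c_k)\sum_{i=0}^k\mu_i$, $\lambda=\sum_{k\ge0}c_k\mu_k$. The boundary $\infty$ is regular if $\sigma<\infty$ and $\lambda<\infty$ (equivalently $\lim_kc_k+\sum_k\mu_k<\infty$). Dirichlet forms. $\mathbb N\cup\{\infty\}$ is the Alexandroff compactification of discrete $\mathbb N$; $\mu$ is the measure with $\mu(\{k\})=\mu_k$ and $\mu(\{\infty\})=0$. Let $\mathscr A^*(f,g)=\frac12\sum_{k\ge0}\frac{(f(k+1)-f(k))(g(k+1)-g(k))}{c_{k+1}-c_k}$ and $\mathscr G^*=\{f\in L^2(\mathbb N,\mu):\mathscr A^*(f,f)<\infty\}$. When $\infty$ is regular, $f(\infty):=\lim_kf(k)$ exists for $f\in\mathscr G^*$. For $\kappa\in[0,\infty)$ set $\mathscr F^\kappa=\mathscr G^*$, $\mathscr E^\kappa(f,g)=\mathscr A^*(f,g)+\kappa f(\infty)g(\infty)$; this is a regular Dirichlet form on $L^2(\mathbb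 N\cup\{\infty\},\mu)$, and $X^\kappa$ denotes the associated ($\mu$-symmetric) Markov process on $\mathbb N\cup\{\infty\}$, with $\mathbf P_i$ its law started at $i$. Ray-Knight compactification and branching points. For a $Q$-process let $R_\alpha(i,A)=\int_0^\infty e^{-\alpha t}\sum_{j\in A}p_{ij}(t)\,dt$ on $\mathbb N\cup\{\partial\}$. Let $\mathbf F=\mathbb N\cup\{\infty\}\cup\{\partial\}$ with $\partial$ isolated. The Ray-Knight compactification is the càdlàg Ray process on $\mathbf F$ with Ray resolvent $\bar R_\alpha:C(\mathbf F)\to C(\mathbf F)$ determined by $\bar R_\alpha f(i)=\sum_{j\in\mathbb N\cup\{\partial\}}R_\alpha(i,\{j\})f(j)$ ($i\in\mathbb N\cup\{\partial\}$), $\bar R_\alpha f(\infty)=\lim_{i\to\infty}\bar R_\alpha f(i)$. A point $x\in\mathbf F$ is branching if it is not true that $\alpha\bar R_\alpha f(x)\to f(x)$ as $\alpha\to\infty$ for all $f\in C(\mathbf F)$. *)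

(* Defs.v *)
From HB Require Import structures.
From mathcomp Require Import all_boot all_order all_algebra.
From mathcomp Require Import all_classical all_reals all_analysis.

Set Implicit Arguments.
Unset Strict Implicit.
Unset Printing Implicit Defensive.

Import Order.TTheory GRing.Theory Num.Theory.
Import numFieldNormedType.Exports.

Local Open Scope classical_set_scope.
Local Open Scope ring_scope.

(* Time is a variable of type R; only its values t >= 0 are ever used. *)

(* A Markov process with countable state space T is represented by its        *)
(* (possibly non-honest) transition function P t x y = P_x(X_t = y).          *)
Definition transition_function (R : realType) (T : choiceType)
    (P : R -> T -> T -> R) : Prop :=
  [/\ forall t x y, 0 <= t -> 0 <= P t x y,
      forall t x, 0 <= t -> (\esum_(y in [set: T]) (P t x y)%:E <= 1)%E &
      forall s t x y, 0 <= s -> 0 <= t ->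
        (P (s + t) x y)%:E = (\esum_(z in [set: T]) (P s x z * P t z y)%:E)%E].

Section BirthDeathChain.
Context {R : realType}.
Variables a b : nat -> R.

Definition Qmatrix (i j : nat) : R :=
  if j == i then - (a i + b i)
  else if j == i.+1 then b i
  else if i == j.+1 then a i
  else 0.

Definition Q_process (p : R -> nat -> nat -> R) : Prop :=
  [/\ transition_function p,
      forall i j, p t i j @[t --> 0^'+] --> ((i == j)%:R : R) &
      forall i j, t^-1 * (p t i j - p 0 i j) @[t --> 0^'+] --> Qmatrix i j].

Definition minimal_Q_process (p : R -> nat -> nat -> R) : Prop :=
  Q_process p /\
  forall p', Q_process p' -> forall t i j, 0 <= t -> p t i j <= p' t i j.

Definition mu (k : nat) : R :=
  (\prod_(0 <= i < k) b i) / (\prod_(1 <= i < k.+1) a i).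

Definition c (k : nat) : R :=
  if k == 0%N then 0
  else (2 * b 0%N)^-1 +
       \sum_(2 <= i < k.+1)
          (\prod_(1 <= j < i) a j) / (2 * \prod_(0 <= j < i) b j).

Definition sigma : \bar R :=
  (\sum_(0 <= k <oo) ((c k.+1 - c k) * \sum_(0 <= i < k.+1) mu i)%:E)%E.

Definition lambda : \bar R := (\sum_(0 <= k <oo) (c k * mu k)%:E)%E.

Definition regular_boundary : Prop := (sigma < +oo)%E /\ (lambda < +oo)%E.

End BirthDeathChain.

Definition symmetrizable (R : realType) (p : R -> nat -> nat -> R) : Prop :=
  exists m : {measure set nat -> \bar R},
    [/\ sigma_finite [set: nat] m,
        m [set: nat] != 0%E &
        forall t i j, 0 <= t ->
          (m [set i] * (p t i j)%:E = m [set j] * (p t j i)%:E)%E].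

(* L^2 of a measure on nat charging every point; m k is the mass of {k}.      *)
Section L2.
Context {R : realType}.
Variable m : nat -> R.

Definition L2 : set (nat -> R) :=
  [set f | (\sum_(0 <= k <oo) (m k * f k ^+ 2)%:E < +oo)%E].

Definition L2dot (f g : nat -> R) : R :=
  limn (series (fun k => m k * f k * g k)).

Definition L2_contraction_semigroup (T : R -> (nat -> R) -> (nat -> R)) : Prop :=
  [/\ forall t f, 0 <= t -> L2 f -> L2 (T t f),
      forall t r f g, 0 <= t -> L2 f -> L2 g ->
        T t (fun k => r * f k + g k) = (fun k => r * T t f k + T t g k),
      forall t f, 0 <= t -> L2 f -> L2dot (T t f) (T t f) <= L2dot f f,
      (forall f, L2 f -> T 0 f = f) /\
      (forall s t f, 0 <= s -> 0 <= t -> L2 f -> T (s + t) f = T s (T t f)) &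
      forall f, L2 f ->
        L2dot (fun k => T t f k - f k) (fun k => T t f k - f k)
          @[t --> 0^'+] --> (0 : R)].

Definition L2_symmetric (T : R -> (nat -> R) -> (nat -> R)) : Prop :=
  forall t f g, 0 <= t -> L2 f -> L2 g -> L2dot (T t f) g = L2dot f (T t g).

(* The correspondence between symmetric strongly continuous contraction       *)
(* semigroups (T_t) and closed symmetric forms (dom, form) on L^2:            *)
(*   dom = {f | lim_{t->0} (f - T_t f, f) / t < oo},                          *)
(*   form f g = lim_{t->0} (f - T_t f, g) / t.                                *)
(* The quotient (f - T_t f, f) / t is monotone in t, so that finiteness of    *)
(* the limit is convergence in R.                                             *)
Definition semigroup_of_form (dom : set (nat -> R))
    (form : (nat -> R) -> (nat -> R) -> R)
    (T : R -> (nat -> R) -> (nat -> R)) : Prop :=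
  let quotient f g t := t^-1 * L2dot (fun k => f k - T t f k) g in
  [/\ L2_contraction_semigroup T,
      L2_symmetric T,
      dom = [set f | L2 f /\ cvg (quotient f f t @[t --> 0^'+])] &
      forall f g, dom f -> dom g -> quotient f g t @[t --> 0^'+] --> form f g].

End L2.

(* nat plus an extra point None; absolutely convergent sums are intended.     *)
Definition option_sum (R : realType) (g : option nat -> R) : R :=
  g None + limn (series (fun k => g (Some k))).

(* N with the point at infinity; None is oo.                                  *)
Notation Ninfty := (one_point_compactification nat).

Definition transition_op (R : realType) (P : R -> Ninfty -> Ninfty -> R)
    (t : R) (f : Ninfty -> R) (x : Ninfty) : R :=
  option_sum (fun y => P t x y * f y).

(* P is the transition function of the Markov (Hunt) process on Ninfty        *)
(* associated with the form (dom, form) on L^2(Ninfty, m), m({oo}) = 0.  As   *)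
(* every k : nat is charged, an element of L^2(Ninfty, m) is identified with  *)
(* its restriction to nat, and "P_t f is a version of T_t f" means equality   *)
(* on nat.  The value at oo is fixed by quasi-continuity of P_t f, t > 0; for *)
(* the forms formK below points have capacity bounded away from 0, so         *)
(* quasi-continuity is continuity.  P 0 x y encodes P_x(X_0 = x) = 1, and the *)
(* last clause is implied by right-continuity of paths.                       *)
Definition process_of_form (R : realType) (m : nat -> R)
    (dom : set (nat -> R)) (form : (nat -> R) -> (nat -> R) -> R)
    (P : R -> Ninfty -> Ninfty -> R) : Prop :=
  transition_function P /\
  (forall x y, P 0 x y = (x == y)%:R) /\
  (exists2 T, semigroup_of_form m dom form T &
     forall t (f : Ninfty -> R), 0 <= t -> bounded_fun f ->
       L2 m (f \o Some) ->
       transition_op P t f \o Some = T t (f \o Some)) /\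
  (forall t (f : Ninfty -> R), 0 < t -> bounded_fun f -> L2 m (f \o Some) ->
     continuous (transition_op P t f)) /\
  (forall (f : Ninfty -> R), continuous f ->
     forall x, transition_op P t f x @[t --> 0^'+] --> f x).

Section Forms.
Context {R : realType}.
Variables a b : nat -> R.

Definition formA (f g : nat -> R) : R :=
  2^-1 * limn (series (fun k =>
    (f k.+1 - f k) * (g k.+1 - g k) / (c a b k.+1 - c a b k))).

Definition domG : set (nat -> R) :=
  [set f | L2 (mu a b) f /\
    (\sum_(0 <= k <oo)
       ((f k.+1 - f k) ^+ 2 / (c a b k.+1 - c a b k))%:E < +oo)%E].

Definition formK (kappa : R) (f g : nat -> R) : R :=
  formA f g + kappa * limn f * limn g.

End Forms.

Section RayKnight.
Context {R : realType}.
Variable p : R -> nat -> nat -> R.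

(* The honest extension to N with a trap; here None is the trap.              *)
Definition honest_extension (t : R) (x y : option nat) : R :=
  match x, y with
  | Some i, Some j => p t i j
  | Some i, None => 1 - limn (series (p t i))
  | None, Some _ => 0
  | None, None => 1
  end.

Definition resolvent (alpha : R) (x y : option nat) : R :=
  \int[lebesgue_measure]_(t in `[0, +oo[)
    (expR (- alpha * t) * honest_extension t x y).

(* N with oo = Some None and the trap None.  The one-point extension of the   *)
(* compact space Ninfty adds an isolated point, so the trap is isolated.      *)
Definition RKspace : topologicalType := one_point_compactification Ninfty.

Definition to_RKspace (x : option nat) : RKspace :=
  if x is Some k then Some (Some k) else None.

Definition ray_resolvent (alpha : R) (f : RKspace -> R) (x : RKspace) : R :=
  let Rf i := option_sum (fun j => resolvent alpha i j * f (to_RKspace j)) in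
  match x with
  | Some (Some k) => Rf (Some k)
  | Some None => limn (fun k => Rf (Some k))
  | None => Rf None
  end.

Definition branching_points : set RKspace :=
  [set x | ~ forall f : RKspace -> R, continuous f ->
     alpha * ray_resolvent alpha f x @[alpha --> +oo] --> f x].

End RayKnight.

(* Main.v *)
Require Import Defs.
From mathcomp Require Import all_boot all_order all_algebra.
From mathcomp Require Import all_classical all_reals all_analysis measurable_realfun.
From mathcomp Require Import ring lra zify.
Import Order.TTheory GRing.Theory Num.Theory.
Import numFieldNormedType.Exports.
Local Open Scope classical_set_scope.
Local Open Scope ring_scope.

Set Implicit Arguments.
Unset Strict Implicit.
Unset Printing Implicit Defensive.

(** Reversibility forces the measure to be proportional to [mu]: divide the
    symmetry relation between neighbours by t and let t tend to 0.  So p acts as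
    a symmetric contraction semigroup T on L^2(mu), with approximating forms
    E_s(f, g) = s^-1 (f - T_s f, g), increasing as s decreases to 0.  Such a form
    splits into a jump part and a killing part.  The jump rates of p are those of
    Q, and the regularity of the boundary bounds oscillations by the energy
    formA, so T_t f has finite energy, hence a limit at infinity, for t > 0.

    The killing masses s^-1 (1 - T_s 1, 1) are monotone in s.  As states of N are
    not killed, the killing concentrates at infinity in the limit: if
    the masses tend to a finite kappa, the limit form is
    formA f g + kappa f(oo) g(oo) and its domain is domG; if they tend to
    infinity, functions in the range of T_t vanish at infinity, and a comparison
    with any other Q-process makes p minimal.

    In the first case extending T_t f to oo by its limit gives a Feller semigroup
    on the compactification.  Its Laplace transform is the Ray resolvent, so the
    absence of branching points is an Abelian theorem. *)

(** No spectral theorem and no generator enter. Dependence on time is controlled by the convexity of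
    t -> (T_t f, f) along arithmetic progressions, a consequence of |T_u f - T_v f|^2 >= 0. The
    price is that monotonicity of E_s is obtained up to a factor 1 + t/s, and that E_s(T_t f, T_t f)
    is bounded along the sequence s = 2t/(n + 1).

    For the limit of E_s the lower bound is easy: keep only the jumps between neighbours. The upper
    bound is the delicate one, as E_s charges jumps of every length. It is direct for finitely
    supported f, where finitely many entries of Q enter; soft thresholding extends it to f vanishing
    at infinity; constants are charged by the killing alone.

    Regularity of the boundary acts through two consequences: mu is finite, so that constants belong
    to L^2, and c is bounded, so that finite energy forces a limit at infinity, at a rate depending
    on the energy only. This uniform rate drives both the minimality argument and the Feller
    property at infinity. *)

Notation rsum u := (limn (series u)).

(** * Absolutely convergent real series *)

Section Series.
Context {R : realType}.
Implicit Types u v w : nat -> R.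

(** Guards every manipulation of [rsum], since [limn] of a divergent series carries no information.
    A bound on partial sums is the form in which comparison arguments deliver summability. *)
Definition abs_summable u :=
  exists M, forall n, \sum_(0 <= k < n) `|u k| <= M.

Lemma le_abs_summable v u : abs_summable v -> (forall k, `|u k| <= v k) ->
  abs_summable u.
Proof.
move=> [M vM] uv; exists M => n; apply: le_trans (vM n).
by apply: ler_sum => k _; apply: le_trans (uv k) _; exact: ler_norm.
Qed.

Lemma abs_summable_norm u : abs_summable u -> abs_summable (fun k => `|u k|).
Proof. by move=> [M uM]; exists M => n; under eq_bigr do rewrite normr_id. Qed.

Lemma abs_summable_tail N u : abs_summable u ->
  abs_summable (fun k => if (k < N)%N then 0 else u k).
Proof.
move=> su; apply: le_abs_summable (abs_summable_norm su) _ => k.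
by case: ifP; rewrite ?normr0.
Qed.

Lemma abs_summableD u v : abs_summable u -> abs_summable v ->
  abs_summable (fun k => u k + v k).
Proof.
move=> [M uM] [N vN]; exists (M + N) => n.
apply: le_trans (lerD (uM n) (vN n)); rewrite -big_split /=.
by apply: ler_sum => k _; exact: ler_normD.
Qed.

Lemma abs_summableZ r u : abs_summable u -> abs_summable (fun k => r * u k).
Proof.
move=> [M uM]; exists (`|r| * M) => n.
under eq_bigr do rewrite normrM.
by rewrite -mulr_sumr ler_wpM2l.
Qed.

Lemma abs_summableB u v : abs_summable u -> abs_summable v ->
  abs_summable (fun k => u k - v k).
Proof.
move=> su sv; have := abs_summableD su (abs_summableZ (-1) sv).
by under [X in abs_summable X]eq_fun do rewrite mulN1r.
Qed.

Lemma nneg_abs_summable u M : (forall k, 0 <= u k) ->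
  (forall n, \sum_(0 <= k < n) u k <= M) -> abs_summable u.
Proof.
by move=> u0 uM; exists M => n; under eq_bigr do rewrite ger0_norm//.
Qed.

Lemma abs_summable_finite u N : (forall k, (N <= k)%N -> u k = 0) ->
  abs_summable u.
Proof.
move=> u0; exists (\sum_(0 <= k < N) `|u k|) => n.
have [nN|Nn] := leqP n N.
  rewrite [leRHS](@big_cat_nat _ _ _ n)//= lerDl; exact: sumr_ge0.
rewrite (@big_cat_nat _ _ _ N)//= ?(ltnW Nn)// [X in _ + X]big_nat [X in _ + X]big1 ?addr0// => k.
by case/andP => /u0 ->; rewrite normr0.
Qed.

Lemma abs_summable_cvg u : abs_summable u -> cvgn (series u).
Proof.
move=> [M uM]; apply: normed_cvg; apply: nondecreasing_is_cvgn.
  by apply: nondecreasing_series => k _ _; exact: normr_ge0.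
by exists M => _ [n _ <-]; exact: uM.
Qed.

Lemma eq_rsum u v : u =1 v -> rsum u = rsum v.
Proof. by move=> /funext ->. Qed.

Lemma rsumD u v : abs_summable u -> abs_summable v ->
  rsum (fun k => u k + v k) = rsum u + rsum v.
Proof. by move=> /abs_summable_cvg su /abs_summable_cvg; exact: lim_seriesD. Qed.

Lemma rsumZ r u : abs_summable u -> rsum (fun k => r * u k) = r * rsum u.
Proof. by move=> /abs_summable_cvg su; exact: lim_seriesZ. Qed.

Lemma rsumB u v : abs_summable u -> abs_summable v ->
  rsum (fun k => u k - v k) = rsum u - rsum v.
Proof. by move=> /abs_summable_cvg su /abs_summable_cvg; exact: lim_seriesB. Qed.

Lemma ler_rsum u v : abs_summable u -> abs_summable v ->
  (forall k, u k <= v k) -> rsum u <= rsum v.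
Proof. by move=> /abs_summable_cvg su /abs_summable_cvg sv; exact: lim_series_le. Qed.

Lemma rsum_finite u N : (forall k, (N <= k)%N -> u k = 0) ->
  rsum u = \sum_(0 <= k < N) u k.
Proof.
move=> u0; apply/cvg_lim => //; apply: cvg_near_cst; near=> n.
have Nn : (N <= n)%N by near: n; exact: nbhs_infty_ge.
rewrite /series/= (@big_cat_nat _ _ _ N)//= [X in _ + X]big_nat [X in _ + X]big1 ?addr0// => k.
by case/andP => /u0.
Unshelve. all: by end_near. Qed.

Lemma rsum0 : rsum (fun=> 0 : R) = 0.
Proof. by rewrite (@rsum_finite _ 0)// big_nil. Qed.

Lemma rsum_ge0 u : abs_summable u -> (forall k, 0 <= u k) -> 0 <= rsum u.
Proof.
move=> su u0; rewrite -rsum0; apply: ler_rsum => //.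
exact: (@abs_summable_finite _ 0).
Qed.

Lemma partial_le_rsum u n : abs_summable u -> (forall k, 0 <= u k) ->
  \sum_(0 <= k < n) u k <= rsum u.
Proof.
move=> su u0; apply: (@nondecreasing_cvgn_le _ (series u)).
  exact: nondecreasing_series.
exact: abs_summable_cvg.
Qed.

Lemma term_le_rsum u k : abs_summable u -> (forall k, 0 <= u k) ->
  u k <= rsum u.
Proof.
move=> su u0; apply: le_trans (partial_le_rsum k.+1 su u0).
by rewrite big_nat_recr//= lerDr sumr_ge0.
Qed.

Lemma rsum_le_bound u M : abs_summable u ->
  (forall n, \sum_(0 <= k < n) u k <= M) -> rsum u <= M.
Proof.
by move=> /abs_summable_cvg su uM; apply: limr_le => //; exact: nearW.
Qed.

Lemma ler_norm_rsum u : abs_summable u -> `|rsum u| <= rsum (fun k => `|u k|).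
Proof.
move=> su; rewrite ler_norml; apply/andP; split; last first.
  by apply: ler_rsum => //; [exact: abs_summable_norm|move=> k; exact: ler_norm].
rewrite lerNl -mulN1r -rsumZ//.
apply: ler_rsum => //; [exact: abs_summableZ|exact: abs_summable_norm|].
by move=> k; rewrite mulN1r -normrN ler_norm.
Qed.

Lemma rsum_split N u : abs_summable u ->
  rsum u = \sum_(0 <= k < N) u k + rsum (fun k => if (k < N)%N then 0 else u k).
Proof.
move=> su.
have s1 : abs_summable (fun k => if (k < N)%N then u k else 0).
  apply: (@abs_summable_finite _ N) => k; by rewrite leqNgt => /negbTE ->.
have s2 := abs_summable_tail N su.
transitivity (rsum (fun k => (if (k < N)%N then u k else 0) +
                      (if (k < N)%N then 0 else u k))).
  by apply: eq_rsum => k; case: ifP; rewrite ?addr0 ?add0r.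
rewrite rsumD//; congr (_ + _); rewrite (@rsum_finite _ N); last first.
  by move=> k; rewrite leqNgt => /negbTE ->.
by rewrite !big_nat; apply: eq_bigr => k /andP[_ ->].
Qed.

Lemma rsum_tail0 u : abs_summable u ->
  rsum (fun k => if (k < N)%N then 0 else u k) @[N --> \oo] --> (0 : R).
Proof.
move=> su.
rewrite (_ : (fun N => _) = (fun N => rsum u - series u N)); last first.
  by apply/funext => N; rewrite (rsum_split N su)/= addrC addKr.
rewrite -(subrr (rsum u)); apply: cvgB; first exact: cvg_cst.
exact: abs_summable_cvg.
Qed.

Lemma cvg_sum_nat {T : Type} (F : set_system T) {FF : Filter F}
    (v : T -> nat -> R) l N : (forall i, v x i @[x --> F] --> l i) ->
  \sum_(0 <= k < N) v x k @[x --> F] --> \sum_(0 <= k < N) l k.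
Proof.
move=> vl; elim: N => [|k IH].
  by under eq_fun do rewrite big_nil; rewrite big_nil; exact: cvg_cst.
rewrite big_nat_recr//=; under eq_fun do rewrite big_nat_recr//=.
exact: cvgD.
Qed.

(** Dominated convergence for series: the majorant makes all tails beyond some N small uniformly in
    x, and a finite sum remains. The filter is general because limits in time and along sequences
    both occur. *)
Lemma tannery {T : Type} (F : set_system T) {FF : ProperFilter F}
    (v : T -> nat -> R) w l :
  abs_summable w -> (\forall x \near F, forall i, `|v x i| <= w i) ->
  (forall i, v x i @[x --> F] --> l i) ->
  rsum (v x) @[x --> F] --> rsum l.
Proof.
move=> sw vw vl.
have lw i : `|l i| <= w i.
  have /cvg_norm := vl i => nvl; rewrite -(cvg_lim _ nvl)//.
  apply: limr_le; first by apply/cvg_ex; eexists; exact: nvl.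
  by apply: filterS vw => x /(_ i).
have sl : abs_summable l by exact: le_abs_summable lw.
have w0 i : 0 <= w i by exact: le_trans (lw i).
apply/cvgrPdist_lt => e e0.
have [N wN] : exists N, rsum (fun k => if (k < N)%N then 0 else w k) < e / 4.
  have /cvgrPdist_lt/(_ (e / 4)) := rsum_tail0 sw.
  have e4 : 0 < e / 4 by rewrite divr_gt0.
  move=> /(_ e4)[N _ /(_ N (leqnn N))] /=; rewrite sub0r normrN => tN.
  by exists N; apply: le_lt_trans (ler_norm _) tN.
have cS : \sum_(0 <= k < N) v x k @[x --> F] --> \sum_(0 <= k < N) l k.
  exact: cvg_sum_nat.
have tail u : abs_summable u -> (forall i, `|u i| <= w i) ->
    `|rsum u - \sum_(0 <= k < N) u k| < e / 4.
  move=> su uw; rewrite (rsum_split N su) addrAC subrr add0r.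
  apply: le_lt_trans (ler_norm_rsum (abs_summable_tail N su)) _; apply: le_lt_trans wN.
  apply: ler_rsum; [exact/abs_summable_norm/abs_summable_tail|exact: abs_summable_tail|].
  by move=> k; case: ifP; rewrite ?normr0.
near=> x.
have vwx : forall i, `|v x i| <= w i by near: x.
have svx : abs_summable (v x) by exact: le_abs_summable vwx.
have A : `|\sum_(0 <= k < N) l k - \sum_(0 <= k < N) v x k| < e / 4.
  by near: x; move/cvgrPdist_lt : cS; apply; rewrite divr_gt0.
have := tail _ sl lw; have := tail _ svx vwx; move: A.
rewrite !ltr_norml => /andP[? ?] /andP[? ?] /andP[? ?]; apply/andP; split; lra.
Unshelve. all: by end_near. Qed.

Lemma rsum_sum n (u : nat -> nat -> R) : (forall j, abs_summable (u j)) ->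
  abs_summable (fun i => \sum_(0 <= j < n) u j i) /\
  rsum (fun i => \sum_(0 <= j < n) u j i) = \sum_(0 <= j < n) rsum (u j).
Proof.
move=> su; elim: n => [|n [s1 s2]].
  split; first by exists 0 => n; rewrite big1// => i _; rewrite big_nil normr0.
  by rewrite big_nil -[RHS]rsum0; apply: eq_rsum => i; rewrite big_nil.
under eq_fun do rewrite big_nat_recr//=.
split; first exact: abs_summableD.
by rewrite rsumD// s2 big_nat_recr.
Qed.

(** Fubini with a majorant of the row sums. Partial sums over j of the column sums are sums over i
    of truncated rows, and [tannery] applies to these. *)
Lemma rsum_exchange (u : nat -> nat -> R) w : abs_summable w ->
  (forall i n, \sum_(0 <= j < n) `|u i j| <= w i) ->
  [/\ forall i, abs_summable (u i), forall j, abs_summable (u^~ j),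
      abs_summable (fun i => rsum (u i)),
      abs_summable (fun j => rsum (u^~ j)) &
      rsum (fun i => rsum (u i)) = rsum (fun j => rsum (u^~ j))].
Proof.
move=> sw uw.
have s1 i : abs_summable (u i) by exists (w i).
have uij i j : `|u i j| <= w i.
  apply: le_trans (uw i j.+1); rewrite big_nat_recr//= lerDr; exact: sumr_ge0.
have s2 j : abs_summable (u^~ j) by exact: le_abs_summable sw _.
have s3 : abs_summable (fun i => rsum (u i)).
  apply: le_abs_summable sw _ => i; apply: le_trans (ler_norm_rsum (s1 i)) _.
  by apply: rsum_le_bound; [exact: abs_summable_norm|exact: uw].
have s4 : abs_summable (fun j => rsum (u^~ j)).
  exists (rsum w) => n.
  apply: (@le_trans _ _ (\sum_(0 <= j < n) rsum (fun i => `|u i j|))).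
    by apply: ler_sum => j _; exact: ler_norm_rsum.
  have [] := @rsum_sum n (fun j i => `|u i j|).
    by move=> j; apply: abs_summable_norm.
  by move=> s5 <-; exact: ler_rsum.
split => //.
apply/esym/cvg_lim => //.
have -> : series (fun j => rsum (u^~ j)) =
    (fun n => rsum (fun i => \sum_(0 <= j < n) u i j)).
  apply/funext => n; rewrite /series/=.
  by have [] := @rsum_sum n (fun j i => u i j).
apply: (tannery sw); last by move=> i; exact: abs_summable_cvg.
near=> n => i; apply: le_trans (uw i n); exact: ler_norm_sum.
Unshelve. all: by end_near. Qed.

Lemma nneseries_rsum u : (forall k, 0 <= u k) -> abs_summable u ->
  (\sum_(0 <= k <oo) (u k)%:E)%E = (rsum u)%:E.
Proof.
move=> u0 su; rewrite -EFin_lim; last exact: abs_summable_cvg.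
by congr (limn _); apply/funext => n /=; rewrite /series/= sumEFin.
Qed.

Lemma nneseries_partial_le u (x : \bar R) n : (forall k, 0 <= u k) ->
  (\sum_(0 <= k <oo) (u k)%:E <= x)%E ->
  ((\sum_(0 <= k < n) u k)%:E <= x)%E.
Proof.
move=> u0; apply: le_trans; rewrite -sumEFin.
by apply: nneseries_lim_ge => k _ _; rewrite lee_fin.
Qed.

Lemma nneseries_ltyP u : (forall k, 0 <= u k) ->
  (\sum_(0 <= k <oo) (u k)%:E < +oo)%E <-> abs_summable u.
Proof.
move=> u0; split => [uoo|su]; last by rewrite nneseries_rsum// ltry.
have s0 : (0 <= \sum_(0 <= k <oo) (u k)%:E)%E.
  by apply: nneseries_ge0 => k _ _; rewrite lee_fin.
apply: (@nneg_abs_summable _ (fine (\sum_(0 <= k <oo) (u k)%:E))) => // n.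
rewrite -lee_fin fineK ?ge0_fin_numE//.
exact: nneseries_partial_le.
Qed.

Lemma esum_nat_rsum u : (forall k, 0 <= u k) -> abs_summable u ->
  (\esum_(k in [set: nat]) (u k)%:E)%E = (rsum u)%:E.
Proof.
move=> u0 su; by rewrite -nneseries_rsum// nneseries_esumT.
Qed.

Lemma esum_option (g : option nat -> \bar R) : (forall x, 0 <= g x)%E ->
  (\esum_(x in [set: option nat]) g x)%E =
  (g None + \esum_(k in [set: nat]) g (Some k))%E.
Proof.
move=> g0; rewrite (esumID [set None])//; congr (_ + _)%E.
  by rewrite setTI esum_set1.
rewrite setTI -(@esum_image _ _ _ setT Some) => [|i j _ _ []//].
by congr esum; apply/seteqP; split => -[x|]//=; [exists x|case].
Qed.

End Series.

(** * Semigroups symmetric with respect to a finite measure *)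

(** The axioms of a standard transition function in terms of real series. For Q-processes [sg_id] is
    derived from standardness, in [Q_process_standard]. *)
Record standard_semigroup (R : realType) (p : R -> nat -> nat -> R) : Prop :=
  StandardSemigroup {
  sg_ge0 : forall t i j, 0 <= t -> 0 <= p t i j;
  sg_row_le1 : forall t i n, 0 <= t -> \sum_(0 <= j < n) p t i j <= 1;
  sg_add : forall s t i j, 0 <= s -> 0 <= t ->
    p (s + t) i j = rsum (fun k => p s i k * p t k j);
  sg_id : forall i j, p 0 i j = (i == j)%:R;
  sg_standard : forall i j, p t i j @[t --> 0^'+] --> ((i == j)%:R : R) }.

Record symmetric_semigroup (R : realType) (m : nat -> R)
    (p : R -> nat -> nat -> R) : Prop := SymmetricSemigroup {
  ss_mass_gt0 : forall i, 0 < m i;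
  ss_mass_finite : abs_summable m;
  ss_base : standard_semigroup p;
  ss_sym : forall t i j, 0 <= t -> m i * p t i j = m j * p t j i }.

Definition semigroup_op (R : realType) (p : R -> nat -> nat -> R) (t : R)
    (f : nat -> R) (i : nat) : R := rsum (fun j => p t i j * f j).

Section SymmetricSemigroup.
Context {R : realType} {m : nat -> R} {p : R -> nat -> nat -> R}.
Hypothesis H : symmetric_semigroup m p.
Implicit Types (f g h : nat -> R) (s t : R) (i j k n : nat).

Let m_gt0 := ss_mass_gt0 H.
Let m_fin := ss_mass_finite H.
Let p_ge0 := sg_ge0 (ss_base H).
Let p_row := sg_row_le1 (ss_base H).
Let p_sym := ss_sym H.
Local Notation T := (semigroup_op p).
Local Notation L1 f := (abs_summable (fun k => m k * f k)).
Local Notation dot := (L2dot m).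

Lemma m_ge0 i : 0 <= m i. Proof. exact: ltW. Qed.
Hint Resolve m_ge0 : core.

Lemma m_sqr_ge0 k (x : R) : 0 <= m k * x ^+ 2.
Proof. by rewrite mulr_ge0// sqr_ge0. Qed.

Lemma L2P f : L2 m f <-> abs_summable (fun k => m k * f k ^+ 2).
Proof. by apply: nneseries_ltyP => k; rewrite mulr_ge0// sqr_ge0. Qed.

Lemma L2_mul_summable f g : L2 m f -> L2 m g ->
  abs_summable (fun k => m k * f k * g k).
Proof.
move=> /L2P sf /L2P sg; apply: le_abs_summable (abs_summableD sf sg) _ => k.
rewrite -mulrA normrM ger0_norm// -mulrDr ler_wpM2l// ler_norml.
have := sqr_ge0 (f k + g k); have := sqr_ge0 (f k - g k); nra.
Qed.

Lemma bounded_L1 f M : (forall k, `|f k| <= M) -> L1 f.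
Proof.
move=> fM; apply: le_abs_summable (abs_summableZ M m_fin) _ => k.
by rewrite normrM ger0_norm// mulrC ler_wpM2r.
Qed.

Lemma bounded_L2 f M : (forall k, `|f k| <= M) -> L2 m f.
Proof.
move=> fM; apply/L2P; apply: (@bounded_L1 _ (M ^+ 2)) => k.
by rewrite normrX lerXn2r ?nnegrE// (le_trans _ (fM k)).
Qed.

Lemma cst_L2 r : L2 m (fun=> r).
Proof. exact: (@bounded_L2 _ `|r|). Qed.

Lemma finite_L2 f N : (forall k, (N <= k)%N -> f k = 0) -> L2 m f.
Proof.
move=> f0; apply/L2P; apply: (@abs_summable_finite _ _ N) => k /f0 ->.
by rewrite expr0n mulr0.
Qed.

Lemma L2_L1 f : L2 m f -> L1 f.
Proof.
move=> Lf; have := L2_mul_summable Lf (cst_L2 1).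
by under [X in abs_summable X]eq_fun do rewrite mulr1.
Qed.

Lemma L2_sqr_L1 f : L2 m f -> L1 (fun k => f k ^+ 2).
Proof. by move=> /L2P. Qed.

Lemma L2D f g : L2 m f -> L2 m g -> L2 m (fun k => f k + g k).
Proof.
move=> Lf Lg; apply/L2P.
have := abs_summableD (abs_summableD (L2_mul_summable Lf Lf) (L2_mul_summable Lg Lg))
  (abs_summableZ 2 (L2_mul_summable Lf Lg)).
by rewrite (_ : (fun k => _) = (fun k => m k * (f k + g k) ^+ 2))//; apply/funext => k; ring.
Qed.

Lemma L2Z r f : L2 m f -> L2 m (fun k => r * f k).
Proof.
move=> Lf; apply/L2P; have := abs_summableZ (r ^+ 2) (L2_mul_summable Lf Lf).
by rewrite (_ : (fun k => _) = (fun k => m k * (r * f k) ^+ 2))//; apply/funext => k; ring.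
Qed.

Lemma L2B f g : L2 m f -> L2 m g -> L2 m (fun k => f k - g k).
Proof.
move=> Lf Lg; have := L2D Lf (L2Z (-1) Lg).
by under eq_fun do rewrite mulN1r.
Qed.

Lemma le_L2 f g : L2 m g -> (forall k, `|f k| <= `|g k|) -> L2 m f.
Proof.
move=> /L2P Lg fg; apply/L2P; apply: le_abs_summable Lg _ => k.
rewrite normrM ger0_norm// ler_wpM2l// normrX -(real_normK (num_real (g k))).
by rewrite lerXn2r ?nnegrE.
Qed.

Lemma dotC f g : dot f g = dot g f.
Proof. by apply: eq_rsum => k; rewrite mulrAC. Qed.

Lemma dotDl f g h : L2 m f -> L2 m g -> L2 m h ->
  dot (fun k => f k + g k) h = dot f h + dot g h.
Proof.
move=> Lf Lg Lh; rewrite /L2dot -rsumD; [|exact: L2_mul_summable..].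
by apply: eq_rsum => k; ring.
Qed.

Lemma dotBl f g h : L2 m f -> L2 m g -> L2 m h ->
  dot (fun k => f k - g k) h = dot f h - dot g h.
Proof.
move=> Lf Lg Lh; rewrite /L2dot -rsumB; [|exact: L2_mul_summable..].
by apply: eq_rsum => k; ring.
Qed.

Lemma dotZl r f h : L2 m f -> L2 m h ->
  dot (fun k => r * f k) h = r * dot f h.
Proof.
move=> Lf Lh; rewrite /L2dot -rsumZ; last exact: L2_mul_summable.
by apply: eq_rsum => k; ring.
Qed.

Lemma dot_ge0 f : L2 m f -> 0 <= dot f f.
Proof.
move=> Lf; apply: rsum_ge0; first exact: L2_mul_summable.
by move=> k; rewrite -mulrA mulr_ge0// -expr2 sqr_ge0.
Qed.

Lemma dotE f : dot f f = rsum (fun k => m k * f k ^+ 2).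
Proof. by apply: eq_rsum => k; rewrite -mulrA. Qed.

Lemma row_summable t i : 0 <= t -> abs_summable (p t i).
Proof.
move=> t0; apply: (@nneg_abs_summable _ _ 1) => [k|n]; first exact: p_ge0.
exact: p_row.
Qed.

Lemma p_le1 t i j : 0 <= t -> p t i j <= 1.
Proof.
move=> t0; apply: le_trans (p_row i j.+1 t0); rewrite big_nat_recr//= lerDr.
by apply: sumr_ge0 => k _; exact: p_ge0.
Qed.

(** Symmetry moves the bound p_ji <= 1 to the other side. Row i is thus dominated by a multiple of m
    uniformly in t, which makes T_t f(i) meaningful for f in L^1 and gives a majorant for limits t
    -> 0. *)
Lemma p_dom t i j : 0 <= t -> p t i j <= (m i)^-1 * m j.
Proof.
move=> t0; rewrite -(ler_pM2l (m_gt0 i)) p_sym// mulrA divff ?gt_eqF// mul1r.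
by rewrite -[leRHS]mulr1 ler_wpM2l// p_le1.
Qed.

Lemma op_dom t i f k : 0 <= t -> `|p t i k * f k| <= (m i)^-1 * `|m k * f k|.
Proof.
move=> t0; rewrite !normrM (ger0_norm (p_ge0 _ _ t0)) (ger0_norm (m_ge0 k)).
by rewrite mulrA ler_wpM2r// p_dom.
Qed.

Lemma op_summable t i f : 0 <= t -> L1 f -> abs_summable (fun j => p t i j * f j).
Proof.
move=> t0 Lf; apply: le_abs_summable (abs_summableZ (m i)^-1 (abs_summable_norm Lf)) _.
by move=> k; exact: op_dom.
Qed.

Lemma opD t f g i : 0 <= t -> L1 f -> L1 g ->
  T t (fun k => f k + g k) i = T t f i + T t g i.
Proof.
move=> t0 Lf Lg; rewrite /semigroup_op -rsumD; [|exact: op_summable..].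
by apply: eq_rsum => k; rewrite mulrDr.
Qed.

Lemma opB t f g i : 0 <= t -> L1 f -> L1 g ->
  T t (fun k => f k - g k) i = T t f i - T t g i.
Proof.
move=> t0 Lf Lg; rewrite /semigroup_op -rsumB; [|exact: op_summable..].
by apply: eq_rsum => k; rewrite mulrBr.
Qed.

Lemma opZ t r f i : 0 <= t -> L1 f -> T t (fun k => r * f k) i = r * T t f i.
Proof.
move=> t0 Lf; rewrite /semigroup_op -rsumZ; last exact: op_summable.
by apply: eq_rsum => k; rewrite mulrCA.
Qed.

Lemma op_mono t f g i : 0 <= t -> L1 f -> L1 g -> (forall k, f k <= g k) ->
  T t f i <= T t g i.
Proof.
move=> t0 Lf Lg fg; apply: ler_rsum; [exact: op_summable..|] => k.
by rewrite ler_wpM2l// p_ge0.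
Qed.

Lemma op_ge0 t f i : 0 <= t -> L1 f -> (forall k, 0 <= f k) -> 0 <= T t f i.
Proof.
move=> t0 Lf f0; apply: rsum_ge0; first exact: op_summable.
by move=> k; rewrite mulr_ge0// p_ge0.
Qed.

Lemma L1_norm f : L1 f -> L1 (fun k => `|f k|).
Proof.
move=> /abs_summable_norm.
by under eq_fun do rewrite normrM ger0_norm//.
Qed.

Lemma ler_norm_op t f i : 0 <= t -> L1 f -> `|T t f i| <= T t (fun k => `|f k|) i.
Proof.
move=> t0 Lf; apply: le_trans (ler_norm_rsum (op_summable i t0 Lf)) _.
by apply: ler_rsum => [||k]; [exact/abs_summable_norm/op_summable|exact/op_summable/L1_norm|
  rewrite normrM ger0_norm// p_ge0].
Qed.

Lemma L1_cst r : L1 (fun=> r).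
Proof. exact: (@bounded_L1 _ `|r|). Qed.

Lemma op1_le1 t i : 0 <= t -> T t (fun=> 1) i <= 1.
Proof.
move=> t0; apply: rsum_le_bound; first exact/op_summable/L1_cst.
by move=> n; under eq_bigr do rewrite mulr1; exact: p_row.
Qed.

Lemma op1_ge0 t i : 0 <= t -> 0 <= T t (fun=> 1) i.
Proof. by move=> t0; apply: op_ge0 => //; exact: L1_cst. Qed.

Lemma op_bounded t f M i : 0 <= t -> (forall k, `|f k| <= M) -> `|T t f i| <= M.
Proof.
move=> t0 fM; have Lf := bounded_L1 fM.
have M0 : 0 <= M by exact: le_trans (fM 0%N).
apply: le_trans (ler_norm_op i t0 Lf) _.
apply: (@le_trans _ _ (T t (fun k => M * 1) i)).
  apply: op_mono => //; [exact: L1_norm|exact: L1_cst|by move=> k; rewrite mulr1].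
rewrite opZ//; last exact: L1_cst.
by rewrite -[leRHS]mulr1 ler_wpM2l// op1_le1.
Qed.

Lemma op_id f i : T 0 f i = f i.
Proof.
rewrite /semigroup_op (@rsum_finite _ _ i.+1) => [|k ik].
  rewrite big_nat_recr//= (sg_id (ss_base H)) eqxx mul1r big_nat big1 ?add0r// => k /andP[_ ki].
  by rewrite (sg_id (ss_base H)) gtn_eqF// mul0r.
by rewrite (sg_id (ss_base H)) ltn_eqF// mul0r.
Qed.

(** Symmetry tested against the constant 1; the double series converges because the rows of p have
    mass at most 1. *)
Lemma op_L1 t f : 0 <= t -> L1 f -> L1 (T t f) /\
  rsum (fun i => m i * T t f i) = rsum (fun j => m j * f j * T t (fun=> 1) j).
Proof.
move=> t0 Lf.
have [] := @rsum_exchange _ (fun j i => m i * (p t i j * f j))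
    (fun j => `|m j * f j|) (abs_summable_norm Lf).
  move=> j n; rewrite (eq_bigr (fun i => `|m j * f j| * p t j i)); last first.
    move=> i _; rewrite mulrA p_sym// mulrAC normrM; congr (_ * _).
    by rewrite ger0_norm// p_ge0.
  by rewrite -mulr_sumr ler_piMr// p_row.
move=> _ _ _ S S'; have E i : rsum (fun j => m i * (p t i j * f j)) = m i * T t f i.
  by rewrite rsumZ//; exact: op_summable.
have {}S : L1 (T t f).
  rewrite (_ : (fun k => _) = (fun i => rsum (fun j => m i * (p t i j * f j))))//.
  by apply/funext => i; rewrite E.
split => //; under eq_fun do rewrite -E.
rewrite -S'; apply: eq_rsum => j.
rewrite -rsumZ; last exact/op_summable/L1_cst.
by apply: eq_rsum => i; rewrite mulrA p_sym//; ring.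
Qed.

Lemma op_add s t f i : 0 <= s -> 0 <= t -> L1 f -> T (s + t) f i = T s (T t f) i.
Proof.
move=> s0 t0 Lf.
have [] := @rsum_exchange _ (fun k j => p s i k * (p t k j * f j))
    (fun k => p s i k * T t (fun j => `|f j|) k).
- by apply: op_summable => //; apply: (op_L1 t0 _).1; exact: L1_norm.
- move=> k n; under eq_bigr do rewrite normrM ger0_norm ?p_ge0//.
  rewrite -mulr_sumr ler_wpM2l ?p_ge0//.
  rewrite (eq_bigr (fun j => p t k j * `|f j|)); last first.
    by move=> j _; rewrite normrM ger0_norm// p_ge0.
  apply: partial_le_rsum; first exact/op_summable/L1_norm.
  by move=> j; rewrite mulr_ge0// p_ge0.
move=> _ _ _ _ S; rewrite {1}/semigroup_op.
rewrite [RHS](_ : _ = rsum (fun k => rsum (fun j => p s i k * (p t k j * f j)))).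
  rewrite S; apply: eq_rsum => j; rewrite (sg_add (ss_base H))// mulrC -rsumZ.
    by apply: eq_rsum => k; ring.
  apply: le_abs_summable (row_summable i s0) _ => k.
  rewrite ger0_norm ?mulr_ge0 ?p_ge0// ler_piMr ?p_ge0//; exact: p_le1.
by apply: eq_rsum => k; rewrite rsumZ//; exact: op_summable.
Qed.

(* Jensen: expand [0 <= T (f - c)^2] at the constant [c = T f i]. *)
Lemma op_sqr_le t f i : 0 <= t -> L2 m f -> T t f i ^+ 2 <= T t (fun k => f k ^+ 2) i.
Proof.
move=> t0 Lf; set c := T t f i.
have L2f := L2_sqr_L1 Lf; have L1f := L2_L1 Lf.
have L1Z r g : L1 g -> L1 (fun k => r * g k).
  by move=> /(abs_summableZ r); under eq_fun do rewrite mulrCA.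
have nn k : 0 <= f k ^+ 2 + (- 2 * c) * f k + c ^+ 2 * 1.
  by have := sqr_ge0 (f k - c); nra.
have L12 : L1 (fun k => f k ^+ 2 + (-2 * c) * f k).
  have := abs_summableD L2f (L1Z (-2 * c) _ L1f).
  by under eq_fun do rewrite -mulrDr.
have := abs_summableD L12 (L1_cst (c ^+ 2 * 1)).
under eq_fun do rewrite -mulrDr.
move=> L3; have := op_ge0 i t0 L3 nn; rewrite opD//; last exact: L1_cst.
rewrite opD//; last exact: L1Z.
rewrite !opZ//; last exact: L1_cst.
rewrite -/c.
have := op1_le1 i t0; have := sqr_ge0 c; nra.
Qed.

Lemma op_L2 t f : 0 <= t -> L2 m f -> L2 m (T t f).
Proof.
move=> t0 Lf; apply/L2P; have [S _] := op_L1 t0 (L2_sqr_L1 Lf).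
apply: le_abs_summable S _ => k.
by rewrite ger0_norm; [rewrite ler_wpM2l// op_sqr_le|rewrite mulr_ge0// sqr_ge0].
Qed.

Lemma op_contraction t f : 0 <= t -> L2 m f -> dot (T t f) (T t f) <= dot f f.
Proof.
move=> t0 Lf; rewrite !dotE; have [S E] := op_L1 t0 (L2_sqr_L1 Lf).
apply: (@le_trans _ _ (rsum (fun k => m k * T t (fun k => f k ^+ 2) k))).
  apply: ler_rsum => //; first exact/L2P/op_L2.
  by move=> k; rewrite ler_wpM2l// op_sqr_le.
have le k : m k * f k ^+ 2 * T t (fun=> 1) k <= m k * f k ^+ 2.
  by rewrite ler_piMr ?m_sqr_ge0// op1_le1.
rewrite E; apply: ler_rsum => //; last exact/L2P.
apply: le_abs_summable (L2_sqr_L1 Lf) _ => k.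
by rewrite ger0_norm// mulr_ge0 ?m_sqr_ge0// op1_ge0.
Qed.

Lemma op_symmetric t f g : 0 <= t -> L2 m f -> L2 m g ->
  dot (T t f) g = dot f (T t g).
Proof.
move=> t0 Lf Lg.
have Lf2 := L2_sqr_L1 Lf; have Lg2 := L2_sqr_L1 Lg.
have [S _] := op_L1 t0 Lg2.
(* The majorant comes from |f_j g_i| <= f_j^2 + g_i^2: the first square is summed with the row mass
   of p, the second gives T_t g^2, which is in L^1 by [op_L1]. *)
have [] := @rsum_exchange _ (fun j i => m i * p t i j * f j * g i)
    (fun j => m j * f j ^+ 2 + m j * T t (fun k => g k ^+ 2) j).
- exact: abs_summableD.
- move=> j n; apply: (@le_trans _ _ (\sum_(0 <= i < n)
      (m j * f j ^+ 2 * p t j i + m j * (p t j i * g i ^+ 2)))).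
    apply: ler_sum => i _; rewrite p_sym//.
    have p0 := p_ge0 j i t0.
    rewrite (_ : m j * _ * _ * _ = (m j * p t j i) * (f j * g i)); last by ring.
    rewrite normrM (ger0_norm (mulr_ge0 _ _))//.
    rewrite (_ : m j * f j ^+ 2 * _ + _ = (m j * p t j i) * (f j ^+ 2 + g i ^+ 2)); last by ring.
    rewrite ler_wpM2l ?mulr_ge0// ler_norml.
    have := sqr_ge0 (f j + g i); have := sqr_ge0 (f j - g i); nra.
  rewrite big_split/= -!mulr_sumr lerD//.
    by rewrite ler_piMr ?m_sqr_ge0// p_row.
  rewrite ler_wpM2l//; apply: partial_le_rsum; first exact: op_summable.
  by move=> k; rewrite mulr_ge0 ?sqr_ge0 ?p_ge0.
move=> _ _ _ _ E; rewrite /L2dot.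
rewrite [LHS](_ : _ = rsum (fun i => rsum (fun j => m i * p t i j * f j * g i))).
  rewrite -E; apply: eq_rsum => j; rewrite -rsumZ; last exact/op_summable/L2_L1.
  by apply: eq_rsum => i; rewrite p_sym//; ring.
apply: eq_rsum => i; rewrite mulrAC -rsumZ; last exact/op_summable/L2_L1.
by apply: eq_rsum => j; ring.
Qed.

Lemma dot_op_op s t f g : 0 <= s -> 0 <= t -> L2 m f -> L2 m g ->
  dot (T s f) (T t g) = dot (T (s + t) f) g.
Proof.
move=> s0 t0 Lf Lg; rewrite -op_symmetric//; last exact: op_L2.
rewrite (_ : T t (T s f) = T (s + t) f)//; apply/funext => i.
by rewrite addrC (op_add i t0 s0 (L2_L1 Lf)).
Qed.

(** * Convexity in time and the approximating forms *)

Local Notation phi f t := (dot (T t f) f).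

Lemma phi_half t f : 0 <= t -> L2 m f -> phi f t = dot (T (t / 2) f) (T (t / 2) f).
Proof.
move=> t0 Lf; have t20 : 0 <= t / 2 by rewrite divr_ge0.
by rewrite (dot_op_op t20 t20 Lf Lf) -splitr.
Qed.

Lemma phi_ge0 t f : 0 <= t -> L2 m f -> 0 <= phi f t.
Proof. by move=> t0 Lf; rewrite phi_half// dot_ge0//; apply: op_L2; rewrite ?divr_ge0. Qed.

Lemma phi0 f : phi f 0 = dot f f.
Proof. by congr (dot _ _); apply/funext => i; rewrite op_id. Qed.

Lemma phi_nonincreasing s t f : 0 <= s -> s <= t -> L2 m f -> phi f t <= phi f s.
Proof.
move=> s0 st Lf; have t0 := le_trans s0 st.
rewrite (phi_half s0)// (phi_half t0)//.
have -> : T (t / 2) f = T ((t - s) / 2) (T (s / 2) f).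
  apply/funext => i; rewrite -op_add ?divr_ge0 ?subr_ge0//; last exact: L2_L1.
  by congr (T _ f i); field.
by apply: op_contraction; rewrite ?divr_ge0 ?subr_ge0//; apply: op_L2; rewrite ?divr_ge0.
Qed.

(** Expands |T_u f - T_v f|^2 >= 0 with u = r/2 and v = r/2 + s. This midpoint convexity stands in
    for a spectral representation of phi. *)
Lemma phi_convex r s f : 0 <= r -> 0 <= s -> L2 m f ->
  2 * phi f (r + s) <= phi f r + phi f (r + s + s).
Proof.
move=> r0 s0 Lf.
have r20 : 0 <= r / 2 by rewrite divr_ge0.
have rs0 : 0 <= r / 2 + s by rewrite addr_ge0.
have L1' : L2 m (T (r / 2) f) by exact: op_L2.
have L2' : L2 m (T (r / 2 + s) f) by exact: op_L2.
have := dot_ge0 (L2B L1' L2'); rewrite dotBl//; last exact: L2B.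
rewrite dotC dotBl// [X in _ - X]dotC dotBl//.
rewrite !dot_op_op//.
have -> : r / 2 + r / 2 = r by field.
have -> : r / 2 + s + (r / 2 + s) = r + s + s by field.
have -> : r / 2 + s + r / 2 = r + s by field.
have -> : r / 2 + (r / 2 + s) = r + s by field.
lra.
Qed.

Lemma phi_decrement n s f : 0 <= s -> L2 m f ->
  phi f (n%:R * s) - phi f (n%:R * s + s) <= phi f 0 - phi f s.
Proof.
move=> s0 Lf; elim: n => [|n IH]; first by rewrite mul0r add0r.
have := @phi_convex (n%:R * s) s f (mulr_ge0 (ler0n _ n) s0) s0 Lf.
rewrite -(natr1 n); move: IH; move: (n%:R : R) => x.
rewrite (_ : (x + 1) * s = x * s + s); last by ring.
move: (phi f 0) (phi f s) (phi f (x * s)) (phi f (x * s + s)) (phi f (x * s + s + s)) => *; lra.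
Qed.

Lemma phi_decrement_sum n s f : 0 <= s -> L2 m f ->
  phi f 0 - phi f (n%:R * s) <= n%:R * (phi f 0 - phi f s).
Proof.
move=> s0 Lf; elim: n => [|n IH]; first by rewrite !mul0r subrr.
have := phi_decrement n s0 Lf.
rewrite -(natr1 n); move: IH; move: (n%:R : R) => x.
rewrite (_ : (x + 1) * s = x * s + s); last by ring.
rewrite [(x + 1) * _]mulrDl mul1r.
move: (phi f 0) (phi f s) (phi f (x * s)) (phi f (x * s + s)) => *; lra.
Qed.

(** The decrements of a convex function decrease, so each one is at most the average of those before
    it. *)
Lemma phi_decrement_avg n s f : 0 <= s -> L2 m f ->
  n%:R * (phi f (n%:R * s) - phi f (n%:R * s + s)) <= phi f 0 - phi f (n%:R * s).
Proof.
move=> s0 Lf; elim: n => [|n IH]; first by rewrite !mul0r subrr.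
have := @phi_convex (n%:R * s) s f (mulr_ge0 (ler0n _ n) s0) s0 Lf.
rewrite -(natr1 n); move: IH (ler0n R n); move: (n%:R : R) => x.
rewrite (_ : (x + 1) * s = x * s + s); last by ring.
move: (phi f 0) (phi f (x * s)) (phi f (x * s + s)) (phi f (x * s + s + s)) => A B C D *; nra.
Qed.

Definition approx_form s f g : R := s^-1 * L2dot m (fun k => f k - semigroup_op p s f k) g.
Local Notation En := approx_form.

Lemma approx_formE s f g : 0 <= s -> L2 m f -> L2 m g -> En s f g = s^-1 * (dot f g - dot (T s f) g).
Proof. by move=> s0 Lf Lg; rewrite /approx_form -dotBl//; exact: op_L2. Qed.

Lemma approx_formC s f g : 0 <= s -> L2 m f -> L2 m g -> En s f g = En s g f.
Proof.
by move=> s0 Lf Lg; rewrite !approx_formE// dotC op_symmetric// [dot f (T s g)]dotC.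
Qed.

Lemma approx_formDl s f g h : 0 <= s -> L2 m f -> L2 m g -> L2 m h ->
  En s (fun k => f k + g k) h = En s f h + En s g h.
Proof.
move=> s0 Lf Lg Lh; rewrite !approx_formE//; last exact: L2D.
have -> : T s (fun k => f k + g k) = (fun k => T s f k + T s g k).
  by apply/funext => k; rewrite opD//; exact: L2_L1.
rewrite !dotDl//; [ring|exact: op_L2..].
Qed.

Lemma approx_formZl s r f h : 0 <= s -> L2 m f -> L2 m h ->
  En s (fun k => r * f k) h = r * En s f h.
Proof.
move=> s0 Lf Lh; rewrite !approx_formE//; last exact: L2Z.
have -> : T s (fun k => r * f k) = (fun k => r * T s f k).
  by apply/funext => k; rewrite opZ//; exact: L2_L1.
rewrite !dotZl//; [ring|exact: op_L2..].
Qed.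

(** Cover [0, s] by n = floor(s/t) + 1 steps of length t and use convexity. As n t <= s + t, the
    loss is the factor 1 + t/s, which tends to 1 as t -> 0. *)
Lemma approx_form_le s t f : 0 < t -> t <= s -> L2 m f ->
  En s f f <= (1 + t / s) * En t f f.
Proof.
move=> t0 ts Lf; have s0 := lt_le_trans t0 ts.
have s0' := ltW s0; have t0' := ltW t0.
rewrite !approx_formE// -!phi0.
rewrite -(ler_pM2l s0).
rewrite [leLHS]mulrA divff ?gt_eqF// mul1r.
set n := (Num.truncn (s / t)).+1.
have stn : s / t < n%:R by exact: truncnS_gt.
have nst : n%:R <= s / t + 1.
  by rewrite /n -natr1 lerD2r truncn_le// divr_ge0 ?ltW.
have snt : s <= n%:R * t by rewrite -ler_pdivrMr// ltW.
apply: (@le_trans _ _ (phi f 0 - phi f (n%:R * t))).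
  by rewrite lerD2l lerN2; apply: phi_nonincreasing => //; exact: ltW.
apply: le_trans (phi_decrement_sum _ _ _) _ => //.
rewrite (_ : s * _ = (s / t + 1) * (phi f 0 - phi f t)).
  by rewrite ler_wpM2r// subr_ge0; apply: phi_nonincreasing => //; exact: ltW.
by  field; rewrite !gt_eqF.
Qed.

Lemma approx_form_le_lim s f (l : R) : 0 < s -> L2 m f ->
  En t f f @[t --> 0^'+] --> l -> En s f f <= l.
Proof.
move=> s0 Lf El.
have C : (1 + t / s) * En t f f @[t --> 0^'+] --> (1 + 0 / s) * l.
  apply: cvgM => //; apply: cvgD; first exact: cvg_cst.
  apply: cvgMr_tmp; apply: cvg_within_filter; exact: cvg_id.
rewrite mul0r addr0 mul1r in C.
rewrite -(cvg_lim _ C)//; apply: limr_ge; first by apply/cvg_ex; exists l.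
near=> t; apply: approx_form_le => //.
by near: t; exact: nbhs_right_le.
Unshelve. all: by end_near. Qed.

(** Since 2t = (n + 1) s, the form at T_t f is a decrement of phi late in a progression of step s.
    Comparison with the first decrement gives E_s(f, f); comparison with the average of the earlier
    ones gives (f, f)/(2t). *)
Lemma approx_form_op n t f : 0 < t -> L2 m f ->
  let s := 2 * t / n.+1%:R in
  En s (T t f) (T t f) <= En s f f /\
  En s (T t f) (T t f) <= dot f f / (2 * t).
Proof.
move=> t0 Lf s; have s0 : 0 < s by rewrite divr_gt0// mulr_gt0.
have t0' := ltW t0; have s0' := ltW s0.
have ns : n.+1%:R * s = t + t by rewrite /s; field.
have E : En s (T t f) (T t f) = s^-1 * (phi f (n.+1%:R * s) - phi f (n.+1%:R * s + s)).
  rewrite approx_formE//; [|exact: op_L2..].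
  rewrite -[in dot (T s _) _](_ : T (s + t) f = T s (T t f)); last first.
    by apply/funext => i; rewrite op_add//; exact: L2_L1.
  by rewrite !dot_op_op ?addr_ge0// ns (_ : s + t + t = t + t + s)//; ring.
rewrite E; split.
  rewrite approx_formE// -phi0 ler_pM2l ?invr_gt0//.
  exact: phi_decrement.
rewrite ler_pdivlMr ?mulr_gt0//.
have -> : 2 * t = n.+1%:R * s by rewrite ns; ring.
rewrite (_ : _ * _ * _ = n.+1%:R * (phi f (n.+1%:R * s) - phi f (n.+1%:R * s + s))); last first.
  by field; rewrite gt_eqF//= gt_eqF.
apply: le_trans (phi_decrement_avg _ _ _) _ => //.
by rewrite -phi0 gerBl phi_ge0// ns addr_ge0.
Qed.

(** This is E_s(1, h), the mass lost up to time s per unit of time, weighted by h. *)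
Definition killing s h := s^-1 * rsum (fun i => m i * (1 - semigroup_op p s (fun=> 1) i) * h i).

Lemma op1_compl s i : 0 <= s -> 0 <= 1 - T s (fun=> 1) i <= 1.
Proof. by move=> s0; have := op1_le1 i s0; have := op1_ge0 i s0; lra. Qed.

Lemma killing_summable s h : 0 <= s -> L1 h ->
  abs_summable (fun i => m i * (1 - T s (fun=> 1) i) * h i).
Proof.
move=> s0 Lh; apply: le_abs_summable (abs_summable_norm Lh) _ => k.
have /andP[r0 r1] := op1_compl k s0.
by rewrite mulrAC normrM (ger0_norm r0) ler_piMr.
Qed.

(** Expand the square: the cross terms give (T_s f, f), and symmetry turns the sum of m T_s f^2 into
    that of m f^2 T_s 1. What T_s 1 lacks to be 1 is the killing part. *)
Lemma approx_form_split s f : 0 <= s -> L2 m f ->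
  [/\ forall i, abs_summable (fun j => p s i j * (f i - f j) ^+ 2),
      abs_summable (fun i => m i * rsum (fun j => p s i j * (f i - f j) ^+ 2)) &
      En s f f = killing s (fun k => f k ^+ 2) +
    (2 * s)^-1 * rsum (fun i => m i * rsum (fun j => p s i j * (f i - f j) ^+ 2))].
Proof.
move=> s0 Lf; have Lf2 := L2_sqr_L1 Lf; have L1f := L2_L1 Lf.
have [S SE] := op_L1 s0 Lf2.
set r := fun i => 1 - T s (fun=> 1) i.
have sa i : abs_summable (fun j => p s i j * f i ^+ 2).
  by apply: (op_summable i s0); exact: L1_cst.
have sb i := op_summable i s0 Lf2.
have sc i := op_summable i s0 L1f.
have eqa i j : p s i j * (f i - f j) ^+ 2 =
    p s i j * f i ^+ 2 + p s i j * f j ^+ 2 - 2 * f i * (p s i j * f j) by ring.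
have sab i := abs_summableD (sa i) (sb i).
have s1 i : abs_summable (fun j => p s i j * (f i - f j) ^+ 2).
  under eq_fun do rewrite eqa.
  by apply: abs_summableB => //; exact: abs_summableZ.
have rowE i : m i * rsum (fun j => p s i j * (f i - f j) ^+ 2) =
    (m i * f i ^+ 2 * T s (fun=> 1) i + m i * T s (fun k => f k ^+ 2) i)
     - 2 * (m i * T s f i * f i).
  under eq_fun do rewrite eqa.
  rewrite rsumB//; last exact: abs_summableZ.
  rewrite rsumD// rsumZ// /semigroup_op.
  under [X in limn (series X) + _]eq_fun do rewrite mulrC -[p _ _ _]mulr1.
  rewrite rsumZ; last exact/(op_summable i s0)/L1_cst.
  ring.
have sx : abs_summable (fun i => m i * f i ^+ 2 * T s (fun=> 1) i).
  apply: le_abs_summable Lf2 _ => k.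
  rewrite ger0_norm; last by rewrite mulr_ge0 ?m_sqr_ge0 ?op1_ge0.
  by rewrite ler_piMr ?m_sqr_ge0 ?op1_le1.
have sy : abs_summable (fun i => m i * T s f i * f i).
  by apply: L2_mul_summable => //; exact: op_L2.
have s2 : abs_summable (fun i => m i * rsum (fun j => p s i j * (f i - f j) ^+ 2)).
  under eq_fun do rewrite rowE.
  by apply: abs_summableB; [exact: abs_summableD|exact: abs_summableZ].
split => //.
rewrite (eq_rsum rowE).
rewrite rsumB; [|exact: abs_summableD|exact: abs_summableZ].
rewrite rsumD// SE rsumZ// approx_formE// /killing.
rewrite (_ : rsum (fun i => m i * (1 - T s (fun=> 1) i) * f i ^+ 2) =
  dot f f - rsum (fun j => m j * f j ^+ 2 * T s (fun=> 1) j)); last first.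
  by rewrite dotE -rsumB//; apply: eq_rsum => k; ring.
set D := rsum (fun k => m k * T s f k * f k).
set C := rsum (fun j => m j * f j ^+ 2 * _).
rewrite (_ : dot (T s f) f = D)//.
(* The inverse of 0 is 0 by convention, so both sides vanish at s = 0. *)
have [->|s_neq0] := eqVneq s 0; first by rewrite mulr0 invr0 !mul0r addr0.
by field.
Qed.

End SymmetricSemigroup.

Arguments approx_form {R} m p s f g.
Arguments killing {R} m p s h.

(** * Behaviour at small times *)

Section SmallTime.
Context {R : realType} {m : nat -> R} {p : R -> nat -> nat -> R}.
Hypothesis H : symmetric_semigroup m p.
Implicit Types (f g h : nat -> R) (s t : R) (i j k n : nat).

Local Notation T := (semigroup_op p).
Local Notation L1 f := (abs_summable (fun k => m k * f k)).
Local Notation dot := (L2dot m).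
Let m_ge0 := m_ge0 H.

Lemma near0_gt0 : \forall t \near (0 : R)^'+, 0 < t.
Proof. exact: nbhs_right_gt. Qed.

Lemma near0_ge0 : \forall t \near (0 : R)^'+, 0 <= t.
Proof. by near=> t; apply/ltW; near: t; exact: nbhs_right_gt.
Unshelve. all: by end_near. Qed.

Lemma op_cvg0 f i : L1 f -> T t f i @[t --> 0^'+] --> f i.
Proof.
move=> Lf; have sf : abs_summable (fun k => (m i)^-1 * `|m k * f k|).
  exact/abs_summableZ/abs_summable_norm.
rewrite -[X in _ --> X](op_id H f i); apply: (tannery sf).
  by near=> t; move=> k; apply: (op_dom H); near: t; exact: near0_ge0.
move=> j; rewrite (sg_id (ss_base H)); apply: cvgM; last exact: cvg_cst.
exact: sg_standard (ss_base H) _ _.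
Unshelve. all: by end_near. Qed.

Lemma dot_op_cvg0 f g M : (forall k, `|f k| <= M) -> L2 m g ->
  dot (T t f) g @[t --> 0^'+] --> dot f g.
Proof.
move=> fM Lg; have sg := abs_summableZ M (abs_summable_norm (L2_L1 H Lg)).
apply: (tannery sg).
  near=> t; move=> k; have t0 : 0 <= t by near: t; exact: near0_ge0.
  rewrite -mulrA mulrCA normrM ler_wpM2r//.
  exact: (op_bounded H _ t0 fM).
move=> k; apply: cvgM; last exact: cvg_cst.
by apply: cvgM; [exact: cvg_cst|exact/op_cvg0/(bounded_L1 H fM)].
Unshelve. all: by end_near. Qed.

Lemma ler_dotD f g : L2 m f -> L2 m g ->
  dot (fun k => f k + g k) (fun k => f k + g k) <= 2 * dot f f + 2 * dot g g.
Proof.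
move=> Lf Lg; rewrite !dotE -!rsumZ; [|exact/(L2P H)..].
rewrite -rsumD; [|exact/abs_summableZ/(L2P H)..].
apply: ler_rsum; [exact/(L2P H)/(L2D H)|exact/abs_summableD/abs_summableZ/(L2P H)/Lg/abs_summableZ/(L2P H)|] => k.
rewrite (_ : 2 * _ + 2 * _ = m k * (2 * f k ^+ 2 + 2 * g k ^+ 2)); last by ring.
rewrite ler_wpM2l//; have := sqr_ge0 (f k - g k); nra.
Qed.

Lemma dot_tail_cvg0 f : L2 m f ->
  dot (fun k => if (k < N)%N then 0 else f k)
      (fun k => if (k < N)%N then 0 else f k) @[N --> \oo] --> (0 : R).
Proof.
move=> /(L2P H)/rsum_tail0; rewrite (_ : (fun N => dot _ _) =
  (fun N => rsum (fun k => if (k < N)%N then 0 else m k * f k ^+ 2)))//.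
apply/funext => N; rewrite dotE; apply: eq_rsum => k.
by case: ifP => //; rewrite expr0n mulr0.
Qed.

(** Split f into a finitely supported g and a tail h of small norm. For g, contraction gives |T_t g
    - g|^2 <= 2 ((g, g) - (T_t g, g)), which tends to 0; for h, contraction alone is enough. *)
Lemma op_strongly_continuous f : L2 m f ->
  dot (fun k => T t f k - f k) (fun k => T t f k - f k) @[t --> 0^'+] --> (0 : R).
Proof.
move=> Lf; apply/cvgrPdist_lt => e e0.
have e16 : 0 < e / 16 by rewrite divr_gt0.
have [N tailN] : exists N, dot (fun k => if (k < N)%N then 0 else f k)
    (fun k => if (k < N)%N then 0 else f k) < e / 16.
  have /cvgrPdist_lt/(_ _ e16)[N _ /(_ N (leqnn N))] /= := dot_tail_cvg0 Lf.
  by rewrite sub0r normrN => tN; exists N; apply: le_lt_trans (ler_norm _) tN.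
set h := fun k => if (k < N)%N then 0 else f k in tailN.
set g := fun k => if (k < N)%N then f k else 0.
have fgh : f = (fun k => g k + h k).
  by apply/funext => k; rewrite /g /h; case: ifP; rewrite ?addr0 ?add0r.
have Lg : L2 m g by apply: (finite_L2 H (N := N)) => k; rewrite /g leqNgt => /negbTE ->.
have Lh : L2 m h.
  by apply: (le_L2 H Lf) => k; rewrite /h; case: ifP; rewrite ?normr0.
have gM k : `|g k| <= \sum_(0 <= k < N) `|f k|.
  rewrite /g; case: ifP => [kN|_]; last by rewrite normr0 sumr_ge0.
  by rewrite (bigD1_seq k) ?iota_uniq ?mem_index_iota//= lerDl sumr_ge0.
have /cvgrPdist_lt/(_ _ e16) := dot_op_cvg0 gM Lg.
move=> near_g; near=> t; have t0 : 0 <= t by near: t; exact: near0_ge0.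
have LTg : L2 m (T t g) by exact: op_L2 H t g t0 Lg.
have LTh : L2 m (T t h) by exact: op_L2 H t h t0 Lh.
have g1 : `|dot g g - dot (T t g) g| < e / 16 by near: t; exact: near_g.
have g2 : dot (fun k => T t g k - g k) (fun k => T t g k - g k) < e / 8.
  have LTgg := L2B H LTg Lg.
  rewrite (dotBl H)// dotC (dotBl H)// [X in _ - X]dotC (dotBl H)//.
  rewrite [dot g (T t g)]dotC.
  have := op_contraction H t0 Lg; move: g1; rewrite ltr_norml => /andP[_].
  lra.
have g3 : dot (fun k => T t h k - h k) (fun k => T t h k - h k) < e / 4.
  rewrite (_ : (fun k => T t h k - h k) = (fun k => T t h k + (-1) * h k)); last first.
    by apply/funext => k; rewrite mulN1r.
  apply: le_lt_trans (ler_dotD LTh (L2Z H (-1) Lh)) _.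
  have -> : dot (fun k => -1 * h k) (fun k => -1 * h k) = dot h h.
    by apply: eq_rsum => k; ring.
  have := op_contraction H t0 Lh; lra.
have -> : (fun k => T t f k - f k) = (fun k => (T t g k - g k) + (T t h k - h k)).
  by apply/funext => k; rewrite fgh (opD H)//; [ring|exact: (L2_L1 H)..].
rewrite sub0r normrN ger0_norm; last first.
  by apply: (dot_ge0 H); apply: (L2D H); exact: (L2B H).
have := ler_dotD (L2B H LTg Lg) (L2B H LTh Lh); lra.
Unshelve. all: by end_near. Qed.

Lemma killing_ge0 s h : 0 <= s -> L1 h -> (forall k, 0 <= h k) -> 0 <= killing m p s h.
Proof.
move=> s0 Lh h0; rewrite /killing mulr_ge0 ?invr_ge0//.
apply: rsum_ge0; first exact: (killing_summable H).
by move=> k; rewrite !mulr_ge0//; have /andP[] := op1_compl H k s0.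
Qed.

(** At fixed s the form passes to bounded pointwise limits, m being finite. Thresholds are removed
    in this way. *)
Lemma dot_op_uniform s (u : nat -> nat -> R) f M : 0 <= s ->
  (forall n k, `|u n k| <= M) -> (forall k, u n k @[n --> \oo] --> f k) ->
  approx_form m p s (u n) (u n) @[n --> \oo] --> approx_form m p s f f.
Proof.
move=> s0 uM uf.
have fM k : `|f k| <= M.
  have /cvg_norm fk := uf k; rewrite -(cvg_lim _ fk)//; apply: limr_le.
    by apply/cvg_ex; eexists; exact: fk.
  exact: nearW.
have M0 : 0 <= M by exact: le_trans (fM 0%N).
apply: cvgM; first exact: cvg_cst.
apply: (tannery (abs_summableZ (2 * M * M) (ss_mass_finite H))).
  apply: nearW => n k; rewrite !normrM (ger0_norm (m_ge0 k)).
  rewrite -mulrA mulrC ler_wpM2r//.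
  apply: ler_pM => //; apply: le_trans (ler_normB _ _) _.
  have := uM n k; have := op_bounded H k s0 (uM n); lra.
move=> k; apply: cvgM; last exact: uf.
apply: cvgM; first exact: cvg_cst.
apply: cvgB; first exact: uf.
apply: (tannery (abs_summableZ M (row_summable H k s0))).
  apply: nearW => n j; rewrite normrM ger0_norm ?(sg_ge0 (ss_base H))// mulrC.
  by rewrite ler_wpM2r// (sg_ge0 (ss_base H)).
by move=> j; apply: cvgM; [exact: cvg_cst|exact: uf].
Qed.

End SmallTime.

(** * Scale, speed measure and energy of the birth-death chain *)

Section BirthDeath.
Context {R : realType} {a b : nat -> R}.
Hypothesis ha : forall k, (1 <= k)%N -> 0 < a k.
Hypothesis hb : forall k, 0 < b k.
Implicit Types (f g h : nat -> R) (s t : R) (i j k n N : nat).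
Local Notation m := (mu a b).
Local Notation c := (c a b).

Lemma mu_gt0 k : 0 < m k.
Proof.
rewrite /mu divr_gt0//; first by apply: prodr_gt0 => i _.
by rewrite big_nat prodr_gt0// => i /andP[i1 _]; exact: ha.
Qed.

Lemma mu0 : m 0%N = 1.
Proof. by rewrite /mu !big_geq// divr1. Qed.

Lemma mu_detailed k : m k * b k = m k.+1 * a k.+1.
Proof.
rewrite /mu [in RHS]big_nat_recr//= [in RHS](big_nat_recr k.+1)//=.
have A : \prod_(1 <= i < k.+1) a i != 0.
  by rewrite gt_eqF// big_nat prodr_gt0// => i /andP[i1 _]; exact: ha.
have ak : a k.+1 != 0 by rewrite gt_eqF// ha.
by field; rewrite A ak.
Qed.

(** c is the natural scale: its increments are half the resistances of the edges. Hence [formA] at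
    (f, f) is the sum of the energies m_k b_k (f(k+1) - f(k))^2. *)
Lemma c_diff k : c k.+1 - c k = (2 * (m k * b k))^-1.
Proof.
rewrite /Defs.c/=; case: k => [|k] /=.
  by rewrite big_geq// mu0 mul1r addr0 subr0.
rewrite big_nat_recr//= addrA addrAC addrAC [X in X = _]addrAC subrr add0r.
rewrite /mu !(big_nat_recr k.+1)//=.
have B : \prod_(0 <= i < k.+1) b i != 0 by rewrite gt_eqF// prodr_gt0.
have A : \prod_(1 <= i < k.+1) a i != 0.
  by rewrite gt_eqF// big_nat prodr_gt0// => i /andP[i1 _]; exact: ha.
have bk : b k.+1 != 0 by rewrite gt_eqF.
have ak : a k.+1 != 0 by rewrite gt_eqF// ha.
by field; rewrite A B bk ak.
Qed.

Lemma cond_gt0 k : 0 < m k * b k.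
Proof. by rewrite mulr_gt0// mu_gt0. Qed.

Lemma c_lt k : c k < c k.+1.
Proof. by rewrite -subr_gt0 c_diff invr_gt0 mulr_gt0// cond_gt0. Qed.

Lemma c_mono i j : (i <= j)%N -> c i <= c j.
Proof.
elim: j => [|j IH]; first by rewrite leqn0 => /eqP ->.
by rewrite leq_eqVlt => /predU1P[->//|/IH /le_trans]; apply; exact/ltW/c_lt.
Qed.

Lemma c_ge0 k : 0 <= c k.
Proof. exact: (@c_mono 0 k). Qed.

(** lambda dominates c_1 times the mass of mu outside 0, and sigma dominates every c_k because its
    inner sums are at least mu_0 = 1. *)
Lemma regular_summable : regular_boundary a b ->
  abs_summable m /\ exists C, forall k, c k <= C.
Proof.
move=> [sg lm]; have mu0' k := ltW (mu_gt0 k).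
split.
  have cm0 k : 0 <= c k * m k by rewrite mulr_ge0// c_ge0.
  have [/(_ lm) [M hM] _] := nneseries_ltyP cm0.
  have c1 : 0 < c 1%N by exact: (c_lt 0).
  apply: (@nneg_abs_summable _ _ (m 0%N + (c 1%N)^-1 * M)) => // n.
  case: n => [|n].
    have M0 : 0 <= M by have := hM 0%N; rewrite big_geq.
    by rewrite big_geq// addr_ge0// mulr_ge0// invr_ge0 ltW.
  rewrite big_nat_recl//= lerD2l -(ler_pM2l c1) mulrA divff ?gt_eqF// mul1r.
  apply: le_trans (hM n.+1); rewrite big_nat_recl//= mulr_sumr ler_wpDl//.
  apply: ler_sum => i _; rewrite (ger0_norm (cm0 _)).
  by rewrite ler_wpM2r// c_mono.
have cs0 k : 0 <= (c k.+1 - c k) * \sum_(0 <= i < k.+1) m i.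
  by rewrite mulr_ge0 ?sumr_ge0// subr_ge0 c_mono.
have [/(_ sg) [M hM] _] := nneseries_ltyP cs0; exists M => k.
apply: le_trans (hM k); elim: k => [|k IH]; first by rewrite big_geq.
rewrite big_nat_recr//= -[leLHS](subrK (c k)) addrC lerD//.
have S1 : 1 <= \sum_(0 <= i < k.+1) m i.
  by rewrite big_nat_recl//= mu0 lerDl sumr_ge0.
have d0 : 0 <= c k.+1 - c k by rewrite subr_ge0 c_mono.
by rewrite ger0_norm; [rewrite ler_peMr|rewrite mulr_ge0// (le_trans _ S1)].
Qed.

Definition edge_energy f k := mu a b k * b k * (f k.+1 - f k) ^+ 2.

Lemma energy_ge0 f k : 0 <= edge_energy f k.
Proof. by rewrite mulr_ge0 ?sqr_ge0// ltW// cond_gt0. Qed.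

Lemma domGP f : domG a b f <-> L2 m f /\ abs_summable (edge_energy f).
Proof.
have E k : (f k.+1 - f k) ^+ 2 / (c k.+1 - c k) = 2 * edge_energy f k.
  by rewrite c_diff invrK /edge_energy mulrC; ring.
rewrite /domG/= (_ : (\sum_(0 <= k <oo) _)%E = (\sum_(0 <= k <oo) (2 * edge_energy f k)%:E)%E); last first.
  by apply: eq_eseriesr => k _; rewrite E.
split=> -[Lf]; last first.
  move=> sf; split => //; apply/nneseries_ltyP; last exact: abs_summableZ.
  by move=> k; rewrite mulr_ge0 ?energy_ge0.
move/nneseries_ltyP => sf; split => //.
have := abs_summableZ 2^-1 (sf (fun k => mulr_ge0 _ (energy_ge0 f k))).
rewrite (_ : (fun k => _) = edge_energy f)//.
  by apply; rewrite ler0n.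
by apply/funext => k; rewrite mulrA mulVf ?mul1r.
Qed.

Lemma formAE f g : abs_summable (edge_energy f) -> abs_summable (edge_energy g) ->
  [/\ abs_summable (fun k => m k * b k * (f k.+1 - f k) * (g k.+1 - g k)) &
  formA a b f g = rsum (fun k => m k * b k * (f k.+1 - f k) * (g k.+1 - g k))].
Proof.
move=> sf sg.
have S : abs_summable (fun k => m k * b k * (f k.+1 - f k) * (g k.+1 - g k)).
  apply: le_abs_summable (abs_summableD sf sg) _ => k.
  have w0 := ltW (cond_gt0 k).
  rewrite -mulrA normrM ger0_norm// /edge_energy -mulrDr ler_wpM2l// ler_norml.
  move: (f k.+1 - f k) (g k.+1 - g k) => x y.
  have := sqr_ge0 (x + y); have := sqr_ge0 (x - y); nra.
split => //; rewrite /formA.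
rewrite [X in _ * X](_ : _ = 2 * rsum (fun k => m k * b k * (f k.+1 - f k) * (g k.+1 - g k))).
  by rewrite mulrA mulVf ?mul1r.
by rewrite -rsumZ//; apply: eq_rsum => k; rewrite c_diff invrK; ring.
Qed.

(* Cauchy-Schwarz along the path from i to i + n. *)
Lemma oscillation f i n : (f (i + n)%N - f i) ^+ 2 <=
  2 * (c (i + n)%N - c i) * \sum_(i <= k < i + n) edge_energy f k.
Proof.
elim: n => [|n IH].
  by rewrite addn0 !subrr expr0n/= mulr0 mul0r.
rewrite addnS big_nat_recr ?leq_addr//=.
have := IH; have := energy_ge0 f (i + n); have := c_diff (i + n).
set w := c (i + n).+1 - c (i + n)%N => wE.
have w0 : 0 < w by rewrite subr_gt0 c_lt.
have -> : edge_energy f (i + n) = (f (i + n).+1 - f (i + n)%N) ^+ 2 / (2 * w).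
  by rewrite /edge_energy wE; field; rewrite !gt_eqF ?mu_gt0 ?hb.
have -> : c (i + n).+1 - c i = (c (i + n)%N - c i) + w by rewrite /w; ring.
have W0 : 0 <= c (i + n)%N - c i by rewrite subr_ge0 c_mono// leq_addr.
have -> : f (i + n).+1 - f i = (f (i + n)%N - f i) + (f (i + n).+1 - f (i + n)%N) by ring.
have : 0 <= \sum_(i <= k < i + n) edge_energy f k by apply: sumr_ge0 => k _; exact: energy_ge0.
move: (\sum_(i <= k < i + n) _) (f (i + n)%N - f i) (f (i + n).+1 - _) (c (i + n)%N - _) W0 => S x y W W0 S0 e0 xWS.
set e := y ^+ 2 / (2 * w) in e0 *.
have ye : y ^+ 2 = 2 * w * e by rewrite /e; field; rewrite gt_eqF.
rewrite (_ : 2 * (W + w) * (S + e) = 2 * W * S + y ^+ 2 + 2 * (W * e + w * S)); last first.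
  by rewrite ye; ring.
rewrite sqrrD -mulr_natl.
(* The cross term: x^2 <= 2 W S and y^2 = 2 w e give (x y)^2 <= 4 (W e)(w S) <= (W e + w S)^2. *)
suff : x * y <= W * e + w * S by lra.
have [xy0|xy0] := ltP (x * y) 0.
  by rewrite ltW// (lt_le_trans xy0)// addr_ge0// mulr_ge0// ltW.
have Q0 : 0 <= W * e + w * S by rewrite addr_ge0// mulr_ge0// ltW.
rewrite -(@ler_pXn2r _ 2)// ?nnegrE//.
rewrite exprMn ye.
have xw : x ^+ 2 * (2 * w * e) <= (2 * W * S) * (2 * w * e).
  by rewrite ler_wpM2r// mulr_ge0// mulr_ge0// ltW.
have := sqr_ge0 (W * e - w * S); nra.
Qed.

(** With w = m_k b_k, |x| <= w x^2 + 1/(2w) bounds each increment of f by the edge energy plus the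
    increment of c. Both are summable. *)
Lemma energy_cvg f C : (forall k, c k <= C) -> abs_summable (edge_energy f) -> cvgn f.
Proof.
move=> cC sf.
have sc : abs_summable (fun k => c k.+1 - c k).
  apply: (@nneg_abs_summable _ _ C) => [k|n]; first by rewrite subr_ge0 c_mono.
  by rewrite telescope_sumr// (_ : c 0 = 0)// subr0.
have sd : abs_summable (fun k => f k.+1 - f k).
  apply: le_abs_summable (abs_summableD sf sc) _ => k.
  rewrite c_diff /edge_energy; have := cond_gt0 k; move: (m k * b k) => w w0.
  move: (f k.+1 - f k) => x.
  have w2 : 0 < 2 * w by rewrite mulr_gt0.
  rewrite -(ler_pM2l w2) mulrDr divff ?gt_eqF// -[`|x|]mul1r.
  rewrite (_ : 2 * w * (w * x ^+ 2) = 2 * (w * `|x|) ^+ 2); last first.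
    by rewrite exprMn -normrX ger0_norm ?sqr_ge0//; ring.
  by have := sqr_ge0 (2 * (w * `|x|) - 1); nra.
have E : f = (fun n => f 0%N + series (fun k => f k.+1 - f k) n).
  by apply/funext => n; rewrite /series/= telescope_sumr// addrC subrK.
rewrite E; apply: is_cvgD; first exact: is_cvg_cst.
exact: abs_summable_cvg.
Qed.

(** When c tends to C, this is a rate of convergence at infinity common to all f of energy at most
    K. *)
Lemma oscillation_lim f C i K : (forall k, c k <= C) -> abs_summable (edge_energy f) ->
  rsum (edge_energy f) <= K -> (limn f - f i) ^+ 2 <= 2 * (C - c i) * K.
Proof.
move=> cC sf fK; have cf := energy_cvg cC sf.
have C2 : (f (i + n)%N - f i) ^+ 2 @[n --> \oo] --> (limn f - f i) ^+ 2.
  rewrite expr2; under eq_fun do rewrite expr2.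
  have cf' : f (i + n)%N @[n --> \oo] --> limn f.
    rewrite (_ : (fun n => f (i + n)%N) = (fun n => f (n + i)%N)); last first.
      by apply/funext => n; rewrite addnC.
    by have Eq := cvg_shiftn i f (nbhs (limn f)); rewrite /mk_sequence/= in Eq; rewrite Eq.
  by apply: cvgM; apply: cvgB => //; exact: cvg_cst.
rewrite -(cvg_lim _ C2)//; apply: limr_le; first by apply/cvg_ex; eexists; exact: C2.
apply: nearW => n; apply: le_trans (oscillation f i n) _.
have s0 : 0 <= \sum_(i <= k < i + n) edge_energy f k.
  by apply: sumr_ge0 => k _; exact: energy_ge0.
apply: ler_pM => //.
- by rewrite mulr_ge0// subr_ge0 c_mono// leq_addr.
- by rewrite ler_wpM2l// lerD2r.
apply: le_trans fK; apply: le_trans (partial_le_rsum (i + n) sf (energy_ge0 f)).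
by rewrite [leRHS](@big_cat_nat _ _ _ i)//= ?leq_addr// lerDr sumr_ge0// => k _; exact: energy_ge0.
Qed.

End BirthDeath.

Arguments edge_energy {R} a b f k.

(** Lets properties of all small times meet bounds that are known at the times r/(n + 1). *)
Lemma near0_sequence (R : realType) (P : R -> Prop) (r : R) : 0 < r ->
  (\forall s \near 0^'+, P s) -> exists n, P (r / n.+1%:R).
Proof.
move=> r0 [d /= d0 dP]; exists (Num.truncn (r / d)).
have rn : 0 < r / (Num.truncn (r / d)).+1%:R by rewrite divr_gt0.
apply: dP => //=; rewrite sub0r normrN gtr0_norm// ltr_pdivrMr// mulrC.
by rewrite -ltr_pdivrMr// truncnS_gt.
Qed.

(** * Jump part of the approximating forms *)

Section DirichletForm.
Context {R : realType} {a b : nat -> R} {p : R -> nat -> nat -> R} {C : R}.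
Hypothesis ha0 : a 0%N = 0.
Hypothesis ha : forall k, (1 <= k)%N -> 0 < a k.
Hypothesis hb : forall k, 0 < b k.
Hypothesis hC : c a b n @[n --> \oo] --> C.
Hypothesis H : symmetric_semigroup (mu a b) p.
Hypothesis hQ : forall i j, t^-1 * (p t i j - p 0 i j) @[t --> 0^'+] --> Qmatrix a b i j.
Implicit Types (f g h : nat -> R) (s t : R) (i j k n N : nat).
Local Notation m := (mu a b).
Local Notation c := (c a b).
Local Notation T := (semigroup_op p).
Local Notation dot := (L2dot m).
Local Notation En := (approx_form m p).
Local Notation kill := (killing m p).
Local Notation energy := (edge_energy a b).

Let m_ge0 := m_ge0 H.
Let e_ge0 := energy_ge0 ha hb.

Lemma c_leC k : c k <= C.
Proof.
rewrite -(cvg_lim _ hC)//; apply: nondecreasing_cvgn_le.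
  by move=> i j ij; exact: c_mono.
by apply/cvg_ex; exists C.
Qed.

Lemma Qmatrix_diag k : Qmatrix a b k k = - (a k + b k).
Proof. by rewrite /Qmatrix eqxx. Qed.

Lemma Qmatrix_up k : Qmatrix a b k k.+1 = b k.
Proof. by rewrite /Qmatrix eqxx (_ : (k.+1 == k) = false)//; lia. Qed.

Lemma Qmatrix_down k : Qmatrix a b k.+1 k = a k.+1.
Proof.
rewrite /Qmatrix eqxx (_ : (k == k.+1) = false); last by lia.
by rewrite (_ : (k == k.+2) = false)//; lia.
Qed.

Lemma Qmatrix_far i j : (i.+1 < j)%N || (j.+1 < i)%N -> Qmatrix a b i j = 0.
Proof.
move=> ij; rewrite /Qmatrix (_ : (j == i) = false); last by lia.
rewrite (_ : (j == i.+1) = false); last by lia.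
by rewrite (_ : (i == j.+1) = false)//; lia.
Qed.

(** At i = 0 the predecessor is 0 itself and [a 0] vanishes, so one formula covers the reflecting
    end. *)
Lemma Qmatrix_row_sum f i :
  \sum_(0 <= j < i.+2) Qmatrix a b i j * f j =
  b i * (f i.+1 - f i) - a i * (f i - f i.-1).
Proof.
rewrite !big_nat_recr//= Qmatrix_diag Qmatrix_up.
case: i => [|k]; first by rewrite big_nil ha0; ring.
rewrite big_nat_recr//= Qmatrix_down big_nat big1; first by ring.
by move=> j /andP[_ jk]; rewrite Qmatrix_far ?mul0r//; lia.
Qed.

Lemma rate_up k : t^-1 * p t k k.+1 @[t --> 0^'+] --> b k.
Proof.
have := hQ (i := k) (j := k.+1); rewrite Qmatrix_up (sg_id (ss_base H)).
rewrite (_ : (k == k.+1) = false); last by lia.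
by under eq_fun do rewrite subr0.
Qed.

(** Q is tridiagonal with zero row sums, so row i puts only o(t) of its mass outside {0, ..., i +
    1}, lost mass included. *)
Lemma row_escape_rate i :
  t^-1 * (1 - \sum_(0 <= j < i.+2) p t i j) @[t --> 0^'+] --> (0 : R).
Proof.
have cS : \sum_(0 <= j < i.+2) t^-1 * (p t i j - p 0 i j) @[t --> 0^'+] -->
    \sum_(0 <= j < i.+2) Qmatrix a b i j.
  by apply: cvg_sum_nat => j; exact: hQ.
have Q0 : \sum_(0 <= j < i.+2) Qmatrix a b i j = 0.
  have := Qmatrix_row_sum (fun=> 1) i; rewrite !subrr !mulr0 subrr => {2}<-.
  by apply: eq_bigr => j _; rewrite mulr1.
have cS' : - \sum_(0 <= j < i.+2) t^-1 * (p t i j - p 0 i j) @[t --> 0^'+] --> - (0 : R).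
  by apply: cvgN; move: cS; rewrite Q0.
rewrite oppr0 in cS'; apply: cvg_trans cS'; apply: near_eq_cvg; near=> t.
rewrite /= -mulr_sumr sumrB -mulrN opprB; congr (_ * (_ - _)).
rewrite (eq_bigr (fun j => if j == i then 1 else 0)); last first.
  by move=> j _; rewrite (sg_id (ss_base H)) eq_sym; case: eqP.
by rewrite -big_mkcond big_nat1_eq leq0n ltnS leqnSn.
Unshelve. all: by end_near. Qed.

Lemma escape_rate i : t^-1 * (1 - T t (fun=> 1) i) @[t --> 0^'+] --> (0 : R).
Proof.
apply: (squeeze_cvgr _ (cvg_cst 0) (row_escape_rate i)).
near=> t; have t0 : 0 <= t by near: t; exact: near0_ge0.
have /andP[r0 _] := op1_compl H i t0.
rewrite mulr_ge0 ?invr_ge0//= ler_wpM2l ?invr_ge0// lerD2l lerN2.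
have -> : T t (fun=> 1) i = rsum (p t i) by apply: eq_rsum => j; rewrite mulr1.
apply: partial_le_rsum; first exact: row_summable H _ _ t0.
by move=> j; exact: (sg_ge0 (ss_base H)).
Unshelve. all: by end_near. Qed.

Lemma killing_local N (z : nat -> R) :
  kill t (fun i => if (i < N)%N then z i else 0) @[t --> 0^'+] --> (0 : R).
Proof.
have : \sum_(0 <= i < N) m i * z i * (t^-1 * (1 - T t (fun=> 1) i)) @[t --> 0^'+] -->
    \sum_(0 <= i < N) m i * z i * 0.
  by apply: cvg_sum_nat => i; apply: cvgM; [exact: cvg_cst|exact: escape_rate].
rewrite big1; last by move=> i _; rewrite mulr0.
apply: cvg_trans; apply: near_eq_cvg; near=> t.
rewrite /killing (@rsum_finite _ _ N); last first.
  by move=> k; rewrite leqNgt => /negbTE ->; rewrite mulr0.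
rewrite mulr_sumr !big_nat; apply: eq_bigr => i /andP[_ ->]; ring.
Unshelve. all: by end_near. Qed.

(** All jump terms are nonnegative, and only those between neighbours are kept. Each edge occurs
    twice, once from either end, which compensates the factor 1/2 of the jump part. *)
Lemma approx_form_lower s f N : 0 <= s -> L2 m f ->
  kill s (fun k => f k ^+ 2) +
  \sum_(0 <= k < N) m k * (s^-1 * p s k k.+1) * (f k.+1 - f k) ^+ 2 <= En s f f.
Proof.
move=> s0 Lf; have [s1 s2 ->] := approx_form_split H s0 Lf.
rewrite lerD2l.
have row0 i j : 0 <= p s i j * (f i - f j) ^+ 2.
  by rewrite mulr_ge0 ?sqr_ge0// (sg_ge0 (ss_base H)).
have row_ge0 i : 0 <= m i * rsum (fun j => p s i j * (f i - f j) ^+ 2).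
  by rewrite mulr_ge0//; exact: rsum_ge0.
apply: le_trans (ler_wpM2l _ (partial_le_rsum N.+1 s2 row_ge0)); last first.
  by rewrite invr_ge0 mulr_ge0.
have : \sum_(0 <= k < N) m k * p s k k.+1 * (f k.+1 - f k) ^+ 2 *+ 2 <=
    \sum_(0 <= i < N.+1) m i * rsum (fun j => p s i j * (f i - f j) ^+ 2).
  (* The downward jump from i, absent at 0. Shifting its index by one pairs it with the upward jump
     along the same edge. *)
  pose lower i := if i is k.+1 then m i * p s i k * (f i - f k) ^+ 2 else 0.
  apply: (@le_trans _ _ (\sum_(0 <= i < N.+1)
    (lower i + m i * p s i i.+1 * (f i - f i.+1) ^+ 2))); last first.
    apply: ler_sum => i _.
    apply: le_trans (ler_wpM2l (m_ge0 i) (partial_le_rsum i.+2 (s1 i) (row0 i))).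
    rewrite !big_nat_recr//= !mulrDr !mulrA lerD2r.
    rewrite subrr !mulr0 addr0 /lower.
    case: (i) => [|k]; first by rewrite big_nil mulr0.
    rewrite big_nat_recr//= mulrDr [X in _ <= _ + X]mulrA lerDr mulr_ge0//.
    by apply: sumr_ge0 => j _.
  rewrite [leRHS]big_split/= [X in _ <= X + _]big_nat_recl//=.
  rewrite [X in _ <= _ + X]big_nat_recr//= add0r addrA -big_split/=.
  rewrite -[leLHS]addr0 lerD//; last first.
    by rewrite -mulrA mulr_ge0.
  apply: ler_sum => k _; rewrite mulr2n /lower lerD//.
    by rewrite (ss_sym H)// mulrAC.
  by rewrite -[X in _ <= _ * X]sqrrN opprB.
move=> le2.
have s20 : 0 <= (2 * s)^-1 by rewrite invr_ge0 mulr_ge0.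
apply: le_trans (ler_wpM2l s20 le2).
rewrite mulr_sumr; apply: ler_sum => k _; rewrite invfM le_eqVlt.
by move: (s^-1) => w; apply/orP; left; apply/eqP; rewrite -mulr_natr; field.
Qed.

Lemma approx_energy_near f N e : 0 < e -> L2 m f ->
  \forall s \near 0^'+, \sum_(0 <= k < N) energy f k - e + kill s (fun k => f k ^+ 2) <= En s f f.
Proof.
move=> e0 Lf.
have : \sum_(0 <= k < N) m k * (t^-1 * p t k k.+1) * (f k.+1 - f k) ^+ 2 @[t --> 0^'+] -->
   \sum_(0 <= k < N) energy f k.
  apply: cvg_sum_nat => k; apply: cvgM; last exact: cvg_cst.
  by apply: cvgM; [exact: cvg_cst|exact: rate_up].
move/cvgrPdist_lt/(_ _ e0) => near_e; near=> s.
have s0 : 0 <= s by near: s; exact: near0_ge0.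
apply: le_trans (approx_form_lower N s0 Lf).
rewrite addrC lerD2l lerBlDr addrC -lerBlDr ltW//; apply: le_lt_trans (ler_norm _) _.
by near: s; exact: near_e.
Unshelve. all: by end_near. Qed.

(** A Fatou argument: partial sums of the energy are, up to e, below E_s for all small s, so a bound
    along one sequence of times suffices. *)
Lemma energy_le_of_approx h (r K : R) : 0 < r -> L2 m h ->
  (forall n, En (r / n.+1%:R) h h <= K) ->
  abs_summable (energy h) /\ rsum (energy h) <= K.
Proof.
move=> r0 Lh hK.
have le N : \sum_(0 <= k < N) energy h k <= K.
  apply/ler_addgt0Pr => e e0.
  have [n] := near0_sequence r0 (approx_energy_near N e0 Lh).
  have : 0 <= kill (r / n.+1%:R) (fun k => h k ^+ 2).
    apply: (killing_ge0 H); [by rewrite divr_ge0// ltW|exact: (L2_sqr_L1 H)|].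
    by move=> k; exact: sqr_ge0.
  by have := hK n; lra.
have S := nneg_abs_summable (e_ge0 h) le.
by split => //; exact: rsum_le_bound.
Qed.

Lemma op_energy t f : 0 < t -> L2 m f ->
  abs_summable (energy (T t f)) /\ rsum (energy (T t f)) <= dot f f / (2 * t).
Proof.
move=> t0 Lf; apply: (@energy_le_of_approx _ (2 * t)); first by rewrite mulr_gt0.
  exact: (op_L2 H (ltW t0)).
by move=> n; have [] := approx_form_op H n t0 Lf.
Qed.

Lemma op_energy_le t f K : 0 < t -> L2 m f -> (forall s, 0 < s -> En s f f <= K) ->
  abs_summable (energy (T t f)) /\ rsum (energy (T t f)) <= K.
Proof.
move=> t0 Lf fK; apply: (@energy_le_of_approx _ (2 * t)); first by rewrite mulr_gt0.
  exact: (op_L2 H (ltW t0)).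
move=> n; have [h _] := approx_form_op H n t0 Lf; apply: le_trans h (fK _ _).
by rewrite divr_gt0// mulr_gt0.
Qed.

(** A Sobolev bound: as mu_0 = 1, the norm controls the value at 0, and the energy of T_t f controls
    the oscillation from 0. So T_t maps L^2 into bounded functions. *)
Lemma op_sup_bound t f i : 0 < t -> L2 m f ->
  T t f i ^+ 2 <= (2 + 2 * C / t) * dot f f.
Proof.
move=> t0 Lf; have [S E] := op_energy t0 Lf.
have C0 : 0 <= C by have := c_leC 0.
have F0 : T t f 0%N ^+ 2 <= dot f f.
  apply: le_trans (op_contraction H (ltW t0) Lf); rewrite dotE.
  have LT := op_L2 H (ltW t0) Lf.
  rewrite -[leLHS]mul1r -(@mu0 _ a b).
  apply: (@term_le_rsum _ (fun k => m k * T t f k ^+ 2)); first exact/(L2P H).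
  by move=> k; exact: (m_sqr_ge0 H).
have Fi : (T t f i - T t f 0%N) ^+ 2 <= C / t * dot f f.
  have := oscillation ha hb (T t f) 0 i; rewrite add0n => /le_trans; apply.
  rewrite (_ : C / t * _ = 2 * C * (dot f f / (2 * t))); last first.
    by field; rewrite gt_eqF.
  apply: ler_pM => //.
  - by rewrite mulr_ge0// subr_ge0 (c_mono ha hb).
  - by apply: sumr_ge0 => k _; exact: e_ge0.
  - rewrite ler_wpM2l// lerBlDr (le_trans (c_leC i))// lerDl.
    exact: (c_ge0 ha hb).
  - exact: le_trans (partial_le_rsum i S (e_ge0 _)) E.
have := sqr_ge0 (T t f i - 2 * T t f 0%N).
have -> : (2 + 2 * C / t) * dot f f = 2 * dot f f + 2 * (C / t * dot f f) by ring.
move: Fi F0; move: (T t f i) (T t f 0%N) (dot f f) (C / t * dot f f) => *; nra.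
Qed.

Lemma Q_finite_sum f i N : (forall k, (N <= k)%N -> f k = 0) ->
  \sum_(0 <= j < N) Qmatrix a b i j * f j =
  b i * (f i.+1 - f i) - a i * (f i - f i.-1).
Proof.
move=> f0; transitivity (rsum (fun j => Qmatrix a b i j * f j)).
  by rewrite (@rsum_finite _ _ N)// => k /f0 ->; rewrite mulr0.
rewrite (@rsum_finite _ _ i.+2) ?Qmatrix_row_sum// => k ik.
by rewrite Qmatrix_far ?mul0r//; lia.
Qed.

(** Green's formula; the boundary term disappears when f vanishes from N on. *)
Lemma summation_by_parts f N :
  \sum_(0 <= i < N) m i * f i * - (b i * (f i.+1 - f i) - a i * (f i - f i.-1)) =
  \sum_(0 <= i < N) energy f i - m N * a N * (f N - f N.-1) * f N.
Proof.
elim: N => [|N IH]; first by rewrite !big_nil ha0; ring.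
rewrite !big_nat_recr//= IH -(mu_detailed ha N) /edge_energy; ring.
Qed.

(** Only the entries of p below N enter, so the derivatives at 0 can be taken one by one; the limit
    is -(Q f, f). *)
Lemma approx_form_finite f N : (forall k, (N <= k)%N -> f k = 0) ->
  En t f f @[t --> 0^'+] --> rsum (energy f).
Proof.
move=> f0; rewrite (@rsum_finite _ _ N); last first.
  by move=> k Nk; rewrite /edge_energy !f0// ?leqW// subrr expr0n/= mulr0.
rewrite -[X in _ --> X]subr0 -[X in _ --> _ - X](mulr0 (m N * a N * (f N - f N.-1))).
rewrite -[X in _ * X](f0 N)// -summation_by_parts.
have : \sum_(0 <= i < N) m i * f i * - (\sum_(0 <= j < N) t^-1 * (p t i j - p 0 i j) * f j) @[t --> 0^'+] -->
    \sum_(0 <= i < N) m i * f i * - (b i * (f i.+1 - f i) - a i * (f i - f i.-1)).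
  apply: cvg_sum_nat => i; apply: cvgM; first exact: cvg_cst.
  rewrite -(Q_finite_sum _ f0); apply: cvgN; apply: cvg_sum_nat => j.
  by apply: cvgM; [exact: hQ|exact: cvg_cst].
apply: cvg_trans; apply: near_eq_cvg; near=> t.
rewrite /approx_form /L2dot (@rsum_finite _ _ N); last first.
  by move=> k /f0 ->; rewrite mulr0.
have opE r i : T r f i = \sum_(0 <= j < N) p r i j * f j.
  by rewrite /semigroup_op (@rsum_finite _ _ N)// => k /f0 ->; rewrite mulr0.
rewrite mulr_sumr; apply: eq_bigr => i _.
have -> : f i - T t f i = - \sum_(0 <= j < N) (p t i j - p 0 i j) * f j.
  rewrite -{1}[f i](op_id H) !opE -sumrB -sumrN.
  by apply: eq_bigr => j _; ring.
by under eq_bigr do rewrite -mulrA; rewrite -mulr_sumr; ring.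
Unshelve. all: by end_near. Qed.

Lemma approx_form_finite_le s f N : 0 < s -> (forall k, (N <= k)%N -> f k = 0) ->
  En s f f <= rsum (energy f).
Proof.
move=> s0 f0; apply: (approx_form_le_lim H s0); last exact: approx_form_finite f0.
exact: (finite_L2 H f0).
Qed.

(** Cutting a function off beyond some N creates energy at the cut. A 1-Lipschitz map that sends a
    neighbourhood of 0 to 0 does not. *)
Definition soft_threshold (e x : R) : R :=
  if e < x then x - e else if x < - e then x + e else 0.

Lemma soft_threshold_dist e x : 0 <= e -> `|x - soft_threshold e x| <= e.
Proof.
move=> e0; rewrite /soft_threshold ler_norml.
by case: ltP => ?; [|case: ltP => ?]; apply/andP; split; lra.
Qed.

Lemma soft_threshold_norm e x : 0 <= e -> `|soft_threshold e x| <= `|x|.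
Proof.
move=> e0; rewrite /soft_threshold ler_norml.
have := ler_norm x; have := ler_norm (- x); rewrite normrN.
by case: ltP => ?; [|case: ltP => ?] => ? ?; apply/andP; split; lra.
Qed.

Lemma soft_threshold_contraction e x y : 0 <= e ->
  (soft_threshold e x - soft_threshold e y) ^+ 2 <= (x - y) ^+ 2.
Proof.
move=> e0; rewrite -[leLHS]real_normK ?num_real// -[leRHS]real_normK ?num_real//.
rewrite lerXn2r ?nnegrE// ler_norml /soft_threshold.
have := ler_norm (x - y); have := ler_norm (- (x - y)); rewrite normrN.
by case: (ltP e x) => ?; [|case: (ltP x (- e)) => ?];
  (case: (ltP e y) => ?; [|case: (ltP y (- e)) => ?]) => ? ?; apply/andP; split; lra.
Qed.

Lemma soft_threshold0 e x : `|x| <= e -> soft_threshold e x = 0.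
Proof.
by rewrite ler_norml /soft_threshold => /andP[? ?]; case: ltP => ?; [lra|case: ltP => ?; [lra|]].
Qed.

(* Soft thresholds of g are finitely supported and have at most its energy. *)
Lemma approx_form_vanishing_le s g : 0 < s -> abs_summable (energy g) ->
  g n @[n --> \oo] --> (0 : R) -> En s g g <= rsum (energy g).
Proof.
move=> s0 sg g0.
pose e n : R := harmonic n.
have e_gt0 n : 0 < e n by exact: harmonic_gt0.
pose u n k := soft_threshold (e n) (g k).
have [M gM] : exists M, forall k, `|g k| <= M.
  have /cvg_has_ub [M hM] : cvgn g by apply/cvg_ex; exists 0.
  by exists M => k; apply: hM; exists k.
have ug k : u n k @[n --> \oo] --> g k.
  apply/cvgrPdist_le => d d0; have /cvgrPdist_le/(_ _ d0) := @cvg_harmonic R.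
  apply: filterS => n; rewrite sub0r normrN gtr0_norm// => /(le_trans _); apply.
  by apply: soft_threshold_dist; exact/ltW.
have uM n k : `|u n k| <= M.
  by apply: le_trans (soft_threshold_norm _ _) (gM k); exact/ltW.
have := dot_op_uniform H (ltW s0) uM ug => uE.
rewrite -(cvg_lim _ uE)//; apply: limr_le; first by apply/cvg_ex; eexists; exact: uE.
apply: nearW => n.
have [N _ uN] : \forall k \near \oo, `|0 - g k| <= e n.
  by move/cvgrPdist_le : g0; apply.
have u0 k : (N <= k)%N -> u n k = 0.
  by move=> /uN /=; rewrite sub0r normrN => /soft_threshold0.
apply: le_trans (approx_form_finite_le s0 u0) _.
have ue k : energy (u n) k <= energy g k.
  rewrite /edge_energy ler_wpM2l//; first exact/ltW/(cond_gt0 ha hb).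
  by apply: soft_threshold_contraction; exact/ltW.
apply: ler_rsum => //; apply: le_abs_summable sg _ => k.
by rewrite ger0_norm.
Qed.

End DirichletForm.

(** * Killing part and limit form *)

Section FormLimit.
Context {R : realType} {a b : nat -> R} {p : R -> nat -> nat -> R} {C : R}.
Hypothesis ha0 : a 0%N = 0.
Hypothesis ha : forall k, (1 <= k)%N -> 0 < a k.
Hypothesis hb : forall k, 0 < b k.
Hypothesis hC : c a b n @[n --> \oo] --> C.
Hypothesis H : symmetric_semigroup (mu a b) p.
Hypothesis hQ : forall i j, t^-1 * (p t i j - p 0 i j) @[t --> 0^'+] --> Qmatrix a b i j.
Implicit Types (f g h : nat -> R) (s t : R) (i j k n N : nat).
Local Notation m := (mu a b).
Local Notation c := (c a b).
Local Notation T := (semigroup_op p).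
Local Notation L1 f := (abs_summable (fun k => m k * f k)).
Local Notation En := (approx_form m p).
Local Notation kill := (killing m p).
Local Notation energy := (edge_energy a b).

Let m_ge0 := m_ge0 H.
Let e_ge0 := energy_ge0 ha hb.
Let cC := c_leC ha hb hC.

Lemma killingD s f g : 0 <= s -> L1 f -> L1 g ->
  kill s (fun k => f k + g k) = kill s f + kill s g.
Proof.
move=> s0 Lf Lg; rewrite /killing -mulrDr -rsumD; [|exact: (killing_summable H)..].
by congr (_ * _); apply: eq_rsum => k; rewrite mulrDr.
Qed.

Lemma killingZ s r f : 0 <= s -> L1 f ->
  kill s (fun k => r * f k) = r * kill s f.
Proof.
move=> s0 Lf; rewrite /killing [in RHS]mulrCA -[in RHS]rsumZ; last exact: (killing_summable H).
by congr (_ * _); apply: eq_rsum => k; rewrite mulrCA.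
Qed.

Lemma killing_mono s f g : 0 <= s -> L1 f -> L1 g -> (forall k, f k <= g k) ->
  kill s f <= kill s g.
Proof.
move=> s0 Lf Lg fg; rewrite /killing ler_wpM2l ?invr_ge0//.
apply: ler_rsum; [exact: (killing_summable H)..|] => k.
by rewrite ler_wpM2l// mulr_ge0//; have /andP[] := op1_compl H k s0.
Qed.

Lemma killing_norm s f : 0 <= s -> L1 f -> `|kill s f| <= kill s (fun k => `|f k|).
Proof.
move=> s0 Lf; have Lnf := L1_norm H Lf.
rewrite ler_norml; apply/andP; split; last first.
  by apply: killing_mono => // k; exact: ler_norm.
rewrite lerNl -mulN1r -killingZ//; apply: killing_mono => //.
  by have := abs_summableZ (-1) Lf; under eq_fun do rewrite mulrCA.
by move=> k; rewrite mulN1r -normrN ler_norm.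
Qed.

Lemma killing1_le s t : 0 < t -> t <= s ->
  kill s (fun=> 1) <= (1 + t / s) * kill t (fun=> 1).
Proof. by move=> t0 ts; exact: (approx_form_le H t0 ts (cst_L2 H 1)). Qed.

Lemma killing1_ge0 s : 0 <= s -> 0 <= kill s (fun=> 1).
Proof. by move=> s0; apply: (killing_ge0 H s0) => //; exact: (L1_cst H). Qed.

(** The bound at every s accompanies the limit because it controls the killing of small functions
    uniformly in time. *)
Definition killing_limit kappa :=
  (kill t (fun=> 1) @[t --> 0^'+] --> kappa) /\
  forall s, 0 < s -> kill s (fun=> 1) <= kappa.

(** For t <= s the mass at s is at most 1 + t/s times the mass at t. If the masses are bounded, they
    therefore tend to their supremum; if not, one large value forces all earlier masses to be at
    least half as large. *)
Lemma killing_dichotomy :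
  (exists2 kappa, 0 <= kappa & killing_limit kappa) \/
  (forall K, \forall s \near 0^'+, K <= kill s (fun=> 1)).
Proof.
have [[K hK]|nb] := pselect (exists K, forall s, 0 < s -> kill s (fun=> 1) <= K).
  left; pose S := [set kill s (fun=> 1) | s in [set s | 0 < s]].
  have S1 : S (kill 1 (fun=> 1)) by exists 1 => //=.
  have supS : has_sup S.
    by split; [exists (kill 1 (fun=> 1))|exists K => _ [s /= s0 <-]; exact: hK].
  have le_sup s : 0 < s -> kill s (fun=> 1) <= sup S.
    by move=> s0; apply: ub_le_sup; [exact: supS.2|exists s].
  have k0 : 0 <= sup S by apply: le_trans (le_sup 1 _) => //; exact: killing1_ge0.
  exists (sup S) => //; split => //.
  apply/cvgrPdist_lt => e e0; have e20 : 0 < e / 2 by rewrite divr_gt0.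
  have [_ [s /= s0 <-] hs] := sup_adherent e20 supS.
  near=> t; have t0 : 0 < t by near: t; exact: near0_gt0.
  have ts : t <= s by near: t; exact: nbhs_right_le.
  (* Makes the error (t/s) times the mass at t at most e/2; the + 1 keeps the denominator
     positive. *)
  have small : t < s * (e / 2) / (sup S + 1).
    near: t; apply: nbhs_right_lt; rewrite divr_gt0// ?mulr_gt0//.
    by rewrite ltr_wpDl.
  rewrite ltr_pdivlMr ?ltr_wpDl// in small.
  have := killing1_le t0 ts; have := le_sup t t0; have := killing1_ge0 (ltW t0).
  move: hs; set x := kill t _; set y := kill s _ => hs x0 xS yx.
  have tx : t / s * x <= e / 2.
    rewrite mulrAC ler_pdivrMr// [leRHS]mulrC; apply: le_trans (ltW small).
    by rewrite ler_wpM2l ?ltW// (le_lt_trans xS)// ltrDl.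
  by rewrite ger0_norm ?subr_ge0//; move: hs yx tx; rewrite mulrDl mul1r; lra.
right => K.
have [s s0 sK] : exists2 s, 0 < s & 2 * K < kill s (fun=> 1).
  apply: contrapT => hn; apply: nb; exists (2 * K) => s s0.
  by rewrite leNgt; apply/negP => ?; apply: hn; exists s.
near=> t; have t0 : 0 < t by near: t; exact: near0_gt0.
have ts : t <= s by near: t; exact: nbhs_right_le.
have := killing1_le t0 ts; have := killing1_ge0 (ltW t0).
have : t / s <= 1 by rewrite ler_pdivrMr// mul1r.
move: (t / s) (kill t _) => x y; nra.
Unshelve. all: by end_near. Qed.

(** If l were nonzero, h^2 would be at least l^2/2 off a finite set, where the killing mass blows
    up, whereas the killing of h^2 is at most E_s(h, h) <= K. *)
Lemma killing_infinite_vanish h (r K l : R) :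
  (forall K', \forall s \near 0^'+, K' <= kill s (fun=> 1)) ->
  0 < r -> L2 m h -> h n @[n --> \oo] --> l ->
  (forall n, En (r / n.+1%:R) h h <= K) -> l = 0.
Proof.
move=> hinf r0 Lh hl hK; apply/eqP; apply: contraT => l0.
have l2 : 0 < l ^+ 2 by rewrite exprn_even_gt0.
have [N _ hN] : \forall k \near \oo, l ^+ 2 / 2 <= h k ^+ 2.
  have : h k ^+ 2 @[k --> \oo] --> l ^+ 2 by apply: cvgM.
  move/cvgrPdist_lt => /(_ (l ^+ 2 / 2) (divr_gt0 l2 _))-/(_ (ltr0n _ 2)).
  by apply: filterS => k; rewrite ltr_norml => /andP[_]; lra.
pose z i : R := if (i < N)%N then 1 else 0.
have near_z : \forall s \near 0^'+, kill s z <= 1.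
  have /cvgrPdist_le/(_ 1 ltr01) := killing_local ha0 H hQ N (fun=> 1).
  by apply: filterS => s; rewrite sub0r normrN => /(le_trans (ler_norm _)).
(* Solves l^2/2 (K' - 1) = K + 1; the 1 taken off K' bounds the killing on the finite set. *)
pose K' := 2 / l ^+ 2 * (K + 1) + 1.
have [n [[nz nK]]] := near0_sequence r0 (filterI near_z (hinf K')).
set s := r / n.+1%:R in nz nK.
have s0 : 0 <= s by rewrite divr_ge0// ltW.
have Lz : L1 z.
  by apply: (bounded_L1 H (M := 1)) => k; rewrite /z; case: ifP; rewrite ?normr1 ?normr0.
have L1c := L1_cst H.
have low : l ^+ 2 / 2 * (kill s (fun=> 1) - kill s z) <= kill s (fun k => h k ^+ 2).
  have -> : l ^+ 2 / 2 * (kill s (fun=> 1) - kill s z) =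
      kill s (fun k => l ^+ 2 / 2 * (1 + (-1) * z k)).
    have Lz1 : L1 (fun k => -1 * z k).
      by have := abs_summableZ (-1) Lz; under eq_fun do rewrite mulrCA.
    rewrite killingZ//; last first.
      by have := abs_summableD (L1c 1) Lz1; under eq_fun do rewrite -mulrDr.
    by rewrite killingD// killingZ// mulN1r.
  apply: killing_mono => //.
  - apply: (bounded_L1 H (M := `|l ^+ 2 / 2|)) => k.
    by rewrite /z; case: ifP => _; rewrite ?mulr1 ?mulr0 ?subrr ?addr0 ?mulr1 ?mulr0 ?normr0.
  - exact: (L2_sqr_L1 H).
  move=> k; rewrite /z; case: ifPn => kN; first by rewrite mulr1 subrr mulr0 sqr_ge0.
  by rewrite mulr0 addr0 mulr1; apply: hN; rewrite /= leqNgt.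
have up : kill s (fun k => h k ^+ 2) <= K.
  apply: le_trans (hK n); have := approx_form_lower H 0 s0 Lh.
  by rewrite big_nil addr0.
have : l ^+ 2 / 2 * (K' - 1) <= K.
  have l20 : 0 <= l ^+ 2 / 2 by rewrite divr_ge0// ltW.
  by apply: le_trans (le_trans low up); rewrite (ler_wpM2l l20)//; move: nz nK; lra.
have -> : l ^+ 2 / 2 * (K' - 1) = K + 1 by rewrite /K'; field.
by lra.
Qed.

Lemma cvgn_bounded g : cvgn g -> exists M, forall k, `|g k| <= M.
Proof. by move=> /cvg_has_ub [M hM]; exists M => k; apply: hM; exists k. Qed.

Section FiniteKilling.
Context {kappa : R}.
Hypothesis kappa0 : 0 <= kappa.
Hypothesis hk : killing_limit kappa.

(** Finitely many states contribute nothing in the limit; on the others g is small and the total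
    killing is at most kappa. *)
Lemma killing_cvg0 g : g n @[n --> \oo] --> (0 : R) ->
  kill t g @[t --> 0^'+] --> (0 : R).
Proof.
move=> g0; have [M gM] : exists M, forall k, `|g k| <= M.
  by apply: cvgn_bounded; apply/cvg_ex; exists 0.
apply/cvgrPdist_lt => e e0.
pose e' := e / (2 * (kappa + 1)).
have e'0 : 0 < e' by rewrite divr_gt0// mulr_gt0// ltr_wpDl.
have [N _ gN] : \forall k \near \oo, `|g k| <= e'.
  move/cvgrPdist_le/(_ _ e'0) : g0.
  by apply: filterS => k; rewrite sub0r normrN.
pose z i := if (i < N)%N then `|g i| else 0.
have z0 : z k @[k --> \oo] --> (0 : R).
  apply: cvg_near_cst; near=> k; rewrite /z ltnNge.
  by have -> : (N <= k)%N by near: k; exact: nbhs_infty_ge.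
have e20 : 0 < e / 2 by rewrite divr_gt0.
have /cvgrPdist_lt/(_ _ e20) near_z := killing_local ha0 H hQ N (fun k => `|g k|).
have Lg := bounded_L1 H gM.
have Lz : L1 z.
  by apply: (bounded_L1 H (M := M)) => k; rewrite /z; case: ifP;
    rewrite ?normr_id ?normr0// (le_trans _ (gM 0%N)).
near=> t; have t0 : 0 < t by near: t; exact: near0_gt0.
have t0' := ltW t0.
rewrite sub0r normrN; apply: le_lt_trans (killing_norm t0' Lg) _.
have Le' : L1 (fun=> e' * 1) by exact: (L1_cst H).
have Lze : L1 (fun k => z k + e' * 1).
  by have := abs_summableD Lz Le'; under eq_fun do rewrite -mulrDr.
apply: (@le_lt_trans _ _ (kill t (fun k => z k + e' * 1))).
  apply: killing_mono => //; first exact: (L1_norm H).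
  move=> k; rewrite /z mulr1; case: ifPn => kN; first by rewrite lerDl ltW.
  by rewrite add0r; apply: gN; rewrite /= leqNgt.
rewrite killingD// killingZ//; last exact: (L1_cst H).
have k1 : kill t z < e / 2.
  apply: le_lt_trans (ler_norm _) _; rewrite -normrN -sub0r.
  by near: t; exact: near_z.
have k2 : e' * kill t (fun=> 1) <= e / 2.
  apply: (@le_trans _ _ (e' * (kappa + 1))).
    by rewrite ler_wpM2l ?ltW// (le_lt_trans (hk.2 _ t0))// ltrDl.
  by rewrite /e' le_eqVlt; apply/orP; left; apply/eqP; field; rewrite gt_eqF// ltr_wpDl.
lra.
Unshelve. all: by end_near. Qed.

Lemma killing_cvg g (l : R) : g n @[n --> \oo] --> l ->
  kill t g @[t --> 0^'+] --> l * kappa.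
Proof.
move=> gl; have g0 : g n - l @[n --> \oo] --> (0 : R).
  by rewrite -(subrr l); apply: cvgB => //; exact: cvg_cst.
have [M gM] : exists M, forall k, `|g k - l| <= M.
  by apply: cvgn_bounded; apply/cvg_ex; exists 0.
rewrite -[X in _ --> X]addr0.
have : l * kill t (fun=> 1) + kill t (fun k => g k - l) @[t --> 0^'+] --> l * kappa + 0.
  apply: cvgD; last exact: killing_cvg0.
  by apply: cvgM; [exact: cvg_cst|exact: hk.1].
apply: cvg_trans; apply: near_eq_cvg; near=> t.
have t0 : 0 <= t by near: t; exact: near0_ge0.
rewrite -killingZ//; last exact: (L1_cst H).
rewrite -killingD//; [|exact: (L1_cst H)|exact: (bounded_L1 H gM)].
by congr (kill t _); apply/funext => k; ring.
Unshelve. all: by end_near. Qed.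

(** A squeeze. Above: with g = f - l, E_t(f, f) equals l^2 kill(1) + 2 l kill(g) + E_t(g, g), and
    E_t(g, g) is at most the energy of f. Below: partial energies plus kill(f^2), which tends to l^2
    kappa. *)
Lemma approx_form_cvg_diag f : domG a b f ->
  En t f f @[t --> 0^'+] --> rsum (energy f) + kappa * limn f ^+ 2.
Proof.
move=> /(domGP ha hb)[Lf sf]; have cf := energy_cvg ha hb cC sf.
set l := limn f in cf *.
pose g k := f k - l.
have g0 : g n @[n --> \oo] --> (0 : R).
  by rewrite -(subrr l); apply: cvgB => //; exact: cvg_cst.
have Lg : L2 m g by apply: (L2B H) => //; exact: (cst_L2 H).
have Eg : energy g = energy f.
  by apply/funext => k; rewrite /edge_energy /g; congr (_ * _ ^+ 2); ring.
have decomp t : 0 <= t -> En t f f =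
    l ^+ 2 * kill t (fun=> 1) + 2 * l * kill t g + En t g g.
  move=> t0; have fE : f = (fun k => l * 1 + g k).
    by apply/funext => k; rewrite /g; ring.
  have Ll : L2 m (fun=> l * 1) by exact: (cst_L2 H).
  have L1' : L2 m (fun=> 1) by exact: (cst_L2 H).
  rewrite {1}fE (approx_formDl H)// (approx_formZl H)//.
  rewrite (approx_formC H t0 Lg Lf) [in En t f g]fE (approx_formDl H)// (approx_formZl H)//.
  rewrite -[En t (fun=> 1) f]/(kill t f) -[En t (fun=> 1) g]/(kill t g).
  rewrite {1}fE killingD//; [|exact: (L1_cst H)|exact: (L2_L1 H)].
  rewrite killingZ//; last exact: (L1_cst H).
  ring.
have up : l ^+ 2 * kill t (fun=> 1) + 2 * l * kill t g + rsum (energy f) @[t --> 0^'+] -->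
    l ^+ 2 * kappa + 2 * l * 0 + rsum (energy f).
  apply: cvgD; last exact: cvg_cst.
  apply: cvgD; apply: cvgM; [exact: cvg_cst|exact: hk.1|exact: cvg_cst|exact: killing_cvg0].
have f2 : f n ^+ 2 @[n --> \oo] --> l ^+ 2 by apply: cvgM.
have low := killing_cvg f2.
have UE : rsum (energy f) + kappa * l ^+ 2 = l ^+ 2 * kappa + 2 * l * 0 + rsum (energy f) by ring.
apply/cvgrPdist_lt => e e0; have e30 : 0 < e / 3 by rewrite divr_gt0.
have [N hN] : exists N, rsum (energy f) - e / 3 < \sum_(0 <= k < N) energy f k.
  have /cvgrPdist_lt/(_ _ e30) [N _ /(_ N (leqnn N))] /= := abs_summable_cvg sf.
  by rewrite /series/= ltr_norml => /andP[_ ?]; exists N; lra.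
near=> t; have t0 : 0 < t by near: t; exact: near0_gt0.
have t0' := ltW t0.
have A1 : \sum_(0 <= k < N) energy f k - e / 3 + kill t (fun k => f k ^+ 2) <= En t f f.
  by near: t; exact: (approx_energy_near H hQ N e30 Lf).
have A2 : `|l ^+ 2 * kappa - kill t (fun k => f k ^+ 2)| < e / 3.
  by near: t; move/cvgrPdist_lt : low; apply.
have A3 : `|l ^+ 2 * kappa + 2 * l * 0 + rsum (energy f) -
   (l ^+ 2 * kill t (fun=> 1) + 2 * l * kill t g + rsum (energy f))| < e / 3.
  by near: t; move/cvgrPdist_lt : up; apply.
have A4 : En t g g <= rsum (energy f).
  by rewrite -Eg; apply: (approx_form_vanishing_le ha0 ha hb H hQ) => //; rewrite Eg.
have D := decomp t t0'.
move: A2 A3; rewrite -UE !ltr_norml => /andP[A2 A2'] /andP[A3 A3'].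
apply/andP; split; lra.
Unshelve. all: by end_near. Qed.

Lemma domGD f g : domG a b f -> domG a b g -> domG a b (fun k => f k + g k).
Proof.
move=> /(domGP ha hb)[Lf sf] /(domGP ha hb)[Lg sg]; apply/(domGP ha hb).
split; first exact: (L2D H).
apply: le_abs_summable (abs_summableD (abs_summableZ 2 sf) (abs_summableZ 2 sg)) _ => k.
rewrite ger0_norm// /edge_energy.
have w0 := ltW (cond_gt0 ha hb k).
rewrite (_ : 2 * _ + 2 * _ = m k * b k *
  (2 * (f k.+1 - f k) ^+ 2 + 2 * (g k.+1 - g k) ^+ 2)); last by ring.
rewrite ler_wpM2l//; have := sqr_ge0 ((f k.+1 - f k) - (g k.+1 - g k)); nra.
Qed.

Lemma domGZ r f : domG a b f -> domG a b (fun k => r * f k).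
Proof.
move=> /(domGP ha hb)[Lf sf]; apply/(domGP ha hb).
split; first exact: (L2Z H).
have := abs_summableZ (r ^+ 2) sf.
by rewrite (_ : (fun k => _) = energy (fun k => r * f k))//; apply/funext => k; rewrite /edge_energy; ring.
Qed.

(** Polarization of the diagonal case, on both sides. *)
Lemma approx_form_cvg f g : domG a b f -> domG a b g ->
  En t f g @[t --> 0^'+] --> formK a b kappa f g.
Proof.
move=> df dg.
have ds := domGD df dg; have dd := domGD df (domGZ (-1) dg).
have [Lf sf] := (domGP ha hb f).1 df; have [Lg sg] := (domGP ha hb g).1 dg.
have [_ ss] := (domGP ha hb _).1 ds; have [_ sd] := (domGP ha hb _).1 dd.
have cf := energy_cvg ha hb cC sf; have cg := energy_cvg ha hb cC sg.
have ls : limn (fun k => f k + g k) = limn f + limn g by exact: limD.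
have ld : limn (fun k => f k + -1 * g k) = limn f + -1 * limn g.
  apply/cvg_lim => //; apply: cvgD => //; apply: cvgM => //; exact: cvg_cst.
have := approx_form_cvg_diag dd; have := approx_form_cvg_diag ds.
rewrite ls ld => cs cd.
have cpol : 4^-1 * (En t (fun k => f k + g k) (fun k => f k + g k) -
    En t (fun k => f k + -1 * g k) (fun k => f k + -1 * g k)) @[t --> 0^'+] -->
    4^-1 * (rsum (energy (fun k => f k + g k)) + kappa * (limn f + limn g) ^+ 2 -
    (rsum (energy (fun k => f k + -1 * g k)) + kappa * (limn f + -1 * limn g) ^+ 2)).
  by apply: cvgM; [exact: cvg_cst|exact: cvgB].
have [sfg AE] := formAE ha hb sf sg.
have -> : formK a b kappa f g = 4^-1 * (rsum (energy (fun k => f k + g k)) +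
    kappa * (limn f + limn g) ^+ 2 -
    (rsum (energy (fun k => f k + -1 * g k)) + kappa * (limn f + -1 * limn g) ^+ 2)).
  have : rsum (energy (fun k => f k + g k)) - rsum (energy (fun k => f k + -1 * g k)) =
      4 * formA a b f g.
    rewrite AE -rsumZ// -rsumB//; apply: eq_rsum => k; rewrite /edge_energy; ring.
  by move=> /(canRL (subrK _)) ->; rewrite /formK; field.
apply: cvg_trans cpol; apply: near_eq_cvg; near=> t.
have t0 : 0 <= t by near: t; exact: near0_ge0.
have Lmg := L2Z H (-1) Lg.
have Ls := L2D H Lf Lg; have Ld := L2D H Lf Lmg.
rewrite /= !(approx_formDl H t0 _ _ Ls)// !(approx_formDl H t0 _ _ Ld)//.
rewrite (approx_formZl H)//.
rewrite (approx_formC H t0 Lf Ls) (approx_formC H t0 Lg Ls).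
rewrite (approx_formC H t0 Lf Ld) (approx_formC H t0 Lg Ld).
rewrite !(approx_formDl H)// !(approx_formZl H)//.
rewrite (approx_formC H t0 Lg Lf); field.
Unshelve. all: by end_near. Qed.

Lemma approx_form_domain f : domG a b f <-> L2 m f /\ cvg (En t f f @[t --> 0^'+]).
Proof.
split=> [df|[Lf /cvg_ex[l cl]]].
  split; first by case/(domGP ha hb) : df.
  by apply/cvg_ex; eexists; exact: approx_form_cvg_diag.
apply/(domGP ha hb); split => //.
have fl n : En (1 / n.+1%:R) f f <= l.
  by apply: (approx_form_le_lim H _ Lf cl); rewrite divr_gt0.
by have [] := energy_le_of_approx ha hb H hQ ltr01 Lf fl.
Qed.

(** Unlike the bound of [op_energy], this one stays finite as t -> 0. *)
Lemma op_energy_domG t f : 0 < t -> domG a b f ->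
  rsum (energy (T t f)) <= rsum (energy f) + kappa * limn f ^+ 2.
Proof.
move=> t0 df; have [Lf _] := (domGP ha hb f).1 df.
have fl s (s0 : 0 < s) := approx_form_le_lim H s0 Lf (approx_form_cvg_diag df).
by have [] := op_energy_le ha hb H hQ t0 Lf fl.
Qed.

End FiniteKilling.

End FormLimit.

(** * Comparison of Q-processes *)

Section StandardSemigroups.
Context {R : realType}.
Implicit Types (p : R -> nat -> nat -> R) (a b : nat -> R).

Lemma sg_row_summable p t i : standard_semigroup p -> 0 <= t -> abs_summable (p t i).
Proof.
move=> P t0; apply: (@nneg_abs_summable _ _ 1) => [k|n]; first exact: (sg_ge0 P).
exact: (sg_row_le1 P).
Qed.

Lemma sg_le1 p t i j : standard_semigroup p -> 0 <= t -> p t i j <= 1.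
Proof.
move=> P t0; apply: le_trans (sg_row_le1 P i j.+1 t0); rewrite big_nat_recr//= lerDr.
by apply: sumr_ge0 => k _; exact: (sg_ge0 P).
Qed.

Lemma Q_process_standard a b p : Q_process a b p -> standard_semigroup p.
Proof.
move=> [[p_ge0 p_row p_add] p_std _].
have row t i n : 0 <= t -> \sum_(0 <= j < n) p t i j <= 1.
  move=> t0; rewrite -lee_fin; apply: (nneseries_partial_le n (p_ge0 t i ^~ t0)).
  rewrite nneseries_esumT; first exact: p_row.
  by move=> k; rewrite lee_fin p_ge0.
have row_sum t i : 0 <= t -> abs_summable (p t i).
  by move=> t0; apply: (nneg_abs_summable (p_ge0 t i ^~ t0)) => n; exact: row.
have le1 t i j : 0 <= t -> p t i j <= 1.
  move=> t0; apply: le_trans (row t i j.+1 t0); rewrite big_nat_recr//= lerDr.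
  by apply: sumr_ge0 => k _; exact: p_ge0.
have add s t i j : 0 <= s -> 0 <= t ->
    p (s + t) i j = rsum (fun k => p s i k * p t k j).
  move=> s0 t0; apply: EFin_inj; rewrite p_add// esum_nat_rsum//.
    by move=> k; rewrite mulr_ge0// p_ge0.
  apply: le_abs_summable (row_sum s i s0) _ => k.
  by rewrite ger0_norm ?mulr_ge0 ?p_ge0// ler_piMr ?p_ge0// le1.
split => // i j.
(* Let t -> 0 in p_t = p_0 p_t: standardness sends the right side to p_0 and the left side to the
   identity, so p_0 is the identity. *)
have c1 : p t i j @[t --> 0^'+] --> p 0 i j.
  have : rsum (fun k => p 0 i k * p t k j) @[t --> 0^'+] -->
      rsum (fun k => p 0 i k * (k == j)%:R).
    apply: (tannery (row_sum 0 i (lexx 0))).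
      near=> t; move=> k; have t0 : 0 <= t by near: t; exact: near0_ge0.
      by rewrite ger0_norm ?mulr_ge0 ?p_ge0// ler_piMr ?p_ge0// le1.
    by move=> k; apply: cvgM; [exact: cvg_cst|exact: p_std].
  have -> : rsum (fun k => p 0 i k * (k == j)%:R) = p 0 i j.
    rewrite (@rsum_finite _ _ j.+1).
      rewrite big_nat_recr//= eqxx mulr1 big_nat big1 ?add0r// => k /andP[_ kj].
      by rewrite ltn_eqF// mulr0.
    by move=> k jk; rewrite gtn_eqF// mulr0.
  apply: cvg_trans; apply: near_eq_cvg; near=> t.
  by rewrite -[in RHS](add0r t) add//; near: t; exact: near0_ge0.
by rewrite -(cvg_lim _ c1)// (cvg_lim _ (p_std i j)).
Unshelve. all: by end_near. Qed.

Lemma sg_mul_dom p s t i j k : standard_semigroup p -> 0 <= s -> 0 <= t ->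
  `|p s i k * p t k j| <= p s i k.
Proof.
move=> P s0 t0; have ps := sg_ge0 P i k s0; have pt := sg_ge0 P k j t0.
by rewrite ger0_norm ?mulr_ge0//; apply: ler_piMr => //; exact: sg_le1.
Qed.

(* An Euler scheme for p' - p on {0, .., N + 1}: one step of length h costs an
   error o(h), as p and p' have the same rates and the rows of p up to N only
   leak o(h) out of {0, .., N + 1}; at N + 1 the difference is at least - e. *)
Lemma euler_comparison a b p p' j N (t e : R) :
  standard_semigroup p -> standard_semigroup p' ->
  (forall i k, s^-1 * (p s i k - p 0 i k) @[s --> 0^'+] --> Qmatrix a b i k) ->
  (forall i k, s^-1 * (p' s i k - p' 0 i k) @[s --> 0^'+] --> Qmatrix a b i k) ->
  (forall i, s^-1 * (1 - \sum_(0 <= k < i.+2) p s i k) @[s --> 0^'+] --> (0 : R)) ->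
  0 < t -> 0 <= e -> (forall s, 0 <= s -> s <= t -> p s N.+1 j <= e) ->
  forall i, (i <= N)%N -> p t i j - e <= p' t i j.
Proof.
move=> P P' rp rp' esc t0 e0 pe i iN.
have p_ge0 := sg_ge0 P; have p'_ge0 := sg_ge0 P'.
(* The error of one step from i: the distance of the two rows on {0, ..., i + 1}, plus the mass that
   p does not put there. *)
pose D h i := \sum_(0 <= k < i.+2) `|p' h i k - p h i k| +
  (1 - \sum_(0 <= k < i.+2) p h i k).
have D0 h k : 0 <= h -> 0 <= D h k.
  move=> h0; rewrite addr_ge0 ?sumr_ge0// subr_ge0; exact: (sg_row_le1 P).
pose DD h := \sum_(0 <= i < N.+1) D h i.
have DD_cvg : h^-1 * DD h @[h --> 0^'+] --> (0 : R).
  have : \sum_(0 <= i < N.+1) (\sum_(0 <= k < i.+2) `|h^-1 * (p' h i k - p' 0 i k)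
      - h^-1 * (p h i k - p 0 i k)| + h^-1 * (1 - \sum_(0 <= k < i.+2) p h i k))
      @[h --> 0^'+] -->
      \sum_(0 <= i < N.+1) (\sum_(0 <= k < i.+2) `|Qmatrix a b i k - Qmatrix a b i k| + 0).
    apply: cvg_sum_nat => l; apply: cvgD; last exact: esc.
    by apply: cvg_sum_nat => k; apply: cvg_norm; apply: cvgB.
  rewrite [X in _ --> X]big1; last first.
    by move=> l _; rewrite addr0 big1// => k _; rewrite subrr normr0.
  apply: cvg_trans; apply: near_eq_cvg; near=> h.
  have h0 : 0 < h by near: h; exact: near0_gt0.
  rewrite /DD mulr_sumr; apply: eq_bigr => l _; rewrite /D [in RHS]mulrDr; congr (_ + _).
  rewrite [in RHS]mulr_sumr; apply: eq_bigr => k _.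
  rewrite -mulrBr normrM ger0_norm ?invr_ge0 ?ltW//; congr (_ * `|_|).
  by rewrite !(sg_id P, sg_id P'); ring.
have step h s (M : R) l : 0 <= h -> 0 <= s -> 0 <= M -> (l <= N)%N ->
    (forall k, (k <= N.+1)%N -> - M <= p' s k j - p s k j) ->
    - (M + DD h) <= p' (h + s) l j - p (h + s) l j.
  move=> h0 s0 M0 lN IH.
  have lower : \sum_(0 <= k < l.+2) p' h l k * p' s k j <= p' (h + s) l j.
    rewrite (sg_add P')//; apply: partial_le_rsum.
      by apply: le_abs_summable (sg_row_summable l P' h0) _ => k; exact: sg_mul_dom.
    by move=> k; rewrite mulr_ge0// ?p'_ge0.
  have upper : p (h + s) l j <= \sum_(0 <= k < l.+2) p h l k * p s k j +
      (1 - \sum_(0 <= k < l.+2) p h l k).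
    have S : abs_summable (fun k => p h l k * p s k j).
      by apply: le_abs_summable (sg_row_summable l P h0) _ => k; exact: sg_mul_dom.
    rewrite (sg_add P)// (rsum_split l.+2 S) lerD2l.
    have Sr := sg_row_summable l P h0.
    have R1 : rsum (p h l) <= 1 by apply: rsum_le_bound => // n; exact: (sg_row_le1 P).
    rewrite lerBrDl; apply: le_trans R1; rewrite [leRHS](rsum_split l.+2 Sr) lerD2l.
    apply: ler_rsum; [exact: abs_summable_tail..|] => k; case: ifP => // _.
    by rewrite ler_piMr ?p_ge0// (sg_le1 _ _ P).
  have mid : - M - \sum_(0 <= k < l.+2) `|p' h l k - p h l k| <=
      \sum_(0 <= k < l.+2) p' h l k * p' s k j - \sum_(0 <= k < l.+2) p h l k * p s k j.
    rewrite -sumrB.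
    apply: (@le_trans _ _ (\sum_(0 <= k < l.+2) (p h l k * - M - `|p' h l k - p h l k|))).
      rewrite sumrB lerD2r -mulr_suml mulrN lerN2 ler_piMl//; exact: (sg_row_le1 P).
    rewrite !big_nat; apply: ler_sum => k /andP[_ kl].
    have kN : (k <= N.+1)%N by lia.
    have h1 : p h l k * - M <= p h l k * (p' s k j - p s k j).
      by rewrite ler_wpM2l ?p_ge0// IH.
    have h2 : - `|p' h l k - p h l k| <= (p' h l k - p h l k) * p' s k j.
      rewrite lerNl -mulNr; apply: le_trans (ler_norm _) _.
      by rewrite normrM normrN (ger0_norm (p'_ge0 _ _ _ s0)) ler_piMr// (sg_le1 _ _ P').
    by move: h1 h2; lra.
  have DDl : D h l <= DD h.
    have lm : l \in index_iota 0 N.+1 by rewrite mem_index_iota; lia.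
    rewrite /DD (bigD1_seq l lm (iota_uniq _ _))/=.
    by rewrite lerDl sumr_ge0// => k _; exact: D0.
  by move: DDl; rewrite /D; move: mid lower upper; lra.
apply/ler_addgt0Pr => d d0.
have d't : 0 < d / t by rewrite divr_gt0.
(* The n + 1 steps of length t/(n + 1) then cost at most d together. *)
have [n hn] : exists n, (t / n.+1%:R)^-1 * DD (t / n.+1%:R) <= d / t.
  apply: (near0_sequence (P := fun s => s^-1 * DD s <= d / t) t0); move/cvgrPdist_le/(_ _ d't) : DD_cvg.
  by apply: filterS => s; rewrite sub0r normrN; apply: le_trans; exact: ler_norm.
set h := t / n.+1%:R in hn; have h0 : 0 < h by rewrite divr_gt0.
have DDh : DD h <= h * (d / t) by rewrite -ler_pdivrMl// mulrC.
have DD0 : 0 <= DD h by apply: sumr_ge0 => l _; exact/D0/ltW.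
have iter q : (q <= n.+1)%N -> forall k, (k <= N.+1)%N ->
    - (e + q%:R * DD h) <= p' (q%:R * h) k j - p (q%:R * h) k j.
  elim: q => [|q IH] qn k kN.
    by rewrite !mul0r addr0 (sg_id P) (sg_id P') subrr oppr_le0.
  have qh0 : 0 <= q.+1%:R * h by rewrite mulr_ge0// ltW.
  move: kN; rewrite leq_eqVlt => /predU1P[->|kN].
    have qt : q.+1%:R * h <= t.
      by rewrite /h mulrA ler_pdivrMr// mulrC ler_wpM2l ?ler_nat// ltW.
    have := pe _ qh0 qt; have := p'_ge0 (q.+1%:R * h) N.+1 j qh0.
    have : 0 <= q.+1%:R * DD h by rewrite mulr_ge0.
    by lra.
  have -> : q.+1%:R * h = h + q%:R * h by rewrite -natr1; ring.
  have -> : e + q.+1%:R * DD h = e + q%:R * DD h + DD h by rewrite -natr1; ring.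
  apply: step => //; [exact: ltW|by rewrite mulr_ge0// ltW| |].
    by rewrite addr_ge0// mulr_ge0.
  by move=> l lN; apply: IH => //; exact: ltnW.
have := iter n.+1 (leqnn _) i (leqW iN).
have nh : n.+1%:R * h = t by rewrite /h; field.
rewrite nh.
have : n.+1%:R * DD h <= d.
  apply: le_trans (ler_wpM2l _ DDh) _ => //.
  by rewrite mulrA nh mulrCA divff ?gt_eqF// mulr1.
by lra.
Unshelve. all: by end_near. Qed.

End StandardSemigroups.

(** * Infinite killing *)

Section Minimal.
Context {R : realType} {a b : nat -> R} {p : R -> nat -> nat -> R} {C : R}.
Hypothesis ha0 : a 0%N = 0.
Hypothesis ha : forall k, (1 <= k)%N -> 0 < a k.
Hypothesis hb : forall k, 0 < b k.
Hypothesis hC : c a b n @[n --> \oo] --> C.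
Hypothesis H : symmetric_semigroup (mu a b) p.
Hypothesis hp : Q_process a b p.
Local Notation m := (mu a b).
Local Notation T := (semigroup_op p).
Local Notation energy := (edge_energy a b).

Let hQ : forall i j, t^-1 * (p t i j - p 0 i j) @[t --> 0^'+] --> Qmatrix a b i j.
Proof. by case: hp. Qed.
Let cC := c_leC ha hb hC.

Lemma op_indicator (j : nat) t i : T t (fun k => (k == j)%:R) i = p t i j.
Proof.
rewrite /semigroup_op (@rsum_finite _ _ j.+1).
  rewrite big_nat_recr//= eqxx mulr1 big_nat big1 ?add0r// => k /andP[_ kj].
  by rewrite ltn_eqF// mulr0.
by move=> k jk; rewrite gtn_eqF// mulr0.
Qed.

(** Column j of p decays at infinity uniformly in time: T_s applied to the indicator of j has limit
    0 and at most the energy of the indicator, so [oscillation_lim] bounds it near infinity. This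
    supplies the small boundary value e that [euler_comparison] asks for. *)
Lemma infinite_killing_minimal :
  (forall K, \forall s \near 0^'+, K <= killing m p s (fun=> 1)) ->
  minimal_Q_process a b p.
Proof.
move=> hinf; split => // p' hp' t i j t0.
have P' := Q_process_standard hp'.
have [->|t_neq0] := eqVneq t 0; first by rewrite (sg_id (ss_base H)) (sg_id P').
have {t_neq0} t_gt0 : 0 < t by rewrite lt_neqAle eq_sym t_neq0.
pose d k : R := (k == j)%:R.
have d0 k : (j.+1 <= k)%N -> d k = 0 by move=> jk; rewrite /d gtn_eqF.
have Ld : L2 m d by exact: (finite_L2 H d0).
set K := rsum (energy d).
have vanish s k : 0 < s -> p s k j ^+ 2 <= 2 * (C - c a b k) * K.
  move=> s0; have eK r : 0 < r -> approx_form m p r d d <= K.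
    by move=> r0; exact: (approx_form_finite_le ha0 ha H hQ r0 d0).
  have [S E] := op_energy_le ha hb H hQ s0 Ld eK.
  have l0 : limn (T s d) = 0.
    apply: (killing_infinite_vanish ha0 H hQ hinf (r := 2 * s) (h := T s d) (K := K)).
    - by rewrite mulr_gt0.
    - exact: (op_L2 H (ltW s0) Ld).
    - exact: (energy_cvg ha hb cC S).
    - move=> n; have [le _] := approx_form_op H n s0 Ld; apply: le_trans le (eK _ _).
      by rewrite divr_gt0// mulr_gt0.
  have := oscillation_lim ha hb k cC S E.
  by rewrite l0 sub0r sqrrN op_indicator.
apply/ler_addgt0Pr => e e0.
(* [jN] settles time 0, which [vanish] does not cover: the entry (N + 1, j) of the identity is 0. *)
have [N [iN jN hN]] : exists N, [/\ (i <= N)%N, (j <= N)%N & 2 * (C - c a b N.+1) * K <= e ^+ 2].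
  have : 2 * (C - c a b n) * K @[n --> \oo] --> 2 * (C - C) * K.
    apply: cvgM; last exact: cvg_cst.
    by apply: cvgM; [exact: cvg_cst|apply: cvgB => //; exact: cvg_cst].
  rewrite subrr mulr0 mul0r => /cvgrPdist_le/(_ (e ^+ 2) (exprn_gt0 _ e0)) [N _ hN].
  exists (maxn N (maxn i j)); split; [by lia|by lia|].
  have /hN : (N <= (maxn N (maxn i j)).+1)%N by lia.
  by rewrite /= sub0r normrN => /(le_trans (ler_norm _)).
have := euler_comparison (ss_base H) P' hQ (ltac:(by case: hp')) 
  (row_escape_rate ha0 H hQ) t_gt0 (ltW e0).
move=> /(_ j N) cmp; rewrite -lerBlDr; apply: cmp => // s s0 st.
have [->|s_neq0] := eqVneq s 0.
  by rewrite (sg_id (ss_base H)) gtn_eqF ?ltW// ltnS.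
have s_gt0 : 0 < s by rewrite lt_neqAle eq_sym s_neq0.
have := le_trans (vanish s N.+1 s_gt0) hN.
by rewrite ler_pXn2r// nnegrE; [exact: (sg_ge0 (ss_base H))|exact: ltW].
Qed.

End Minimal.

(** * The Feller process on the compactification *)

Lemma compact_nat_bounded (K : set nat) : compact K ->
  exists N, forall k, K k -> (k < N)%N.
Proof.
move=> /compact_near_coveringP/(_ nat \oo (fun n k => (k < n)%N)) [|].
  move=> x _; exists ([set x], [set n | (x.+1 <= n)%N]) => /=.
    by split; [rewrite nbhs_principalE; apply/principal_filterP|exists x.+1].
  by move=> [y n] /= [-> //].
by move=> N _ /(_ N (leqnn N)) KN; exists N.
Qed.

Lemma Ninfty_someE (i k : nat) : ((Some i : Ninfty) == (Some k : Ninfty)) = (i == k).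
Proof. by apply/eqP/eqP => [[]|->]. Qed.

Lemma Ninfty_noneE (k : nat) : ((None : Ninfty) == (Some k : Ninfty)) = false.
Proof. by apply/eqP. Qed.

Lemma Ninfty_someNE (k : nat) : ((Some k : Ninfty) == (None : Ninfty)) = false.
Proof. by apply/eqP. Qed.

Lemma Ninfty_continuousP (R : realType) (g : Ninfty -> R) :
  continuous g <-> g (Some i) @[i --> \oo] --> g None.
Proof.
split=> [cg|cg [i|]].
- move=> A /(cg None)[U [cU _] UA].
  have [N UN] := compact_nat_bounded cU.
  exists N => //= i /= Ni; apply: UA; left; exists i => //= Ui.
  by have := UN _ Ui; rewrite ltnNge Ni.
- move=> A /nbhs_singleton gA; rewrite /nbhs/= /nbhs/= => x /= xi.
  by rewrite xi.
move=> A gA; have [N _ NA] := cg _ gA; exists [set k | (k < N)%N] => /=.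
  split; first exact/finite_compact/finite_II.
  exact: discrete_closed.
by move=> _ [[k /= /negP kN <-]|->]; [apply: NA; rewrite /= leqNgt|exact: nbhs_singleton gA].
Qed.

Section Process.
Context {R : realType} {a b : nat -> R} {p : R -> nat -> nat -> R} {C kappa : R}.
Hypothesis ha0 : a 0%N = 0.
Hypothesis ha : forall k, (1 <= k)%N -> 0 < a k.
Hypothesis hb : forall k, 0 < b k.
Hypothesis hC : c a b n @[n --> \oo] --> C.
Hypothesis H : symmetric_semigroup (mu a b) p.
Hypothesis hQ : forall i j, t^-1 * (p t i j - p 0 i j) @[t --> 0^'+] --> Qmatrix a b i j.
Hypothesis kappa0 : 0 <= kappa.
Hypothesis hk : killing_limit (a := a) (b := b) (p := p) kappa.
Implicit Types (f g h : nat -> R) (s t : R) (i j k n N : nat).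
Local Notation m := (mu a b).
Local Notation c := (c a b).
Local Notation T := (semigroup_op p).
Local Notation dot := (L2dot m).
Local Notation energy := (edge_energy a b).
Local Notation P := (ss_base H).

Let cC := c_leC ha hb hC.

Lemma op_cvgn t f : 0 < t -> L2 m f -> cvgn (T t f).
Proof.
by move=> t0 Lf; apply: (energy_cvg ha hb cC); have [] := op_energy ha hb H hQ t0 Lf.
Qed.

Lemma p_cvgn t j : 0 < t -> cvgn (fun i => p t i j).
Proof.
move=> t0; have Ld : L2 m (fun k => (k == j)%:R).
  by apply: (finite_L2 H (N := j.+1)) => k jk; rewrite gtn_eqF.
by have := op_cvgn t0 Ld; rewrite (_ : T t _ = fun i => p t i j)//;
  apply/funext => i; rewrite op_indicator.
Qed.

(** The entrance law from infinity, possibly of mass less than 1. *)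
Definition entrance t j := limn (fun i => p t i j).

Lemma entrance_ge0 t j : 0 < t -> 0 <= entrance t j.
Proof.
move=> t0; apply: limr_ge; first exact: p_cvgn.
by apply: nearW => i; exact/(sg_ge0 P)/ltW.
Qed.

(** Exchanges the limit at infinity with the sum over j: the L^2 tails of f tend to 0, and
    [op_sup_bound] makes T_t of a tail small at all states at once. *)
Lemma entrance_cvg t f : 0 < t -> L2 m f ->
  series (fun j => entrance t j * f j) @ \oo --> limn (T t f).
Proof.
move=> t0 Lf; set K := 2 + 2 * C / t.
have C0 : 0 <= C by have := cC 0.
have K0 : 0 <= K by rewrite addr_ge0// mulr_ge0 ?invr_ge0 ?mulr_ge0// ltW.
pose h N k := if (k < N)%N then 0 else f k.
pose g N k := if (k < N)%N then f k else 0.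
have Lh N : L2 m (h N).
  by apply: (le_L2 H Lf) => k; rewrite /h; case: ifP; rewrite ?normr0.
have Lg N : L2 m (g N).
  by apply: (le_L2 H Lf) => k; rewrite /g; case: ifP; rewrite ?normr0.
have gE N : series (fun j => entrance t j * f j) N = limn (T t (g N)).
  apply/esym/cvg_lim => //.
  have -> : T t (g N) = (fun i => \sum_(0 <= j < N) p t i j * f j).
    apply/funext => i; rewrite /semigroup_op (@rsum_finite _ _ N).
      by rewrite !big_nat; apply: eq_bigr => k /andP[_ kN]; rewrite /g kN.
    by move=> k; rewrite /g leqNgt => /negbTE ->; rewrite mulr0.
  apply: cvg_sum_nat => j; apply: cvgM; last exact: cvg_cst.
  exact: p_cvgn.
have dE N : limn (T t f) - series (fun j => entrance t j * f j) N = limn (T t (h N)).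
  rewrite gE -limB; [|exact: op_cvgn..].
  congr (limn _); apply/funext => i /=; rewrite -[LHS](opB H)//.
  - by congr (T t _ i); apply/funext => k; rewrite /g /h; case: ifP; rewrite ?subrr ?subr0.
  - exact: ltW.
  - exact: (L2_L1 H).
  - exact: (L2_L1 H).
have hB N : limn (T t (h N)) ^+ 2 <= K * dot (h N) (h N).
  have cl : T t (h N) i ^+ 2 @[i --> \oo] --> limn (T t (h N)) ^+ 2.
    by apply: cvgM; exact: op_cvgn.
  rewrite -(cvg_lim _ cl)//; apply: limr_le; first by apply/cvg_ex; eexists; exact: cl.
  by apply: nearW => i; exact: (op_sup_bound ha hb hC H hQ).
have Kh : K * dot (h N) (h N) @[N --> \oo] --> K * 0.
  by apply: cvgM; [exact: cvg_cst|exact: (dot_tail_cvg0 H Lf)].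
rewrite mulr0 in Kh.
apply/cvgrPdist_lt => e e0.
have /cvgrPdist_lt/(_ (e ^+ 2) (exprn_gt0 _ e0)) := Kh.
apply: filterS => N; rewrite sub0r normrN => /(le_lt_trans (ler_norm _)) Ke.
rewrite dE -(@ltr_pXn2r _ 2)// ?nnegrE ?ltW// real_normK ?num_real//.
exact: le_lt_trans (hB N) Ke.
Qed.

(** A fixed state i far out replaces infinity: f and all T_t f have energy at most M, hence are
    within e/3 of their limits at i, and T_t f(i) tends to f(i). *)
Lemma op_infty_cvg0 f : domG a b f ->
  limn (T t f) @[t --> 0^'+] --> limn f.
Proof.
move=> df; have [Lf sf] := (domGP ha hb f).1 df.
set M := rsum (energy f) + kappa * limn f ^+ 2.
have M1 : rsum (energy f) <= M by rewrite lerDl mulr_ge0// sqr_ge0.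
apply/cvgrPdist_lt => e e0; have e30 : 0 < e / 3 by rewrite divr_gt0.
have [i hi] : exists i, 2 * (C - c i) * M < (e / 3) ^+ 2.
  have : 2 * (C - c n) * M @[n --> \oo] --> 2 * (C - C) * M.
    apply: cvgM; last exact: cvg_cst.
    by apply: cvgM; [exact: cvg_cst|apply: cvgB => //; exact: cvg_cst].
  rewrite subrr mulr0 mul0r => /cvgrPdist_lt/(_ _ (exprn_gt0 2 e30)) [N _ /(_ N (leqnn N))].
  by rewrite /= sub0r normrN => /(le_lt_trans (ler_norm _)); exists N.
have close (x y : R) : (x - y) ^+ 2 <= 2 * (C - c i) * M -> `|x - y| < e / 3.
  move=> xy; rewrite -(@ltr_pXn2r _ 2)// ?nnegrE ?ltW// real_normK ?num_real//.
  exact: le_lt_trans xy hi.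
have f1 := close _ _ (oscillation_lim ha hb i cC sf M1).
have /cvgrPdist_lt/(_ _ e30) near_i := op_cvg0 H (i := i) (L2_L1 H Lf).
near=> t; have t0 : 0 < t by near: t; exact: near0_gt0.
have [S _] := op_energy ha hb H hQ t0 Lf.
have f2 := close _ _ (oscillation_lim ha hb i cC S
  (op_energy_domG ha0 ha hb hC H hQ kappa0 hk t0 df)).
have f3 : `|f i - T t f i| < e / 3 by near: t; exact: near_i.
move: f1 f2 f3; rewrite !ltr_norml => /andP[? ?] /andP[? ?] /andP[? ?].
by apply/andP; split; lra.
Unshelve. all: by end_near. Qed.

Lemma op_contraction_semigroup : L2_contraction_semigroup m T.
Proof.
split.
- by move=> t f t0; exact: (op_L2 H).
- move=> t r f g t0 Lf Lg; apply/funext => k.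
  by rewrite (opD H)// ?(opZ H)//; [exact: (L2_L1 H)|exact/(L2_L1 H)/(L2Z H)|exact: (L2_L1 H)].
- by move=> t f t0; exact: (op_contraction H).
- split=> [f _|s t f s0 t0 Lf]; first by apply/funext => k; exact: (op_id H).
  by apply/funext => k; apply: (op_add H) => //; exact: (L2_L1 H).
- by move=> f Lf; exact: (op_strongly_continuous H).
Qed.

Lemma op_semigroup_of_form : semigroup_of_form m (domG a b) (formK a b kappa) T.
Proof.
split.
- exact: op_contraction_semigroup.
- by move=> t f g t0 Lf Lg; exact: (op_symmetric H).
- by apply/seteqP; split => f /(approx_form_domain ha0 ha hb hC H hQ kappa0 hk).
- by move=> f g df dg; exact: (approx_form_cvg ha0 ha hb hC H hQ kappa0 hk).
Qed.

(** Time 0 is separate because the rows of the identity tend to 0 and not to the unit mass at oo. At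
    other times no mass sits at oo, a point that mu does not charge. *)
Definition extension (t : R) (x y : Ninfty) : R :=
  if t == 0 then (x == y)%:R else
  match y, x with
  | None, _ => 0
  | Some j, Some i => p t i j
  | Some j, None => entrance t j
  end.

Lemma extension_op t (f : Ninfty -> R) (x : Ninfty) : 0 < t -> L2 m (f \o Some) ->
  transition_op extension t f x =
  if x is Some i then T t (f \o Some) i else limn (T t (f \o Some)).
Proof.
move=> t0 Lf; rewrite /transition_op /option_sum /extension gt_eqF// mul0r add0r.
by case: x => [//|]; apply/cvg_lim => //; exact: (entrance_cvg t0 Lf).
Qed.

Lemma extension_op0 (f : Ninfty -> R) x : transition_op extension 0 f x = f x.
Proof.
rewrite /transition_op /option_sum /extension eqxx.
case: x => [i|].
  rewrite Ninfty_someNE mul0r add0r (@rsum_finite _ _ i.+1).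
    rewrite big_nat_recr//= eqxx mul1r big_nat big1 ?add0r// => k /andP[_ ki].
    by rewrite Ninfty_someE gtn_eqF// mul0r.
  by move=> k ik; rewrite Ninfty_someE ltn_eqF// mul0r.
rewrite eqxx mul1r (@rsum_finite _ _ 0) ?big_nil ?addr0// => k _.
by rewrite Ninfty_noneE mul0r.
Qed.

Lemma extension_ge0 t x y : 0 <= t -> 0 <= extension t x y.
Proof.
rewrite le_eqVlt => /predU1P[<-|t0]; first by rewrite /extension eqxx.
rewrite /extension gt_eqF//; case: y => [j|//]; case: x => [i|].
  exact/(sg_ge0 P)/ltW.
exact: entrance_ge0.
Qed.

Lemma esum_Ninfty (g : Ninfty -> R) (l : R) : (forall x, 0 <= g x) ->
  series (fun k => g (Some k)) @ \oo --> l ->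
  (\esum_(x in [set: Ninfty]) (g x)%:E)%E = (g None + l)%:E.
Proof.
move=> g0 gl; have E := @esum_option R (fun x => (g x)%:E) _.
rewrite [LHS]E; last by move=> x; rewrite lee_fin.
rewrite (esum_nat_rsum (u := fun k => g (Some k)))//; first by rewrite (cvg_lim _ gl).
apply: (@nneg_abs_summable _ _ l) => // n.
rewrite -(cvg_lim _ gl)//.
apply: (@nondecreasing_cvgn_le _ (series (fun k => g (Some k)))).
  by apply: nondecreasing_series => k _ _.
by apply/cvg_ex; exists l.
Qed.

Lemma extension_transition_function : transition_function extension.
Proof.
have op1 t x : 0 < t ->
    series (fun j => extension t x (Some j)) @ \oo -->
    (if x is Some i then T t (fun=> 1) i else limn (T t (fun=> 1))).
  move=> t0; case: x => [i|]; rewrite /extension gt_eqF//.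
    under eq_fun do rewrite -[p _ _ _]mulr1.
    by apply/abs_summable_cvg/(op_summable H _ (ltW t0))/(L1_cst H).
  by have := entrance_cvg t0 (cst_L2 H 1); under eq_fun do rewrite mulr1.
(* Summation against the identity matrix, for all the cases in which a time is 0. *)
have E0 (x : Ninfty) (g : Ninfty -> R) : (forall x, 0 <= g x) ->
    (\esum_(z in [set: Ninfty]) ((x == z)%:R * g z)%:E)%E = (g x)%:E.
  move=> g0; rewrite (@esum_Ninfty _ (if x is Some i then g x else 0)).
  - by case: x => [i|]; rewrite ?Ninfty_someNE ?eqxx ?mul0r ?add0r ?mul1r ?addr0.
  - by move=> y; rewrite mulr_ge0.
  case: x => [i|].
    apply: cvg_near_cst; near=> n; have ni : (i < n)%N by near: n; exact: nbhs_infty_gt.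
    rewrite /series/= (@bigD1_seq _ _ _ _ _ i)/=; last 2 first.
    - by rewrite mem_index_iota.
    - exact: iota_uniq.
    rewrite eqxx mul1r big1 ?addr0// => k /negbTE ki.
    by rewrite Ninfty_someE eq_sym ki mul0r.
  apply: cvg_near_cst; near=> n; rewrite /series/= big1// => k _.
  by rewrite mul0r.
split.
- by move=> t x y; exact: extension_ge0.
- move=> t x; rewrite le_eqVlt => /predU1P[<-|t0].
    have := E0 x (fun=> 1) (fun=> ler01).
    rewrite (eq_esum (b := fun y => (extension 0 x y)%:E)); first by move=> ->.
    by move=> y _; rewrite /extension eqxx mulr1.
  rewrite (esum_Ninfty _ (op1 t x t0)); last by move=> y; exact/extension_ge0/ltW.
  rewrite {1}/extension gt_eqF// add0r lee_fin.
  case: x => [i|]; first exact/(op1_le1 H)/ltW.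
  apply: limr_le; first exact/op_cvgn/(cst_L2 H).
  by apply: nearW => i; exact/(op1_le1 H)/ltW.
move=> s t x y; rewrite le_eqVlt => /predU1P[<- t0|s0].
  rewrite add0r -(E0 x (extension t ^~ y)); last by move=> z; exact: extension_ge0.
  by apply: eq_esum => z _; rewrite /extension eqxx.
rewrite le_eqVlt => /predU1P[<-|t0].
  rewrite addr0 -(E0 y (extension s x)); last by move=> z; exact/extension_ge0/ltW.
  by apply: eq_esum => z _; rewrite {2 3}/extension eqxx mulrC [y == z]eq_sym.
have st0 : 0 < s + t by rewrite addr_gt0.
have s0' := ltW s0; have t0' := ltW t0.
case: y => [j|]; last first.
  rewrite {1}/extension gt_eqF// esum1// => z _.
  by rewrite {2}/extension gt_eqF// mulr0.
have Lt : L2 m (fun k => p t k j).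
  apply: (bounded_L2 H (M := 1)) => k.
  by rewrite ger0_norm ?(sg_ge0 P)// (sg_le1 _ _ P).
have opE i : T s (fun k => p t k j) i = p (s + t) i j by rewrite (sg_add P).
rewrite (@esum_Ninfty _ (extension (s + t) x (Some j))).
- by rewrite {2}/extension gt_eqF// mul0r add0r.
- by move=> z; rewrite mulr_ge0// extension_ge0.
rewrite /extension !gt_eqF//; case: x => [i|].
  by rewrite -opE; apply/abs_summable_cvg/(op_summable H _ s0')/(L2_L1 H).
(* From oo, Chapman-Kolmogorov says that the entrance law at time s integrates column j of p_t. *)
rewrite /entrance (_ : (fun i => p (s + t) i j) = T s (fun k => p t k j)); last first.
  by apply/funext.
exact: entrance_cvg.
Unshelve. all: by end_near. Qed.

Lemma extension_continuous t (f : Ninfty -> R) : 0 < t -> L2 m (f \o Some) ->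
  continuous (transition_op extension t f).
Proof.
move=> t0 Lf; apply/Ninfty_continuousP; rewrite extension_op//.
by under eq_fun do rewrite extension_op//; exact: op_cvgn.
Qed.

Lemma extension_feller (f : Ninfty -> R) x : continuous f ->
  transition_op extension t f x @[t --> 0^'+] --> f x.
Proof.
move=> /Ninfty_continuousP cf; set f0 := f \o Some.
have [M fM] : exists M, forall k, `|f0 k| <= M.
  by apply: cvgn_bounded; apply/cvg_ex; exists (f None).
have Lf : L2 m f0 by exact: (bounded_L2 H fM).
case: x => [i|].
  apply: cvg_trans (op_cvg0 H (i := i) (L2_L1 H Lf)); apply: near_eq_cvg; near=> t.
  by rewrite extension_op//; near: t; exact: near0_gt0.
apply/cvgrPdist_lt => e e0; have e30 : 0 < e / 3 by rewrite divr_gt0.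
have [N _ hN] : \forall k \near \oo, `|f0 k - f None| < e / 3.
  by move/cvgrPdist_lt/(_ _ e30) : cf; apply: filterS => k; rewrite distrC.
(* A function constant from N on has finite energy, so [op_infty_cvg0] applies to it. It is
   uniformly within e/3 of f, and T_t does not enlarge this distance. *)
pose g k := if (k < N)%N then f0 k else f None.
have gl : g k @[k --> \oo] --> f None.
  apply: cvg_near_cst; near=> k; rewrite /g ltnNge.
  by have -> : (N <= k)%N by near: k; exact: nbhs_infty_ge.
have dg : domG a b g.
  apply/(domGP ha hb); split.
    have cg : cvgn g by apply/cvg_ex; exists (f None).
    by have [K gK] := cvgn_bounded cg; exact: (bounded_L2 H gK).
  apply: (@abs_summable_finite _ _ N) => k Nk.
  by rewrite /edge_energy /g !ltnNge Nk (leqW Nk)/= subrr expr0n mulr0.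
have [Lg _] := (domGP ha hb g).1 dg.
have fg k : `|f0 k - g k| <= e / 3.
  rewrite /g; case: ifPn => kN; first by rewrite subrr normr0 ltW.
  by apply/ltW/hN; rewrite /= leqNgt.
have /cvgrPdist_lt/(_ _ e30) near_g := op_infty_cvg0 dg.
rewrite (cvg_lim _ gl)// in near_g.
near=> t; have t0 : 0 < t by near: t; exact: near0_gt0.
rewrite extension_op//.
have g1 : `|f None - limn (T t g)| < e / 3 by near: t; exact: near_g.
have g2 : `|limn (T t f0) - limn (T t g)| <= e / 3.
  have cd : T t f0 i - T t g i @[i --> \oo] --> limn (T t f0) - limn (T t g).
    by apply: cvgB; exact: op_cvgn.
  have /cvg_norm cn := cd; rewrite -(cvg_lim _ cn)//.
  apply: limr_le; first by apply/cvg_ex; eexists; exact: cn.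
  apply: nearW => i; have t0' := ltW t0.
  rewrite -(opB H i t0' (L2_L1 H Lf) (L2_L1 H Lg)).
  exact: (op_bounded H i t0' fg).
move: g1 g2; rewrite -/f0 !ltr_norml ler_norml => /andP[? ?] /andP[? ?].
by apply/andP; split; lra.
Unshelve. all: by end_near. Qed.

Lemma extension_process : process_of_form m (domG a b) (formK a b kappa) extension.
Proof.
split; first exact: extension_transition_function.
split; first by move=> x y; rewrite /extension eqxx.
split; last split.
- exists T; first exact: op_semigroup_of_form.
  move=> t f; rewrite le_eqVlt => /predU1P[<-|t0] bf Lf; apply/funext => i /=.
    by rewrite extension_op0 (op_id H).
  by rewrite extension_op.
- by move=> t f t0 _ Lf; exact: extension_continuous.
- by move=> f cf x; exact: extension_feller.
Qed.

End Process.

Arguments extension {R} p t x y.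

(** * Laplace transforms and an Abelian theorem *)

Section Laplace.
Context {R : realType}.
Implicit Types (u v : R -> R) (alpha M l : R).
Local Notation D := (`[0, +oo[%classic : set (measurableTypeR R)).
Local Notation leb := (@lebesgue_measure R).

Definition laplace alpha u :=
  \int[leb]_(t in D) (expR (- alpha * t) * u t).

Definition bounded_signal M u :=
  measurable_fun D (u : measurableTypeR R -> R) /\ forall t, 0 <= t -> `|u t| <= M.

Let mD : measurable D. Proof. by []. Qed.

Lemma expR_integrable alpha : 0 < alpha ->
  leb.-integrable D (fun t => (expR (- alpha * t))%:E).
Proof.
move=> a0; have I := integrable_exponential_pdf a0.
have {}I := integrableS (@measurableT _ (measurableTypeR R)) mD (@subsetT _ _) I.
have := integrableZl mD alpha^-1 I; apply: eq_integrable => // t.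
rewrite inE/= in_itv/= andbT => t0.
by rewrite /= exponential_pdfE// -EFinM mulrA mulVf ?gt_eqF// mul1r.
Qed.

Lemma laplace1 alpha : 0 < alpha -> laplace alpha (fun=> 1) = alpha^-1.
Proof.
move=> a0; rewrite /laplace; under eq_Rintegral do rewrite mulr1.
apply: (mulfI (lt0r_neq0 a0)); rewrite divff ?gt_eqF//.
rewrite -RintegralZl//; last exact: expR_integrable.
rewrite Rintegral_mkcond /Rintegral.
by rewrite -[1 in RHS]/(fine 1%:E) -(integral_exponential_pdf a0).
Qed.

Lemma bounded_signalD M N u v : bounded_signal M u -> bounded_signal N v ->
  bounded_signal (M + N) (fun t => u t + v t).
Proof.
move=> [mu uM] [mv vN]; split; first exact: measurable_funD.
by move=> t t0; apply: le_trans (ler_normD _ _) _; rewrite lerD ?uM ?vN.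
Qed.

Lemma bounded_signal_cst r : bounded_signal `|r| (fun=> r).
Proof. by split => //; exact: measurable_cst. Qed.

Lemma expRM_measurable alpha u : measurable_fun D (u : measurableTypeR R -> R) ->
  measurable_fun D ((fun t => expR (- alpha * t) * u t) : measurableTypeR R -> R).
Proof.
move=> mu; apply: measurable_funM => //.
apply: measurableT_comp; first exact: measurable_expR.
by apply: measurable_funM => //; exact: measurable_cst.
Qed.

Lemma laplace_integrable alpha M u : 0 < alpha -> bounded_signal M u ->
  leb.-integrable D (EFin \o (fun t => expR (- alpha * t) * u t)).
Proof.
move=> a0 [mu uM].
apply: (le_integrable mD _ _ (integrableZl mD M (expR_integrable a0))).
  by apply/measurable_EFinP; exact: expRM_measurable.
move=> t; rewrite /= in_itv/= andbT => t0.
rewrite lee_fin normrM [leRHS]normrM (ger0_norm (expR_ge0 _)) mulrC ler_wpM2r ?expR_ge0//.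
exact: le_trans (uM t t0) (ler_norm _).
Qed.

Lemma laplaceD alpha M N u v : 0 < alpha -> bounded_signal M u -> bounded_signal N v ->
  laplace alpha (fun t => u t + v t) = laplace alpha u + laplace alpha v.
Proof.
move=> a0 bu bv; rewrite /laplace.
rewrite -(RintegralD mD (laplace_integrable a0 bu) (laplace_integrable a0 bv)).
by apply: eq_Rintegral => t _; rewrite mulrDr.
Qed.

Lemma laplaceZ alpha M r u : 0 < alpha -> bounded_signal M u ->
  laplace alpha (fun t => r * u t) = r * laplace alpha u.
Proof.
move=> a0 bu; rewrite /laplace -(RintegralZl r mD (laplace_integrable a0 bu)).
by apply: eq_Rintegral => t _; rewrite mulrCA.
Qed.

Lemma eq_laplace alpha u v : (forall t, 0 <= t -> u t = v t) ->
  laplace alpha u = laplace alpha v.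
Proof.
move=> uv; apply: eq_Rintegral => t; rewrite inE/= in_itv/= andbT => t0.
by rewrite uv.
Qed.

Lemma eq_bounded_signal M u v : (forall t, 0 <= t -> u t = v t) ->
  bounded_signal M u -> bounded_signal M v.
Proof.
move=> uv [mu uM]; split; last by move=> t t0; rewrite -uv ?uM.
apply: (eq_measurable_fun (u : measurableTypeR R -> R)) mu.
by move=> t; rewrite inE/= in_itv/= andbT => t0; rewrite uv.
Qed.

Lemma bounded_signal_lim M (u_ : nat -> R -> R) u :
  (forall n, bounded_signal M (u_ n)) ->
  (forall t, 0 <= t -> u_ n t @[n --> \oo] --> u t) -> bounded_signal M u.
Proof.
move=> bu ul; split.
  apply: (measurable_fun_cvg (h := u_)) => [n|t]; first by case: (bu n).
  by rewrite /= in_itv/= andbT; exact: ul.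
move=> t t0; have /cvg_norm cn := ul t t0; rewrite -(cvg_lim _ cn)//.
apply: limr_le; first by apply/cvg_ex; eexists; exact: cn.
by apply: nearW => n; case: (bu n) => _; exact.
Qed.

Lemma laplace_cvg alpha M (u_ : nat -> R -> R) u : 0 < alpha ->
  (forall n, bounded_signal M (u_ n)) ->
  (forall t, 0 <= t -> u_ n t @[n --> \oo] --> u t) ->
  laplace alpha (u_ n) @[n --> \oo] --> laplace alpha u.
Proof.
move=> a0 bu ul; have bul := bounded_signal_lim bu ul.
have M0 : 0 <= M by apply: le_trans ((bu 0%N).2 0 (lexx 0)).
have [] := @dominated_convergence _ _ _ leb D mD
  (fun n t => (expR (- alpha * t) * u_ n t)%:E)
  (fun t => (expR (- alpha * t) * u t)%:E)
  (fun t => M%:E * (expR (- alpha * t))%:E)%E.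
- by move=> n; apply/measurable_EFinP; exact: expRM_measurable (bu n).1.
- by apply/measurable_EFinP; exact: expRM_measurable bul.1.
- apply: aeW => t; rewrite /= in_itv/= andbT => t0.
  by apply: cvg_EFin; [exact: nearW|apply: cvgM; [exact: cvg_cst|exact: ul]].
- exact: integrableZl (expR_integrable a0).
- apply: aeW => t n; rewrite /= in_itv/= andbT => t0.
  rewrite lee_fin normrM (ger0_norm (expR_ge0 _)) mulrC ler_wpM2r ?expR_ge0//.
  by case: (bu n) => _; exact.
move=> _ _ I; rewrite /laplace /Rintegral.
apply: fine_cvg; rewrite fineK//.
exact: (integrable_fin_num mD (laplace_integrable a0 bul)).
Qed.

(** The probability density alpha e^(-alpha t) concentrates at 0. After subtraction of l, times
    before d contribute at most e/2, and the late part is exponentially small. *)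
Lemma laplace_abel M u l : bounded_signal M u -> u 0 = l ->
  u t @[t --> 0^'+] --> l -> alpha * laplace alpha u @[alpha --> +oo] --> l.
Proof.
move=> bu u0 ul; set K := M + `|l|.
have M0 : 0 <= M by apply: le_trans (bu.2 0 (lexx 0)).
have K0 : 0 <= K by rewrite addr_ge0.
have bv : bounded_signal K (fun t => u t + - l).
  by have := bounded_signalD bu (bounded_signal_cst (- l)); rewrite normrN.
apply/cvgrPdist_le => e e0; have e20 : 0 < e / 2 by rewrite divr_gt0.
have [d /= d0 hd] : \forall t \near 0^'+, `|l - u t| <= e / 2.
  by move/cvgrPdist_le/(_ _ e20) : ul.
have near_small t : 0 <= t -> t < d -> `|u t + - l| <= e / 2.
  rewrite le_eqVlt => /predU1P[<- _|t0 td]; first by rewrite u0 subrr normr0 ltW.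
  by rewrite distrC; apply: hd => //=; rewrite sub0r normrN gtr0_norm.
near=> alpha.
have a0 : 0 < alpha by near: alpha; apply: nbhs_pinfty_gt; rewrite num_real.
(* The late part will be 2 K w with w = e^(-x), x = alpha d/2. As x e^(-x) <= 1, this threshold
   makes it at most e/2. *)
have a1 : 8 * K / (d * e) <= alpha by near: alpha; apply: nbhs_pinfty_ge; rewrite num_real.
have a20 : 0 < alpha / 2 by rewrite divr_gt0.
have -> : l - alpha * laplace alpha u = - (alpha * laplace alpha (fun t => u t + - l)).
  rewrite (laplaceD a0 bu (bounded_signal_cst (- l))).
  rewrite -[X in _ + laplace _ X](_ : (fun t => - l * 1) = _); last first.
    by apply/funext => t; rewrite mulr1.
  rewrite (laplaceZ _ a0 (bounded_signal_cst 1)) laplace1//.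
  by field; rewrite gt_eqF.
rewrite normrN normrM gtr0_norm//.
(* For t >= d half of the exponent is spent on the small factor w and the other half keeps the bound
   integrable. *)
set w := expR (- (alpha * d / 2)).
have pw t : 0 <= t -> `|expR (- alpha * t) * (u t + - l)| <=
    e / 2 * expR (- alpha * t) + K * w * expR (- (alpha / 2) * t).
  move=> t0; rewrite normrM (ger0_norm (expR_ge0 _)).
  have [td|dt] := ltP t d.
    apply: ler_wpDr; first by rewrite !mulr_ge0 ?expR_ge0.
    by rewrite mulrC ler_wpM2r ?expR_ge0// near_small.
  apply: ler_wpDl; first by rewrite mulr_ge0 ?expR_ge0// ltW.
  rewrite mulrC -mulrA; apply: ler_pM; [exact: normr_ge0|exact: expR_ge0|exact: bv.2|].
  rewrite /w -expRD ler_expR.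
  have : alpha / 2 * d <= alpha / 2 * t by rewrite ler_wpM2l// ltW.
  lra.
have int1 := expR_integrable a0; have int2 := expR_integrable a20.
have I1 : leb.-integrable D (EFin \o (fun t => e / 2 * expR (- alpha * t))).
  by apply: eq_integrable (integrableZl mD (e / 2) int1).
have I2 : leb.-integrable D (EFin \o (fun t => K * w * expR (- (alpha / 2) * t))).
  by apply: eq_integrable (integrableZl mD (K * w) int2).
have I12 : leb.-integrable D (EFin \o (fun t => e / 2 * expR (- alpha * t) +
    K * w * expR (- (alpha / 2) * t))).
  by apply: eq_integrable (integrableD mD I1 I2).
have lap1 b : 0 < b -> \int[leb]_(t in D) expR (- b * t) = b^-1.
  by move=> b0; rewrite -laplace1// /laplace; under [RHS]eq_Rintegral do rewrite mulr1.
have bound : `|laplace alpha (fun t => u t + - l)| <=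
    e / 2 * alpha^-1 + K * w * (alpha / 2)^-1.
  have In := laplace_integrable a0 bv.
  apply: le_trans (le_normr_Rintegral mD In) _.
  rewrite -(lap1 _ a0) -(lap1 _ a20) -(RintegralZl _ mD int1) -(RintegralZl _ mD int2).
  rewrite -(RintegralD mD I1 I2); apply: le_Rintegral => //.
    have := integrable_norm In; apply: eq_integrable => //.
  by move=> t; rewrite /= in_itv/= andbT; exact: pw.
apply: le_trans (ler_wpM2l (ltW a0) bound) _.
have -> : alpha * (e / 2 * alpha^-1 + K * w * (alpha / 2)^-1) = e / 2 + 2 * K * w.
  by field; rewrite gt_eqF.
have w0 : 0 < w := expR_gt0 _.
have wx : (alpha * d / 2) * w <= 1.
  have x0 : 0 < alpha * d / 2 by rewrite divr_gt0// mulr_gt0.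
  rewrite /w expRN ler_pdivrMr ?expR_gt0// mul1r.
  have := @expR_ge1Dx R (alpha * d / 2); lra.
have : 2 * K * w <= e / 2.
  have Kw : 8 * K * w <= alpha * (d * e) * w.
    by apply: ler_wpM2r; [exact: ltW|rewrite -ler_pdivrMr// mulr_gt0].
  have : alpha * (d * e) * w <= 2 * e.
    rewrite (_ : alpha * (d * e) * w = 2 * e * (alpha * d / 2 * w)); last by field.
    by rewrite -[leRHS]mulr1 ler_wpM2l// mulr_ge0// ltW.
  lra.
lra.
Unshelve. all: by end_near. Qed.

End Laplace.

(** * Continuity of transition functions in time *)

Section Continuity.
Context {R : realType} {p : R -> nat -> nat -> R}.
Hypothesis P : standard_semigroup p.

(** Both bounds isolate the term k = i of the Chapman-Kolmogorov sum; the other terms add up to at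
    most 1 - p_h(i, i). The modulus does not depend on s. *)
Lemma sg_modulus h s i j : 0 <= h -> 0 <= s ->
  `|p (h + s) i j - p s i j| <= 1 - p h i i.
Proof.
move=> h0 s0; have hs0 : 0 <= h + s by rewrite addr_ge0.
have S : abs_summable (fun k => p h i k * p s k j).
  by apply: le_abs_summable (sg_row_summable i P h0) _ => k; exact: sg_mul_dom.
have ps1 := sg_le1 i j P s0; have ph1 := sg_le1 i i P h0.
have ps0 := sg_ge0 P i j s0; have ph0 := sg_ge0 P i i h0.
have low : p h i i * p s i j <= p (h + s) i j.
  rewrite (sg_add P)//; apply: (@term_le_rsum _ (fun k => p h i k * p s k j)) => // k.
  by rewrite mulr_ge0 ?(sg_ge0 P).
have up : p (h + s) i j <= 1 - p h i i * (1 - p s i j).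
  rewrite (sg_add P)//.
  have D0 k : p h i k * p s k j <= p h i k - (if k == i then p h i i * (1 - p s i j) else 0).
    have [->|ki] := eqVneq k i; first by rewrite le_eqVlt; apply/orP; left; apply/eqP; ring.
    by rewrite subr0 ler_piMr ?(sg_ge0 P)// (sg_le1 _ _ P).
  have Si : abs_summable (fun k => if k == i then p h i i * (1 - p s i j) else 0).
    by apply: (@abs_summable_finite _ _ i.+1) => k ik; rewrite gtn_eqF.
  have Sr := sg_row_summable i P h0.
  apply: le_trans (ler_rsum S (abs_summableB Sr Si) D0) _.
  rewrite rsumB//; apply: lerB.
    by apply: rsum_le_bound => // n; exact: (sg_row_le1 P).
  apply: le_trans (term_le_rsum i Si _); first by rewrite eqxx.
  by move=> k; case: eqP => // _; rewrite mulr_ge0// subr_ge0.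
by rewrite ler_norml; apply/andP; split; nra.
Qed.

(** The absolute value discards the negative times, where p is arbitrary, so that continuity on the
    whole line yields measurability. *)
Lemma sg_continuous i j : continuous (fun t : R => p `|t| i j).
Proof.
move=> t; apply/cvgrPdist_lt => e e0.
have [d /= d0 hd] : \forall h \near 0^'+, 1 - p h i i < e.
  have := sg_standard P (i := i) (j := i); rewrite eqxx => /cvgrPdist_lt/(_ _ e0).
  by apply: filterS => h; rewrite ltr_norml => /andP[_].
have key x y : 0 <= x -> x <= y -> y - x < d -> `|p y i j - p x i j| < e.
  move=> x0 xy yxd; have [->|ne] := eqVneq x y; first by rewrite subrr normr0.
  have yx0 : 0 < y - x by rewrite subr_gt0 lt_neqAle ne.
  have := sg_modulus i j (ltW yx0) x0; rewrite subrK => /le_lt_trans; apply.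
  by apply: hd => //=; rewrite sub0r normrN gtr0_norm.
near=> s; have ts : `|t - s| < d.
  by near: s; move: d0 => /[dup] d0; exact: (@cvgr_dist_lt _ _ _ (nbhs t) _ id t).
have [le|lt] := leP `|s| `|t|.
  apply: key => //; apply: le_lt_trans ts.
  exact: le_trans (ler_norm _) (ler_dist_dist t s).
rewrite distrC; apply: key => //; first exact: ltW.
apply: le_lt_trans ts; rewrite distrC.
exact: le_trans (ler_norm _) (ler_dist_dist s t).
Unshelve. all: by end_near. Qed.

Lemma sg_bounded_signal i j : bounded_signal 1 (fun t => p t i j).
Proof.
split; last by move=> t t0; rewrite ger0_norm ?(sg_ge0 P)// (sg_le1 _ _ P).
apply: (eq_measurable_fun (fun t : measurableTypeR R => p `|t| i j)).
  by move=> t; rewrite inE/= in_itv/= andbT => t0; rewrite ger0_norm.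
apply: measurable_funTS.
exact: (continuous_measurable_fun (@sg_continuous i j)).
Qed.

End Continuity.

(** * Ray resolvent and branching points *)

Section Branching.
Context {R : realType} {a b : nat -> R} {p : R -> nat -> nat -> R} {C kappa : R}.
Hypothesis ha0 : a 0%N = 0.
Hypothesis ha : forall k, (1 <= k)%N -> 0 < a k.
Hypothesis hb : forall k, 0 < b k.
Hypothesis hC : c a b n @[n --> \oo] --> C.
Hypothesis H : symmetric_semigroup (mu a b) p.
Hypothesis hQ : forall i j, t^-1 * (p t i j - p 0 i j) @[t --> 0^'+] --> Qmatrix a b i j.
Hypothesis kappa0 : 0 <= kappa.
Hypothesis hk : killing_limit (a := a) (b := b) (p := p) kappa.
Local Notation m := (mu a b).
Local Notation T := (semigroup_op p).
Local Notation P := (ss_base H).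

(** The transform is taken term by term: rows of mass at most 1 bound all partial sums by M, so
    bounded convergence applies. *)
Lemma op_signal M f i : (forall k, `|f k| <= M) ->
  bounded_signal M (fun t => T t f i) /\
  forall alpha, 0 < alpha ->
    series (fun k => laplace alpha (fun t => p t i k) * f k) @ \oo -->
    laplace alpha (fun t => T t f i).
Proof.
move=> fM; have M0 : 0 <= M by exact: le_trans (fM 0%N).
have bs k : bounded_signal `|f k| (fun t => p t i k * f k).
  have [mp p1] := sg_bounded_signal P i k; split.
    by apply: measurable_funM => //; exact: measurable_cst.
  by move=> t t0; rewrite normrM ler_piMl// p1.
have mS n : measurable_fun (`[0, +oo[%classic : set (measurableTypeR R))
    ((fun t => \sum_(0 <= k < n) p t i k * f k) : measurableTypeR R -> R).
  by apply: measurable_sum => k; exact: (bs k).1.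
have bS n : bounded_signal M (fun t => \sum_(0 <= k < n) p t i k * f k).
  split => // t t0; apply: le_trans (ler_norm_sum _ _ _) _.
  apply: (@le_trans _ _ (\sum_(0 <= k < n) p t i k * M)).
    by apply: ler_sum => k _; rewrite normrM ger0_norm ?(sg_ge0 P)// ler_wpM2l// (sg_ge0 P).
  by rewrite -mulr_suml ler_piMl// (sg_row_le1 P).
have cS t : 0 <= t -> \sum_(0 <= k < n) p t i k * f k @[n --> \oo] --> T t f i.
  by move=> t0; apply/abs_summable_cvg/(op_summable H _ t0)/(L2_L1 H)/(bounded_L2 H fM).
split; first exact: bounded_signal_lim bS cS.
move=> alpha a0; apply: cvg_trans (laplace_cvg a0 bS cS); apply: near_eq_cvg.
apply: nearW => n; elim: n => [|n IH].
  rewrite /series/= big_nil /laplace; under eq_Rintegral do rewrite big_geq// mulr0.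
  by rewrite Rintegral_cst// mul0r.
rewrite seriesSr/= -IH.
rewrite [LHS](_ : _ = laplace alpha (fun t => \sum_(0 <= k < n) p t i k * f k + f n * p t i n)).
  rewrite (laplaceD a0 (bS n) (N := `|f n|)); last first.
    by have := bs n; under eq_fun do rewrite mulrC.
  by rewrite (laplaceZ _ a0 (sg_bounded_signal P i n)) [f n * _]mulrC.
by apply: eq_laplace => t _; rewrite big_nat_recr//= [f n * _]mulrC.
Qed.

Lemma no_branching_point : branching_points p = set0.
Proof.
rewrite -subset0 => x nx; apply: nx => g cg.
(* The mass missing from p sits at the trap, where g - y0 vanishes. So the honest resolvent of g is
   y0/alpha plus the Laplace transform of T_t h. *)
set y0 := g None; pose h (y : Ninfty) := g (Some y) - y0; pose h0 k := h (Some k).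
have ch : continuous h.
  move=> y; have gy : g (Some z) @[z --> y] --> g (Some y).
    exact: cvg_comp (@one_point_compactification_some_continuous _ y) (cg (Some y)).
  exact: cvgB gy (cvg_cst y0).
have hoo := (Ninfty_continuousP h).1 ch.
have [M hM] : exists M, forall k, `|h0 k| <= M.
  by apply: cvgn_bounded; apply/cvg_ex; exists (h None).
have Lh : L2 m (h \o Some) by exact: (bounded_L2 H hM).
pose v (y : Ninfty) (t : R) := transition_op (extension p) t h y.
have v_some i t : 0 <= t -> T t h0 i = v (Some i) t.
  rewrite le_eqVlt => /predU1P[<-|t0]; first by rewrite /v extension_op0 (op_id H).
  by rewrite /v (extension_op ha hb hC H hQ).
have bv_some i : bounded_signal M (v (Some i)).
  by have [bT _] := op_signal i hM; exact: eq_bounded_signal (v_some i) bT.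
have cv t : 0 <= t -> v (Some i) t @[i --> \oo] --> v None t.
  rewrite le_eqVlt => /predU1P[<-|t0].
    by rewrite /v extension_op0; under eq_fun do rewrite extension_op0.
  rewrite /v (extension_op ha hb hC H hQ)//.
  under eq_fun do rewrite (extension_op ha hb hC H hQ)//.
  exact: (op_cvgn ha hb hC H hQ).
have bv y : bounded_signal M (v y).
  by case: y => [i//|]; exact: bounded_signal_lim bv_some cv.
have key y : alpha * (alpha^-1 * y0 + laplace alpha (v y)) @[alpha --> +oo] --> g (Some y).
  rewrite (_ : g (Some y) = y0 + h y); last by rewrite /h addrC subrK.
  have lv : alpha * laplace alpha (v y) @[alpha --> +oo] --> h y.
    apply: (laplace_abel (bv y)); first exact: extension_op0.
    exact: (extension_feller ha0 ha hb hC H hQ kappa0 hk).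
  have ylv : y0 + alpha * laplace alpha (v y) @[alpha --> +oo] --> y0 + h y.
    by apply: cvgD lv; exact: cvg_cst.
  apply: cvg_trans ylv; apply: near_eq_cvg; near=> alpha.
  have al0 : 0 < alpha by near: alpha; apply: nbhs_pinfty_gt; rewrite num_real.
  by rewrite /= mulrDr mulrA divff ?gt_eqF// mul1r.
have Rsome alpha i : 0 < alpha ->
    ray_resolvent p alpha g (Some (Some i)) = alpha^-1 * y0 + laplace alpha (v (Some i)).
  move=> al0; have le11 (k : nat) : `|1 : R| <= 1 by rewrite normr1.
  have [b1 /(_ alpha al0) l1] := op_signal i le11.
  have [_ /(_ alpha al0) l2] := op_signal i hM.
  rewrite (eq_laplace _ (v_some i)) in l2.
  have none : resolvent p alpha (Some i) None =
      alpha^-1 - laplace alpha (fun t => T t (fun=> 1) i).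
    rewrite -(laplace1 al0) -mulN1r -(laplaceZ (-1) al0 b1).
    rewrite -(laplaceD al0 (bounded_signal_cst 1) (N := 1)).
      apply: eq_laplace => t _ /=; rewrite mulN1r; congr (_ + - _).
      by apply: eq_rsum => k; rewrite mulr1.
    split; first by apply: measurable_funM b1.1; exact: measurable_cst.
    by move=> t t0; rewrite mulN1r normrN b1.2.
  rewrite /ray_resolvent /option_sum none -/y0.
  rewrite (cvg_lim _ (l := laplace alpha (v (Some i)) +
    y0 * laplace alpha (fun t => T t (fun=> 1) i)))//; first by ring.
  have {}l1 : y0 * series (fun k => laplace alpha (fun t => p t i k) * 1) n @[n --> \oo] -->
      y0 * laplace alpha (fun t => T t (fun=> 1) i).
    by apply: cvgM l1; exact: cvg_cst.
  apply: cvg_trans (cvgD l2 l1); apply: near_eq_cvg; apply: nearW => n.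
  rewrite -[LHS]/(series _ n + y0 * series _ n) /series/= mulr_sumr -big_split/=; apply: eq_bigr => k _.
  rewrite /h0 /h -[resolvent _ _ _ _]/(laplace alpha (fun t => p t i k)); ring.
case: x => [[i|]|].
- apply: cvg_trans (key (Some i)); apply: near_eq_cvg; near=> alpha.
  by rewrite Rsome//; near: alpha; apply: nbhs_pinfty_gt; rewrite num_real.
(* At oo the Ray resolvent is the limit of its values on N, which bounded convergence moves inside
   the Laplace transform. *)
- apply: cvg_trans (key None); apply: near_eq_cvg; near=> alpha.
  have al0 : 0 < alpha by near: alpha; apply: nbhs_pinfty_gt; rewrite num_real.
  congr (_ * _); apply/esym/cvg_lim => //.
  under eq_fun do rewrite -[option_sum _]/(ray_resolvent p alpha g (Some (Some _))) Rsome//.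
  by apply: cvgD; [exact: cvg_cst|exact: (laplace_cvg al0 bv_some cv)].
(* The trap is absorbing, so alpha times the resolvent there is y0 for every alpha > 0. *)
- apply: cvg_near_cst; near=> alpha.
  have al0 : 0 < alpha by near: alpha; apply: nbhs_pinfty_gt; rewrite num_real.
  rewrite /ray_resolvent /option_sum -[resolvent _ _ _ _]/(laplace alpha (fun=> 1)).
  rewrite laplace1// (@rsum_finite _ _ 0) ?big_geq// ?addr0 ?mulVKf ?gt_eqF// => k _.
  rewrite /resolvent/=; under eq_Rintegral do rewrite mulr0.
  by rewrite Rintegral_cst// !mul0r.
Unshelve. all: by end_near. Qed.

End Branching.

(** * Reversing measures *)

Section ReversingMeasure.
Context {R : realType} {a b : nat -> R} {p : R -> nat -> nat -> R}.
Hypothesis ha : forall k, (1 <= k)%N -> 0 < a k.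
Hypothesis hb : forall k, 0 < b k.
Local Notation m := (mu a b).

Lemma detailed_balance_mu (x : nat -> R) : Q_process a b p ->
  (forall t i j, 0 <= t -> x i * p t i j = x j * p t j i) ->
  forall k, x k = x 0%N * m k.
Proof.
move=> hp xp; have P := Q_process_standard hp; have [_ _ hQ] := hp.
have rate i j : i != j -> t^-1 * p t i j @[t --> 0^'+] --> Qmatrix a b i j.
  move=> ij; have := hQ i j; rewrite (sg_id P) (negbTE ij).
  by under eq_fun do rewrite subr0.
have bal k : x k * b k = x k.+1 * a k.+1.
  have n1 : k != k.+1 by rewrite neq_ltn ltnSn.
  have l1 : x k * (t^-1 * p t k k.+1) @[t --> 0^'+] --> x k * b k.
    apply: cvgM; first exact: cvg_cst.
    by have := rate _ _ n1; rewrite Qmatrix_up.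
  have l2 : x k.+1 * (t^-1 * p t k.+1 k) @[t --> 0^'+] --> x k.+1 * a k.+1.
    apply: cvgM; first exact: cvg_cst.
    by rewrite eq_sym in n1; have := rate _ _ n1; rewrite Qmatrix_down.
  apply: (cvg_unique _ l1) => //; apply: cvg_trans l2; apply: near_eq_cvg; near=> t.
  have t0 : 0 <= t by apply/ltW; near: t; exact: nbhs_right_gt.
  by rewrite /= !(mulrCA _ t^-1) xp.
elim=> [|k IH]; first by rewrite mu0 mulr1.
have a0 : a k.+1 != 0 by rewrite gt_eqF// ha.
by apply: (mulIf a0); rewrite -bal IH -[LHS]mulrA -[RHS]mulrA (mu_detailed ha).
Unshelve. all: by end_near. Qed.

Lemma symmetrizable_symmetric : abs_summable m -> Q_process a b p ->
  symmetrizable p -> symmetric_semigroup m p.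
Proof.
move=> sm hp [nu [[F FT Ffin] nu0 nup]].
have nufin i : nu [set i] \is a fin_num.
  have [n _ Fni] : (\bigcup_n F n) i by rewrite -FT.
  have [mF nuF] := Ffin n; rewrite ge0_fin_numE//.
  by apply: le_lt_trans nuF; apply: le_measure; rewrite ?inE// => j ->.
pose x i := fine (nu [set i]).
have xE i : nu [set i] = (x i)%:E by rewrite fineK.
have xp t i j : 0 <= t -> x i * p t i j = x j * p t j i.
  by move=> t0; have := nup t i j t0; rewrite !xE => -[].
have xm := detailed_balance_mu hp xp.
(* All point masses are multiples of [x 0]; were it 0, countable additivity would make nu null. *)
have x0 : x 0%N != 0.
  apply: contra nu0 => /eqP x0; apply/eqP.
  have nuk k : nu [set k] = 0%E by rewrite xE xm x0 mul0r.
  have -> : [set: nat] = \bigcup_k [set k] by rewrite bigcup_imset1 image_id.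
  rewrite measure_bigcup//.
    by apply: eseries0 => k _ _; rewrite nuk.
  by move=> i j _ _ [k [-> ->]].
split; [exact: mu_gt0|exact: sm|exact: Q_process_standard hp|].
by move=> t i j t0; have := xp t i j t0; rewrite (xm i) (xm j) -!mulrA => /(mulfI x0).
Qed.

Definition reversing_measure : {measure set nat -> \bar R} :=
  mseries (fun k => mscale (NngNum (ltW (mu_gt0 ha hb k))) \d_k) 0.

Lemma reversing_measure1 i : reversing_measure [set i] = (m i)%:E.
Proof.
rewrite /reversing_measure/= /mseries (nneseriesD1 (n := i)) => [|k _|//]; last exact: measure_ge0.
rewrite eseries0 => [|k _ /= ki].
  by rewrite adde0 -[LHS]/((m i)%:E * @dirac _ nat i R [set i])%E diracE mem_set// mule1.
rewrite -[LHS]/((m k)%:E * @dirac _ nat k R [set i])%E diracE memNset ?mule0//.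
by move=> ik; rewrite ik eqxx in ki.
Qed.

Lemma symmetric_symmetrizable :
  (forall t i j, 0 <= t -> m i * p t i j = m j * p t j i) -> symmetrizable p.
Proof.
move=> mp; exists reversing_measure; split.
- exists (fun i => [set i]); first by rewrite bigcup_imset1 image_id.
  by move=> i; rewrite reversing_measure1 ltry; split.
- rewrite gt_eqF//; apply: (@lt_le_trans _ _ (reversing_measure [set 0%N])).
    by rewrite reversing_measure1 lte_fin mu0.
  by apply: le_measure; rewrite ?inE.
- by move=> t i j t0; rewrite !reversing_measure1 -!EFinM mp.
Qed.

End ReversingMeasure.

(** * The two directions of the equivalence *)

Section Main.
Context {R : realType} {a b : nat -> R} {p : R -> nat -> nat -> R}.
Hypothesis ha0 : a 0%N = 0.
Hypothesis ha : forall k, (1 <= k)%N -> 0 < a k.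
Hypothesis hb : forall k, 0 < b k.
Hypothesis hreg : regular_boundary a b.
Hypothesis hp : Q_process a b p.
Local Notation m := (mu a b).

(** Non-minimality enters here, to exclude infinite killing. *)
Lemma symmetrizable_killing_limit : ~ minimal_Q_process a b p -> symmetrizable p ->
  exists C kappa : R, [/\ c a b n @[n --> \oo] --> C, symmetric_semigroup m p, 0 <= kappa &
    killing_limit (a := a) (b := b) (p := p) kappa].
Proof.
move=> hpmin sp; have [sm [C0 cC0]] := regular_summable ha hb hreg.
have H := symmetrizable_symmetric ha hb sm hp sp.
have hC : cvgn (c a b).
  apply: nondecreasing_is_cvgn => [i j|]; first exact: c_mono.
  by exists C0 => _ [k _ <-].
have [[kappa kappa0 hk]|hinf] := killing_dichotomy H.
  by exists (limn (c a b)), kappa.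
by case: hpmin; apply: (infinite_killing_minimal ha0 ha hb hC H hp hinf).
Qed.

(** Testing on indicators recovers the kernel, m_i p_t(i, j) = (T_t 1_j, 1_i), so the symmetry of T
    is the reversibility of p with respect to mu. *)
Lemma process_of_form_symmetrizable kappa pkappa :
  process_of_form m (domG a b) (formK a b kappa) pkappa ->
  (forall t i j, 0 <= t -> p t i j = pkappa t (Some i) (Some j)) -> symmetrizable p.
Proof.
move=> [[pk0 pk1 _] [_ [[T [[TL2 _ _ _ _] Tsym _ _] opT] _]]] pE.
apply: (symmetric_symmetrizable ha hb) => t i j t0.
pose ind (k : nat) (y : Ninfty) : R := (y == Some k)%:R.
have indS k : ind k \o Some = fun l => (l == k)%:R by [].
have bd k : bounded_fun (ind k).
  exists 1; split => // M M1 y _ /=; rewrite /ind.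
  by case: (y == _); rewrite ?normr1 ?normr0; [exact: ltW|apply: le_trans (ltW M1)].
have finL2 k : L2 m (ind k \o Some).
  apply/(nneseries_ltyP _).2; first by move=> l; rewrite mulr_ge0 ?sqr_ge0// ltW// mu_gt0.
  apply: (@abs_summable_finite _ _ k.+1) => l kl.
  by rewrite indS gtn_eqF// expr0n mulr0.
have val k l : T t (ind l \o Some) k = p t k l.
  have <- := congr1 (@^~ k) (opT t (ind l) t0 (bd l) (finL2 l)).
  rewrite /= /transition_op /option_sum pE// /ind mulr0 add0r.
  rewrite (@rsum_finite _ _ l.+1); last first.
    by move=> n ln; rewrite Ninfty_someE gtn_eqF// mulr0.
  rewrite big_nat_recr//= eqxx mulr1 big_nat big1 ?add0r// => n /andP[_ nl].
  by rewrite Ninfty_someE ltn_eqF// mulr0.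
have dotl k f : L2dot m f (ind k \o Some) = m k * f k.
  rewrite /L2dot (@rsum_finite _ _ k.+1); last first.
    by move=> n ln; rewrite indS gtn_eqF// mulr0.
  rewrite big_nat_recr//= /ind eqxx mulr1 big_nat big1 ?add0r// => n /andP[_ nl].
  by rewrite Ninfty_someE ltn_eqF// mulr0.
have := Tsym t _ _ t0 (finL2 j) (finL2 i).
rewrite dotl val => ->; rewrite (_ : L2dot m _ _ = L2dot m (T t (ind i \o Some)) (ind j \o Some)).
  by rewrite dotl val.
by apply: eq_rsum => k; rewrite mulrAC.
Qed.

End Main.

Theorem theorem7p3 (R : realType) (a b : nat -> R)
    (ha0 : a 0%N = 0) (ha : forall k, (1 <= k)%N -> 0 < a k)
    (hb : forall k, 0 < b k)
    (hreg : regular_boundary a b)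
    (p : R -> nat -> nat -> R)
    (hp : Q_process a b p) (hpmin : ~ minimal_Q_process a b p) :
  (symmetrizable p <->
     exists2 kappa : R, 0 <= kappa &
       exists2 pkappa : R -> Ninfty -> Ninfty -> R,
         process_of_form (mu a b) (domG a b) (formK a b kappa) pkappa &
         forall (t : R) (i j : nat), 0 <= t ->
           p t i j = pkappa t (Some i) (Some j)) /\
  (symmetrizable p -> branching_points p = set0).
Proof.
have [_ _ hQ] := hp.
have lim := symmetrizable_killing_limit ha0 ha hb hreg hp hpmin.
split; first split.
- move=> /lim[C [kappa [hC H kappa0 hk]]]; exists kappa => //; exists (extension p).
    exact: (extension_process ha0 ha hb hC H hQ kappa0 hk).
  move=> t i j t0; rewrite /extension; case: eqP => // ->.
  by rewrite Ninfty_someE (sg_id (ss_base H)).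
- by move=> [kappa _ [pkappa]]; exact: (process_of_form_symmetrizable ha hb).
- move=> /lim[C [kappa [hC H kappa0 hk]]].
  exact: (no_branching_point ha0 ha hb hC H hQ kappa0 hk).
Qed.
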